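(* The following two statements are equivalent: 1) For all separable metrizable spaces $X,Y$ and every function $f:X\to Y$, the game $G(f)$ is determined, i.e. either Player I or Player II has a winning strategy in $G(f)$. 2) $\mathsf{GBT}$: For all separable metrizable spaces $X,Y$ and every function $f: X\rightarrow Y$, $f$ is Baire class $1$ if and only if $f{\upharpoonright} K$ has a point of continuity for every nonempty compact $K\subseteq X$.
   Context: Base theory: the equivalence is to be understood over $\mathsf{ZF}$ together with $\mathsf{AC}_\omega(\mathbb{R})$ (every countable family of nonempty subsets of $\mathbb{R}$ has a choice function); the full axiom of choice is not assumed. A function $f:X\to Y$ between topological spaces is Baire class $1$ if for every open $V\subseteq Y$ the preimage $f^{-1}(V)$ is an $F_\sigma$ subset of $X$ (a countable union of closed subsets of $X$). A point of continuity of $f{\upharpoonright}K$ is a point $x\in K$ at which $f{\upharpoonright}K$ is continuous, where $K$ carries the subspace topology. Convergent sequences of open sets: a sequence $(U_n)_{n\in\mathbb{N}}$ of open subsets of a topological space $X$ is convergent if it is decreasing with respect to $\subseteq$ and it is a local basis of some $x\in X$ (i.e. $x\in U_n$ for all $n$, and every open neighborhood of $x$ contains some $U_n$); in that case it is said to converge to $x$. The game $G(f)$: let $X,Y$ be separable metrizable spaces and $f:X\to Y$. At round $n\in\mathbb{N}$, Player I plays a nonempty open subset $U_n$ of $X$, and then Player II plays a point $y_n\in\mathrm{ran}(f)$, with the rule that $U_{n+1}\subseteq U_n$ for every $n$. Player II wins the run if either the sequence $(U_n)_{n\in\mathbb{N}}$ is not convergent, or it converges to some $x\in X$ and $(y_n)_{n\in\mathbb{N}}$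 converges to $f(x)$ in $Y$; otherwise Player I wins the run. Strategies: a partial play of Player I is a nonempty finite $\subseteq$-decreasing sequence of nonempty open subsets of $X$; a partial play of Player II is a finite (possibly empty) sequence of elements of $\mathrm{ran}(f)$. A strategy for Player I is a function $\tau$ assigning to each partial play of Player II an open subset of $X$, respecting the rules of the game (the sets played are nonempty and decreasing along each play); it is winning if for every infinite sequence $(y_n)_{n\in\mathbb{N}}$ in $\mathrm{ran}(f)$, Player I wins the run in which Player I plays $U_n=\tau(y_0,\dots,y_{n-1})$ and Player II plays $y_n$ at each round $n$. A strategy for Player II is a function $\sigma$ assigning to each partial play of Player I an element of $\mathrm{ran}(f)$; it is winning if for every infinite $\subseteq$-decreasing sequence $(U_n)_{n\in\mathbb{N}}$ of nonempty open subsets of $X$, Player II wins the run in which Player I plays $U_n$ and Player II plays $y_n=\sigma(U_0,\dots,U_n)$ at each round $n$. *)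

(* Defs.v *)
(* The theorem is relative to the base theory ZF + AC_omega(R).  Rocq's ambient
   logic cannot play that role: with the usual choice axioms both sides of the
   equivalence are refutable.  So "provable in ZF + AC_omega(R)" is rendered,
   via completeness of first-order logic, as "true in every first-order model
   of ZF + AC_omega(R)": all the topology below takes place inside a model [M].
   Every notion below is a first-order formula about the membership relation of
   [M]; its Rocq predicates [P : M -> Prop] stand for definable classes. *)

Set Implicit Arguments.

(** * First-order models of ZF *)

Record structure := Structure { carrier :> Type; mem : carrier -> carrier -> Prop }.

Arguments mem {s} _ _.
Notation "x ∈ y" := (mem x y) (at level 70, no associativity).

(* De Bruijn formulas: index 0 is the most recently bound variable. *)
Inductive formula : Type :=
| Mem (i j : nat)
| Equ (i j : nat)
| Neg (p : formula)
| And (p q : formula)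
| Or (p q : formula)
| Imp (p q : formula)
| All (p : formula)
| Exi (p : formula).

Definition scons (T : Type) (x : T) (e : nat -> T) (n : nat) : T :=
  match n with O => x | S m => e m end.

Fixpoint sat (M : structure) (e : nat -> M) (p : formula) : Prop :=
  match p with
  | Mem i j => e i ∈ e j
  | Equ i j => e i = e j
  | Neg q => ~ sat M e q
  | And q r => sat M e q /\ sat M e r
  | Or q r => sat M e q \/ sat M e r
  | Imp q r => sat M e q -> sat M e r
  | All q => forall x : M, sat M (scons x e) q
  | Exi q => exists x : M, sat M (scons x e) q
  end.

Definition subset (M : structure) (a b : M) : Prop := forall z, z ∈ a -> z ∈ b.
Notation "a ⊆ b" := (subset _ a b) (at level 70, no associativity).

Definition empty (M : structure) (a : M) : Prop := forall z, ~ z ∈ a.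
Definition nonempty (M : structure) (a : M) : Prop := exists z, z ∈ a.

(* b = n ∪ {n} *)
Definition is_succ (M : structure) (b n : M) : Prop :=
  forall z, z ∈ b <-> z ∈ n \/ z = n.

Definition inductive (M : structure) (w : M) : Prop :=
  (exists o, empty M o /\ o ∈ w) /\
  (forall n, n ∈ w -> exists m, is_succ M m n /\ m ∈ w).

Record ZF (M : structure) : Prop := {
  zf_extensionality : forall a b : M, (forall z, z ∈ a <-> z ∈ b) -> a = b;
  zf_foundation : forall a : M, nonempty M a ->
    exists x, x ∈ a /\ forall z, z ∈ x -> ~ z ∈ a;
  zf_pairing : forall a b : M, exists c, forall z, z ∈ c <-> z = a \/ z = b;
  zf_union : forall a : M, exists u, forall z, z ∈ u <-> exists x, x ∈ a /\ z ∈ x;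
  zf_power : forall a : M, exists p, forall z, z ∈ p <-> z ⊆ a;
  zf_infinity : exists w : M, inductive M w;
  zf_separation : forall (p : formula) (e : nat -> M) (a : M),
    exists b, forall x, x ∈ b <-> x ∈ a /\ sat M (scons x e) p;
  zf_replacement : forall (p : formula) (e : nat -> M) (a : M),
    (forall x, x ∈ a -> forall y y',
       sat M (scons x (scons y e)) p -> sat M (scons x (scons y' e)) p -> y = y') ->
    exists b, forall y, y ∈ b <-> exists x, x ∈ a /\ sat M (scons x (scons y e)) p
}.

(** * Functions, natural numbers, cardinality inside a model *)

(* Kuratowski pair: p = {{x}, {x, y}} *)
Definition is_pair (M : structure) (p x y : M) : Prop :=
  forall z, z ∈ p <->
    (forall t, t ∈ z <-> t = x) \/ (forall t, t ∈ z <-> t = x \/ t = y).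

(* (x, y) ∈ g; for a function g this reads g(x) = y *)
Definition app (M : structure) (g x y : M) : Prop :=
  exists p, is_pair M p x y /\ p ∈ g.

Definition is_map (M : structure) (g : M) (A B : M -> Prop) : Prop :=
  (forall p, p ∈ g -> exists x y, A x /\ B y /\ is_pair M p x y) /\
  (forall x, A x -> exists! y, app M g x y).

(* Membership in omega, the least inductive set. *)
Definition is_nat (M : structure) (n : M) : Prop :=
  forall w, inductive M w -> n ∈ w.

Definition injects (M : structure) (a : M) (B : M -> Prop) : Prop :=
  exists g, is_map M g (fun x => x ∈ a) B /\
    forall x x' y, app M g x y -> app M g x' y -> x = x'.

Definition finite (M : structure) (a : M) : Prop :=
  exists n, is_nat M n /\ injects M a (fun i => i ∈ n).

Definition countable (M : structure) (a : M) : Prop := injects M a (is_nat M).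

(** * The reals of a model: a Dedekind-complete ordered field *)

Record field_data (M : structure) := FieldData {
  car : M; addg : M; mulg : M; ltg : M; zero : M; one : M
}.

(* op g x y z reads g(x, y) = z *)
Definition op (M : structure) (g x y z : M) : Prop :=
  exists p, is_pair M p x y /\ app M g p z.

Definition in_prod (M : structure) (A B p : M) : Prop :=
  exists x y, x ∈ A /\ y ∈ B /\ is_pair M p x y.

Definition lt (M : structure) (R : field_data M) (x y : M) : Prop := app M (ltg R) x y.

Record complete_ordered_field (M : structure) (R : field_data M) : Prop := {
  cof_add_map : is_map M (addg R) (in_prod M (car R) (car R)) (fun z => z ∈ car R);
  cof_mul_map : is_map M (mulg R) (in_prod M (car R) (car R)) (fun z => z ∈ car R);
  cof_lt_rel : forall p, p ∈ ltg R -> in_prod M (car R) (car R) p;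
  cof_zero : zero R ∈ car R;
  cof_one : one R ∈ car R;
  cof_zero_one : zero R <> one R;
  cof_addC : forall x y z, op M (addg R) x y z -> op M (addg R) y x z;
  cof_addA : forall x y z xy yz t,
    op M (addg R) x y xy -> op M (addg R) y z yz ->
    op M (addg R) xy z t -> op M (addg R) x yz t;
  cof_add0 : forall x, x ∈ car R -> op M (addg R) x (zero R) x;
  cof_opp : forall x, x ∈ car R -> exists y, op M (addg R) x y (zero R);
  cof_mulC : forall x y z, op M (mulg R) x y z -> op M (mulg R) y x z;
  cof_mulA : forall x y z xy yz t,
    op M (mulg R) x y xy -> op M (mulg R) y z yz ->
    op M (mulg R) xy z t -> op M (mulg R) x yz t;
  cof_mul1 : forall x, x ∈ car R -> op M (mulg R) x (one R) x;
  cof_inv : forall x, x ∈ car R -> x <> zero R -> exists y, op M (mulg R) x y (one R);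
  cof_distr : forall x y z yz xy xz t,
    op M (addg R) y z yz -> op M (mulg R) x y xy -> op M (mulg R) x z xz ->
    op M (mulg R) x yz t -> op M (addg R) xy xz t;
  cof_lt_irr : forall x, ~ lt R x x;
  cof_lt_trans : forall x y z, lt R x y -> lt R y z -> lt R x z;
  cof_lt_total : forall x y, x ∈ car R -> y ∈ car R -> lt R x y \/ x = y \/ lt R y x;
  cof_lt_add : forall x y z xz yz, lt R x y ->
    op M (addg R) x z xz -> op M (addg R) y z yz -> lt R xz yz;
  cof_lt_mul : forall x y xy, lt R (zero R) x -> lt R (zero R) y ->
    op M (mulg R) x y xy -> lt R (zero R) xy;
  cof_complete : forall a, a ⊆ car R -> nonempty M a ->
    (exists u, u ∈ car R /\ forall x, x ∈ a -> ~ lt R u x) ->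
    exists s, s ∈ car R /\ (forall x, x ∈ a -> ~ lt R s x) /\
      forall u, u ∈ car R -> (forall x, x ∈ a -> ~ lt R u x) -> ~ lt R u s
}.

Definition AC_omega_R (M : structure) (R : field_data M) : Prop :=
  forall F : M, countable M F ->
    (forall a, a ∈ F -> a ⊆ car R /\ nonempty M a) ->
    exists c, is_map M c (fun a => a ∈ F) (fun r => r ∈ car R) /\
      forall a r, app M c a r -> r ∈ a.

(** * Separable metrizable spaces *)

Record space (M : structure) := Space { pts : M; opens : M }.

Definition metric (M : structure) (R : field_data M) (X d : M) : Prop :=
  is_map M d (in_prod M X X) (fun r => r ∈ car R) /\
  (forall x y r, op M d x y r -> ~ lt R r (zero R)) /\
  (forall x y, x ∈ X -> y ∈ X -> (op M d x y (zero R) <-> x = y)) /\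
  (forall x y r, op M d x y r -> op M d y x r) /\
  (forall x y z a b c s, op M d x y a -> op M d y z b -> op M d x z c ->
     op M (addg R) a b s -> ~ lt R s c).

Definition metric_open (M : structure) (R : field_data M) (X d U : M) : Prop :=
  U ⊆ X /\
  forall x, x ∈ U -> exists eps, lt R (zero R) eps /\
    forall y r, y ∈ X -> op M d x y r -> lt R r eps -> y ∈ U.

(* No separate topology axioms: they follow, the opens being those of a metric. *)
Definition metrizable (M : structure) (R : field_data M) (X : space M) : Prop :=
  exists d, metric R (pts X) d /\
    forall U, U ∈ opens X <-> metric_open R (pts X) d U.

Definition separable (M : structure) (X : space M) : Prop :=
  exists D, D ⊆ pts X /\ countable M D /\
    forall U, U ∈ opens X -> nonempty M U -> exists x, x ∈ D /\ x ∈ U.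

Definition sep_metrizable (M : structure) (R : field_data M) (X : space M) : Prop :=
  metrizable R X /\ separable X.

Definition is_closed (M : structure) (X : space M) (C : M) : Prop :=
  C ⊆ pts X /\ exists U, U ∈ opens X /\ forall x, x ∈ pts X -> (x ∈ C <-> ~ x ∈ U).

(* Compactness of K as a subspace, with covers by open sets of X. *)
Definition compact (M : structure) (X : space M) (K : M) : Prop :=
  forall F, F ⊆ opens X -> (forall x, x ∈ K -> exists U, U ∈ F /\ x ∈ U) ->
    exists G, G ⊆ F /\ finite M G /\ forall x, x ∈ K -> exists U, U ∈ G /\ x ∈ U.

Definition function (M : structure) (X Y : space M) (f : M) : Prop :=
  is_map M f (fun x => x ∈ pts X) (fun y => y ∈ pts Y).

Definition F_sigma (M : structure) (X : space M) (A : M -> Prop) : Prop :=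
  exists F, countable M F /\ (forall C, C ∈ F -> is_closed X C) /\
    forall x, A x <-> exists C, C ∈ F /\ x ∈ C.

Definition Baire_class_1 (M : structure) (X Y : space M) (f : M) : Prop :=
  forall V, V ∈ opens Y -> F_sigma X (fun x => exists y, app M f x y /\ y ∈ V).

(* f|K is continuous at x, with the subspace topology on K *)
Definition continuity_point (M : structure) (X Y : space M) (f K x : M) : Prop :=
  x ∈ K /\
  forall y V, app M f x y -> V ∈ opens Y -> y ∈ V ->
    exists U, U ∈ opens X /\ x ∈ U /\
      forall x' y', x' ∈ U -> x' ∈ K -> app M f x' y' -> y' ∈ V.

(** * The game G(f) *)

Definition ran (M : structure) (f y : M) : Prop := exists x, app M f x y.

Definition move_I (M : structure) (X : space M) (U : M) : Prop :=
  U ∈ opens X /\ nonempty M U.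

Definition decreasing (M : structure) (s : M) : Prop :=
  forall i j A B, is_succ M j i -> app M s i A -> app M s j B -> B ⊆ A.

(* Runs are indexed by omega; finite sequences of length n by the von Neumann
   numeral n = {0, ..., n-1}. *)
Definition run_I (M : structure) (X : space M) (U : M) : Prop :=
  is_map M U (is_nat M) (move_I X) /\ decreasing M U.

Definition run_II (M : structure) (f y : M) : Prop :=
  is_map M y (is_nat M) (ran M f).

Definition partial_play_I (M : structure) (X : space M) (s : M) : Prop :=
  exists n, is_nat M n /\ nonempty M n /\
    is_map M s (fun i => i ∈ n) (move_I X) /\ decreasing M s.

Definition partial_play_II (M : structure) (f s : M) : Prop :=
  exists n, is_nat M n /\ is_map M s (fun i => i ∈ n) (ran M f).

(* s is the restriction of the sequence u to n = {0, ..., n-1} *)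
Definition init_seg (M : structure) (s n u : M) : Prop :=
  s ⊆ u /\ is_map M s (fun i => i ∈ n) (fun _ => True).

Definition converges_opens (M : structure) (X : space M) (U x : M) : Prop :=
  x ∈ pts X /\ decreasing M U /\
  (forall n A, app M U n A -> x ∈ A) /\
  (forall V, V ∈ opens X -> x ∈ V -> exists n A, app M U n A /\ A ⊆ V).

(* N ⊆ n is the order N <= n on von Neumann numerals. *)
Definition converges_pts (M : structure) (Y : space M) (y l : M) : Prop :=
  l ∈ pts Y /\
  forall V, V ∈ opens Y -> l ∈ V ->
    exists N, is_nat M N /\ forall n v, N ⊆ n -> app M y n v -> v ∈ V.

Definition II_wins_run (M : structure) (X Y : space M) (f U y : M) : Prop :=
  ~ (exists x, converges_opens X U x) \/
  exists x fx, converges_opens X U x /\ app M f x fx /\ converges_pts Y y fx.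

(* The last condition says that Player I's sets decrease along each play: t ⊆ t'
   means that the finite sequence t' extends t. *)
Definition strategy_I (M : structure) (X : space M) (f tau : M) : Prop :=
  is_map M tau (partial_play_II M f) (move_I X) /\
  forall t t' A A', t ⊆ t' -> app M tau t A -> app M tau t' A' -> A' ⊆ A.

(* U_n = tau(y_0, ..., y_{n-1}) for all n *)
Definition I_follows (M : structure) (tau U y : M) : Prop :=
  forall n A, app M U n A -> exists s, init_seg M s n y /\ app M tau s A.

Definition winning_I (M : structure) (X Y : space M) (f tau : M) : Prop :=
  strategy_I X f tau /\
  forall U y, run_I X U -> run_II M f y -> I_follows M tau U y ->
    ~ II_wins_run X Y f U y.

Definition strategy_II (M : structure) (X : space M) (f sigma : M) : Prop :=
  is_map M sigma (partial_play_I X) (ran M f).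

(* y_n = sigma(U_0, ..., U_n) for all n *)
Definition II_follows (M : structure) (sigma U y : M) : Prop :=
  forall n v, app M y n v ->
    exists m s, is_succ M m n /\ init_seg M s m U /\ app M sigma s v.

Definition winning_II (M : structure) (X Y : space M) (f sigma : M) : Prop :=
  strategy_II X f sigma /\
  forall U y, run_I X U -> run_II M f y -> II_follows M sigma U y ->
    II_wins_run X Y f U y.

Definition determined (M : structure) (X Y : space M) (f : M) : Prop :=
  (exists tau, winning_I X Y f tau) \/ (exists sigma, winning_II X Y f sigma).

Definition all_games_determined (M : structure) (R : field_data M) : Prop :=
  forall (X Y : space M) (f : M),
    sep_metrizable R X -> sep_metrizable R Y -> function X Y f ->
    determined X Y f.

Definition GBT (M : structure) (R : field_data M) : Prop :=
  forall (X Y : space M) (f : M),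
    sep_metrizable R X -> sep_metrizable R Y -> function X Y f ->
    (Baire_class_1 X Y f <->
     forall K, K ⊆ pts X -> nonempty M K -> compact X K ->
       exists x, continuity_point X Y f K x).

(* Main.v *)
Set Warnings "-notation-overridden,-ambiguous-paths,-redundant-canonical-projection".
From HB Require Import structures.
From mathcomp Require Import all_boot all_order all_algebra ring lra.
From mathcomp Require boolp.
From Stdlib Require Import FunctionalExtensionality ClassicalEpsilon.
Require Import Defs.

Set Implicit Arguments.
Unset Strict Implicit.
Unset Printing Implicit Defensive.
Import Order.TTheory GRing.Theory Num.Theory.

(** Let [f : X -> Y] be a function between separable metrizable spaces of the model. Four
    facts relate the game to the two sides of the Baire characterization.

    - If [f] is Baire class 1, then Player II wins ([II_wins_of_Baire1]). There are countably
      many pairs of a closed [C] and an open [V] with [f(C) ⊆ V] that determine [f]; facing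
      the open set [U], Player II obeys as many as possible of the first constraints [y ∈ V]
      for the pairs such that [C] meets [U].
    - If Player II wins, then [f] is Baire class 1 ([Baire1_of_II_wins]): [f(x)] lies in an
      open set when some play through basic open sets containing [x] forces all later answers
      of the strategy into a smaller one, and this is a countable union of closed conditions
      on [x].
    - If [f] restricted to a nonempty compact [K] has no continuity point, then Player I wins
      ([I_wins_of_compact]). By the Baire category theorem, two subsets of [K] whose images
      are far apart are both dense in a relatively open part of [K]; Player I aims at a point
      of one of them and turns to the other whenever the answer comes close to the image of
      the target.
    - If Player I wins, then there is such a [K] ([compact_of_I_wins]). Let Player II play in
      a countable dense subset of the range. Some finite play must have all its continuations
      followed by limits whose images meet two fixed sets that are far apart: otherwise Player
      II could settle one such pair after the other and converge to the image of the limit.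
      A compactly branching tree of runs that keeps jumping between the two sets has a compact
      set of limits, on which [f] oscillates at every point.

    A Baire class 1 function has continuity points on compact sets ([Baire1_continuity]),
    again by the Baire category theorem, and the equivalence follows.

    All the objects built in these arguments are sets of a model of [ZF], so each
    comprehension and recursion must be given by a formula with parameters. Instead of writing
    formulas, set operations are functions of the ambient logic on the model, and [dfn], [tdef]
    say that a predicate or an operation is definable; the tactic [df] proves such goals by
    recursion on the shape of the expression. Choice is available only for countable families
    of sets of reals; it is extended to families of subsets of [P(C)] for [C] countable
    ([countable_choice]) by a ternary expansion, and this covers points of separable spaces,
    sequences of closed sets, and sequences in a countable set. *)

(** * Definability with parameters *)

Existing Class ZF.

Section Definability.
Context {M : structure}.
Implicit Types (e c : nat -> M) (P Q : (nat -> M) -> Prop).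

(** The environment with the parameters [c] in even positions and the variables [e] in odd
    ones. *)
Definition mix c e : nat -> M := fun n => if odd n then e n./2 else c n./2.

(** A predicate on environments is definable if a formula with parameters expresses it. *)
Definition dfn P : Prop :=
  exists (p : formula) (c : nat -> M), forall e, sat M (mix c e) p <-> P e.

(** An operation on environments is definable if its graph is; the value is variable 0. *)
Definition tdef (t : (nat -> M) -> M) : Prop :=
  dfn (fun e => e 0 = t (fun n => e n.+1)).

(* The renaming [r] under a quantifier. *)
Definition up (r : nat -> nat) n := if n is m.+1 then (r m).+1 else 0.

Fixpoint ren (r : nat -> nat) (p : formula) : formula :=
  match p with
  | Mem i j => Mem (r i) (r j)
  | Equ i j => Equ (r i) (r j)
  | Neg q => Neg (ren r q)
  | And q s => And (ren r q) (ren r s)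
  | Or q s => Or (ren r q) (ren r s)
  | Imp q s => Imp (ren r q) (ren r s)
  | All q => All (ren (up r) q)
  | Exi q => Exi (ren (up r) q)
  end.

Lemma scons_up r (x : M) e :
  (fun n => scons x e (up r n)) = scons x (fun n => e (r n)).
Proof. by apply: functional_extensionality; case. Qed.

Lemma sat_ren p r e : sat M e (ren r p) <-> sat M (fun n => e (r n)) p.
Proof.
elim: p r e => [i j|i j|q IH|q IHq s IHs|q IHq s IHs|q IHq s IHs|q IH|q IH] r e //=.
- by rewrite IH.
- by rewrite IHq IHs.
- by rewrite IHq IHs.
- by rewrite IHq IHs.
- by split=> H x; move: (H x); rewrite IH scons_up.
- by split=> -[x H]; exists x; move: H; rewrite IH scons_up.
Qed.

Lemma dfn_ext P Q : (forall e, P e <-> Q e) -> dfn P -> dfn Q.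
Proof. by move=> PQ [p [c H]]; exists p, c => e; rewrite H. Qed.

Lemma mixS c e n : mix c e n.*2.+1 = e n.
Proof. by rewrite /mix /= odd_double /= uphalf_double. Qed.

Lemma mix0 c e n : mix c e n.*2 = c n.
Proof. by rewrite /mix odd_double doubleK. Qed.

Lemma parityP n : exists m, n = m.*2 \/ n = m.*2.+1.
Proof.
exists n./2; rewrite -{1 3}(odd_double_half n).
by case: (odd n); [right|left].
Qed.

(* Renaming the variables of a definable predicate. *)
Lemma dfn_ren P r : dfn P -> dfn (fun e => P (fun n => e (r n))).
Proof.
move=> [p [c H]]; exists (ren (fun n => if odd n then (r n./2).*2.+1 else n) p), c => e.
rewrite sat_ren -H.
suff -> : (fun n => mix c e (if odd n then (r n./2).*2.+1 else n))
  = mix c (fun n => e (r n)) by [].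
apply: functional_extensionality => n; case: (parityP n) => m [] ->.
- by rewrite odd_double !mix0.
- by rewrite /= odd_double /= uphalf_double !mixS.
Qed.

(* Two predicates can be expressed with a common list of parameters. *)
Lemma dfn_merge P Q : dfn P -> dfn Q -> exists p q c,
  (forall e, sat M (mix c e) p <-> P e) /\ (forall e, sat M (mix c e) q <-> Q e).
Proof.
move=> [p [c H]] [q [d K]].
exists (ren (fun n => if odd n then n else n.*2) p).
exists (ren (fun n => if odd n then n else n.+1.*2) q), (mix c d).
split=> e; rewrite sat_ren -?H -?K.
- suff -> : (fun n => mix (mix c d) e (if odd n then n else n.*2)) = mix c e by [].
  apply: functional_extensionality => n; case: (parityP n) => m [] ->.
  + by rewrite odd_double !mix0.
  + by rewrite /= odd_double /= !mixS.
- suff -> : (fun n => mix (mix c d) e (if odd n then n else n.+1.*2)) = mix d e by [].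
  apply: functional_extensionality => n; case: (parityP n) => m [] ->.
  + by rewrite odd_double mix0 mixS mix0.
  + by rewrite /= odd_double /= !mixS.
Qed.


End Definability.

Section Connectives.
Context {M : structure} {hZF : ZF M}.
Implicit Types (e c : nat -> M) (P Q : (nat -> M) -> Prop).

Lemma inhabited_model : inhabited M.
Proof. by have [w _] := zf_infinity hZF; exists. Qed.

(* The junk value of definite descriptions. *)
Definition dflt : M := epsilon inhabited_model (fun _ => True).

(** A proposition of the ambient logic that does not mention the variables is definable,
    being true or false. *)
Lemma dfn_prop (A : Prop) : dfn (fun _ : nat -> M => A).
Proof.
case: (excluded_middle_informative A) => [a|na].
- by exists (All (Equ 0 0)), (fun _ => dflt) => e /=.
- exists (Neg (All (Equ 0 0))), (fun _ => dflt) => e /=.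
  by split=> [H|//]; case: H.
Qed.

Lemma dfn_not P : dfn P -> dfn (fun e => ~ P e).
Proof. by move=> [p [c H]]; exists (Neg p), c => e /=; rewrite H. Qed.

Lemma dfn_and P Q : dfn P -> dfn Q -> dfn (fun e => P e /\ Q e).
Proof.
move=> H K; have [p [q [c [Hp Hq]]]] := dfn_merge H K.
by exists (And p q), c => e /=; rewrite Hp Hq.
Qed.

Lemma dfn_or P Q : dfn P -> dfn Q -> dfn (fun e => P e \/ Q e).
Proof.
move=> H K; have [p [q [c [Hp Hq]]]] := dfn_merge H K.
by exists (Or p q), c => e /=; rewrite Hp Hq.
Qed.

Lemma dfn_imp P Q : dfn P -> dfn Q -> dfn (fun e => P e -> Q e).
Proof.
move=> H K; have [p [q [c [Hp Hq]]]] := dfn_merge H K.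
by exists (Imp p q), c => e /=; rewrite Hp Hq.
Qed.

Lemma dfn_iff P Q : dfn P -> dfn Q -> dfn (fun e => P e <-> Q e).
Proof. by move=> H K; apply: dfn_and; apply: dfn_imp. Qed.

Lemma mix_scons (c e : nat -> M) (x : M) :
  (fun n => scons x (mix c e) (if odd n then n.-1 else n.+1)) = mix c (scons x e).
Proof.
apply: functional_extensionality => n; case: (parityP n) => -[|m] [] -> //.
- by rewrite odd_double [LHS]mix0 mix0.
- by rewrite mixS /= odd_double /= (mixS c e m).
Qed.

Lemma dfn_all (Q : (nat -> M) -> M -> Prop) :
  dfn (fun e => Q (fun n => e n.+1) (e 0)) -> dfn (fun e => forall x, Q e x).
Proof.
move=> [p [c H]]; exists (All (ren (fun n => if odd n then n.-1 else n.+1) p)), c => e /=.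
by split=> K x; move: (K x); rewrite sat_ren mix_scons H.
Qed.

Lemma dfn_ex (Q : (nat -> M) -> M -> Prop) :
  dfn (fun e => Q (fun n => e n.+1) (e 0)) -> dfn (fun e => exists x, Q e x).
Proof.
move=> [p [c H]]; exists (Exi (ren (fun n => if odd n then n.-1 else n.+1) p)), c => e /=.
by split=> -[x K]; exists x; move: K; rewrite sat_ren mix_scons H.
Qed.

Lemma tdef_var i : tdef (fun e : nat -> M => e i).
Proof. by exists (Equ 1 i.+1.*2.+1), (fun _ => dflt) => e; rewrite /= mixS. Qed.

Lemma tdef_const (a : M) : tdef (fun _ => a).
Proof. by exists (Equ 1 0), (fun _ => a) => e. Qed.

Lemma tdef_ren (t : (nat -> M) -> M) r : tdef t -> tdef (fun e => t (fun n => e (r n))).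
Proof. by move=> H; apply: (@dfn_ren _ _ (up r) H). Qed.

Lemma dfn_let (P : (nat -> M) -> M -> Prop) t :
  dfn (fun e => P (fun n => e n.+1) (e 0)) -> tdef t -> dfn (fun e => P e (t e)).
Proof.
move=> HP Ht; apply: (@dfn_ext _ (fun e => exists a, a = t e /\ P e a)).
  by move=> e; split=> [[a [->]]|H] //; exists (t e).
by apply/dfn_ex/dfn_and.
Qed.

Lemma dfn_mem t u : tdef t -> tdef u -> dfn (fun e : nat -> M => t e ∈ u e).
Proof.
move=> Ht Hu; apply: (dfn_let (P := fun e x => x ∈ u e) _ Ht).
apply: (@dfn_let (fun e x => e 0 ∈ x) (fun e => u (fun n => e n.+1)) _ (tdef_ren S Hu)).
by exists (Mem 3 1), (fun _ => dflt) => e.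
Qed.

Lemma dfn_eq t u : tdef t -> tdef u -> dfn (fun e : nat -> M => t e = u e).
Proof. by move=> Ht Hu; apply: (dfn_let (P := fun e x => x = u e) Hu Ht). Qed.

Lemma dfn_app (P : (nat -> M) -> M -> Prop) :
  dfn (fun e => P (fun n => e n.+1) (e 0)) ->
  forall r t, tdef t -> dfn (fun e => P (fun n => e (r n)) (t e)).
Proof.
move=> HP r t; move=> Ht; apply: (@dfn_let (fun e x => P (fun n => e (r n)) x) _ _ Ht).
exact: (dfn_ren (up r) HP).
Qed.

Lemma tdef_app (F : (nat -> M) -> M -> M) :
  tdef (fun e => F (fun n => e n.+1) (e 0)) ->
  forall r t, tdef t -> tdef (fun e => F (fun n => e (r n)) (t e)).
Proof.
move=> HF r t Ht.
apply: (@dfn_let (fun e x => e 0 = F (fun n => e (r n).+1) x) (fun e => t (fun n => e n.+1))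
  _ (tdef_ren S Ht)).
exact: (@dfn_ren _ _ (fun n => match n with 0 => 1 | 1 => 0 | k.+2 => (r k).+2 end) HF).
Qed.

Lemma tdef_app2 (F : (nat -> M) -> M -> M -> M) :
  tdef (fun e => F (fun n => e n.+2) (e 1) (e 0)) ->
  forall r t u, tdef t -> tdef u -> tdef (fun e => F (fun n => e (r n)) (t e) (u e)).
Proof.
move=> HF r t u Ht Hu.
apply: (@dfn_let (fun e x => e 0 = F (fun n => e (r n).+1) x (u (fun n => e n.+1)))
  (fun e => t (fun n => e n.+1)) _ (tdef_ren S Ht)).
apply: (@dfn_let (fun e x => e 1 = F (fun n => e (r n).+2) (e 0) x)
  (fun e => u (fun n => e n.+2)) _ (tdef_ren (fun n => n.+2) Hu)).
exact: (@dfn_ren _ _ (fun n => match n with 0 => 2 | 1 => 0 | 2 => 1 | k.+3 => (r k).+3 end) HF).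
Qed.

Lemma dfn_app2 (F : (nat -> M) -> M -> M -> Prop) :
  dfn (fun e => F (fun n => e n.+2) (e 1) (e 0)) ->
  forall r t u, tdef t -> tdef u -> dfn (fun e => F (fun n => e (r n)) (t e) (u e)).
Proof.
move=> HF r t u Ht Hu.
apply: (@dfn_let (fun e x => F (fun n => e (r n)) x (u e)) t _ Ht).
apply: (@dfn_let (fun e x => F (fun n => e (r n).+1) (e 0) x)
  (fun e => u (fun n => e n.+1)) _ (tdef_ren S Hu)).
exact: (@dfn_ren _ _ (fun n => match n with 0 => 0 | 1 => 1 | k.+2 => (r k).+2 end) HF).
Qed.

Lemma tdef_ext t u : (forall e, t e = u e) -> tdef t -> tdef u.
Proof. by move=> E; apply: dfn_ext => e; rewrite E. Qed.

(* Here and below, an operation is taken from an opaque existence proof, so that it is never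
   unfolded by conversion and only its equation is used. *)
Fact iota_sig : {f : (M -> Prop) -> M | forall P : M -> Prop, f P = epsilon inhabited_model
    (fun z => (exists! x, P x) /\ P z \/ ~ (exists! x, P x) /\ z = dflt)}.
Proof. by eexists. Qed.
(** Definite description: the unique [z] with [P z], a fixed element if there is none. *)
Definition iota : (M -> Prop) -> M := proj1_sig iota_sig.

Lemma iota_graph (P : M -> Prop) z :
  z = iota P <-> (exists! x, P x) /\ P z \/ ~ (exists! x, P x) /\ z = dflt.
Proof.
have H : (exists! x, P x) /\ P (iota P) \/ ~ (exists! x, P x) /\ iota P = dflt.
  rewrite /iota (proj2_sig iota_sig).
  apply: (epsilon_spec inhabited_model
    (fun z => (exists! x, P x) /\ P z \/ ~ (exists! x, P x) /\ z = dflt)).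
  case: (excluded_middle_informative (exists! x, P x)) => [K|K].
    by have [x [Hx _]] := K; exists x; left.
  by exists dflt; right.
split=> [->//|[[K Hz]|[K ->]]]; case: H => -[K' H] //.
by have [x [_ U]] := K; rewrite -(U _ Hz) (U _ H).
Qed.

Lemma iotaP (P : M -> Prop) : (exists! x, P x) -> P (iota P).
Proof. by move=> K; case: ((iota_graph P (iota P)).1 erefl) => -[]. Qed.

Lemma iota_eq (P : M -> Prop) z : P z -> (forall y, P y -> y = z) -> iota P = z.
Proof. by move=> Hz U; symmetry; apply/iota_graph; left; split=> //; exists z; split=> // y /U. Qed.

Lemma dfn_ex1 (Q : (nat -> M) -> M -> Prop) :
  dfn (fun e => Q (fun n => e n.+1) (e 0)) -> dfn (fun e => exists! x, Q e x).
Proof.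
move=> HQ; apply/dfn_ex/dfn_and => //; apply/dfn_all/dfn_imp.
  exact: (dfn_app HQ (fun n => n.+2) (tdef_var 0)).
exact: (dfn_eq (tdef_var 1) (tdef_var 0)).
Qed.

Lemma tdef_iota (P : (nat -> M) -> M -> Prop) :
  dfn (fun e => P (fun n => e n.+1) (e 0)) -> tdef (fun e => iota (P e)).
Proof.
move=> HP; apply: (dfn_ext (fun e => iff_sym (iota_graph _ _))).
have H1 : dfn (fun e => exists! x, P (fun n => e n.+1) x).
  by apply: dfn_ex1; exact: (dfn_app HP (fun n => n.+2) (tdef_var 0)).
apply: dfn_or; apply: dfn_and => //; first exact: dfn_not.
exact: (dfn_eq (tdef_var 0) (tdef_const dflt)).
Qed.

End Connectives.

(* Closes a goal by a definability hypothesis, up to a change of arguments. *)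
Ltac dfn_hyp :=
  match goal with
  | H : ?T |- _ =>
    lazymatch T with
    | tdef (fun e => ?F (fun n => e n.+2) (e 1) (e 0)) =>
      lazymatch goal with
      | |- tdef (fun e => F (fun n => e (@?r n)) (@?t e) (@?u e)) =>
          apply (tdef_app2 (F := F) H r (t := t) (u := u))
      | |- tdef (fun e => F e (@?t e) (@?u e)) =>
          apply (tdef_app2 (F := F) H id (t := t) (u := u))
      end
    | tdef (fun e => ?F (fun n => e n.+1) (e 0)) =>
      lazymatch goal with
      | |- tdef (fun e => F (fun n => e (@?r n)) (@?t e)) =>
          apply (tdef_app (F := F) H r (t := t))
      | |- tdef (fun e => F e (@?t e)) => apply (tdef_app (F := F) H id (t := t))
      end
    | dfn (fun e => ?F (fun n => e n.+1) (e 0)) =>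
      lazymatch goal with
      | |- dfn (fun e => F (fun n => e (@?r n)) (@?t e)) =>
          apply (dfn_app (P := F) H r (t := t))
      | |- dfn (fun e => F e (@?t e)) => apply (dfn_app (P := F) H id (t := t))
      end
    | tdef (fun e => ?F (e 1) (e 0)) =>
      lazymatch goal with
      | |- tdef (fun e => F (@?t e) (@?u e)) =>
          apply (tdef_app2 (F := fun _ => F) H id (t := t) (u := u))
      end
    | dfn (fun e => ?F (e 1) (e 0)) =>
      lazymatch goal with
      | |- dfn (fun e => F (@?t e) (@?u e)) =>
          apply (dfn_app2 (F := fun _ => F) H id (t := t) (u := u))
      end
    | tdef (fun e => ?F (e 0)) =>
      lazymatch goal with
      | |- tdef (fun e => F (@?t e)) => apply (tdef_app (F := fun _ => F) H id (t := t))
      end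
    | dfn (fun e => ?F (e 0)) =>
      lazymatch goal with
      | |- dfn (fun e => F (@?t e)) => apply (dfn_app (P := fun _ => F) H id (t := t))
      end
    | dfn ?P => 
      lazymatch goal with
      | |- dfn (fun e => P (fun n => e (@?r n))) => apply (dfn_ren (P := P) r H)
      end
    | tdef ?t =>
      lazymatch goal with
      | |- tdef (fun e => t (fun n => e (@?r n))) => apply (tdef_ren (t := t) r H)
      end
    end
  end.

(* Rules for the operations introduced below; each of these tactics is extended there. *)
Ltac dfn_reg1 := fail.
Ltac dfn_reg2 := fail.
Ltac dfn_reg3 := fail.
Ltac dfn_reg4 := fail.

(* Proves [dfn] and [tdef] goals by recursion on the expression. *)
Ltac df :=
  intros; cbv beta;
  lazymatch goal with
  | |- dfn (fun _ => ?A) => exact (dfn_prop A)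
  | |- dfn (fun e => ~ (@?P e)) => apply (dfn_not (P := P)); df
  | |- dfn (fun e => (@?P e) /\ (@?Q e)) => apply (dfn_and (P := P) (Q := Q)); df
  | |- dfn (fun e => (@?P e) \/ (@?Q e)) => apply (dfn_or (P := P) (Q := Q)); df
  | |- dfn (fun e => (@?P e) <-> (@?Q e)) => apply (dfn_iff (P := P) (Q := Q)); df
  | |- dfn (fun e => (@?P e) -> (@?Q e)) => apply (dfn_imp (P := P) (Q := Q)); df
  | |- dfn (fun e => forall x, @?Q e x) => apply (dfn_all (Q := Q)); df
  | |- dfn (fun e => exists x, @?Q e x) => apply (dfn_ex (Q := Q)); df
  | |- dfn (fun e => exists! x, @?Q e x) => apply (dfn_ex1 (Q := Q)); df
  | |- dfn (fun e => mem (@?t e) (@?u e)) => apply (dfn_mem (t := t) (u := u)); df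
  | |- dfn (fun e => @?t e = @?u e) =>
      first [apply (dfn_eq (t := t) (u := u)) | dfn_reg2]; df
  | |- tdef (fun _ => ?a) => exact (tdef_const a)
  | |- tdef (fun e => e ?i) => exact (tdef_var i)
  | |- tdef (fun e => iota (@?P e)) => apply (tdef_iota (P := P)); df
  | |- _ => first [assumption | dfn_hyp | dfn_reg1 | dfn_reg2 | dfn_reg4 | dfn_reg3]; df
  end.

Global Opaque iota dfn.

(** * Sets, pairs and functions of the model *)

Section Sets.
Context {M : structure} {hZF : ZF M}.
Implicit Types (a b c g n m k x y z p : M).

Lemma ext a b : (forall z, z ∈ a <-> z ∈ b) -> a = b.
Proof. exact: zf_extensionality. Qed.

Fact setof_sig : {f : (M -> Prop) -> M | forall P, f P = iota (fun b => forall x, x ∈ b <-> P x)}.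
Proof. by eexists. Qed.
(** The set of all [x] with [P x]; junk if that class is not a set. *)
Definition setof : (M -> Prop) -> M := proj1_sig setof_sig.
Definition setofE P : setof P = iota (fun b => forall x, x ∈ b <-> P x) :=
  proj2_sig setof_sig P.

Lemma in_setof (P : M -> Prop) : (exists b, forall x, x ∈ b <-> P x) ->
  forall x, x ∈ setof P <-> P x.
Proof.
move=> [b Hb]; suff -> : setof P = b by [].
by rewrite setofE; apply: iota_eq => // c Hc; apply: ext => z; rewrite Hb Hc.
Qed.

Lemma tdef_setof (P : (nat -> M) -> M -> Prop) :
  dfn (fun e => P (fun i => e i.+1) (e 0)) -> tdef (fun e => setof (P e)).
Proof. by move=> HP; apply: (tdef_ext (fun e => esym (setofE _))); df. Qed.

(** The empty set, [{x ∈ a | P x}], [{F x | x ∈ a}], [{a, b}], the union of the members of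
    [a], the power set, and the binary union. *)
Definition emp : M := setof (fun _ => False).
Definition sep a (P : M -> Prop) : M := setof (fun x => x ∈ a /\ P x).
Definition img a (F : M -> M) : M := setof (fun y => exists x, x ∈ a /\ y = F x).
Definition upr a b : M := setof (fun x => x = a \/ x = b).
Definition bigU a : M := setof (fun x => exists y, y ∈ a /\ x ∈ y).
Definition pow a : M := setof (fun x => x ⊆ a).
Definition cup a b : M := bigU (upr a b).
Fact pr_sig : {f : M -> M -> M | forall x y, f x y = upr (upr x x) (upr x y)}.
Proof. by eexists. Qed.
(** The Kuratowski pair. *)
Definition pr : M -> M -> M := proj1_sig pr_sig.
Definition prE x y : pr x y = upr (upr x x) (upr x y) := proj2_sig pr_sig x y.

Lemma in_sep a (P : M -> Prop) : dfn (fun e => P (e 0)) ->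
  forall x, x ∈ sep a P <-> x ∈ a /\ P x.
Proof.
move=> [p [c H]]; apply: in_setof.
have [b Hb] := zf_separation hZF
  (ren (fun i => if odd i then i./2 else i./2.+1) p) c a.
exists b => x; rewrite Hb sat_ren.
rewrite -(H (scons x c)).
suff -> : (fun i => scons x c (if odd i then i./2 else i./2.+1)) = mix c (scons x c) by [].
apply: functional_extensionality => i; case: (parityP i) => j [] ->.
- by rewrite odd_double doubleK mix0.
- by rewrite /= odd_double /= uphalf_double mixS.
Qed.

Lemma in_img a (F : M -> M) : tdef (fun e => F (e 0)) ->
  forall y, y ∈ img a F <-> exists x, x ∈ a /\ y = F x.
Proof.
move=> HF; apply: in_setof.
have [p [c H]] : dfn (fun e => e 1 = F (e 0)) by df.
pose r i := if odd i then i./2 else i./2.+2.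
have S x y : sat M (scons x (scons y c)) (ren r p) <-> y = F x.
  rewrite sat_ren -(H (scons x (scons y c))).
  suff -> : (fun i => scons x (scons y c) (r i)) = mix c (scons x (scons y c)) by [].
  apply: functional_extensionality => i; rewrite /r; case: (parityP i) => j [] ->.
  - by rewrite odd_double doubleK mix0.
  - by rewrite /= odd_double /= uphalf_double mixS.
have [|b Hb] := zf_replacement hZF (ren r p) c a.
  by move=> x _ y y'; rewrite !S => -> ->.
exists b => y; rewrite Hb; split=> -[x [xa Hx]]; exists x; split=> //; exact/S.
Qed.

Lemma in_upr a b x : x ∈ upr a b <-> x = a \/ x = b.
Proof. by move: x; apply/in_setof/(zf_pairing hZF). Qed.

Lemma in_bigU a x : x ∈ bigU a <-> exists y, y ∈ a /\ x ∈ y.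
Proof. by move: x; apply/in_setof/(zf_union hZF). Qed.

Lemma in_pow a x : x ∈ pow a <-> x ⊆ a.
Proof. by move: x; apply/in_setof/(zf_power hZF). Qed.

Lemma in_emp x : ~ x ∈ emp.
Proof.
rewrite in_setof //; exists (sep dflt (fun _ => False)) => z.
by rewrite in_sep; [tauto|exact: dfn_prop].
Qed.

Lemma empP a : empty M a <-> a = emp.
Proof.
split=> [H|->]; last exact: in_emp.
by apply: ext => z; split=> // [/H|/in_emp].
Qed.

Lemma nonemptyP a : a <> emp <-> nonempty M a.
Proof.
split=> [H|[z Hz] E]; last by apply: (@in_emp z); rewrite -E.
by apply: NNPP => K; apply/H/empP => z Hz; apply: K; exists z.
Qed.

Lemma in_cup a b x : x ∈ cup a b <-> x ∈ a \/ x ∈ b.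
Proof.
rewrite in_bigU; split=> [[y [/in_upr [->|->] H]]|[H|H]]; [by left|by right| |].
- by exists a; split=> //; apply/in_upr; left.
- by exists b; split=> //; apply/in_upr; right.
Qed.

Lemma is_pairP p x y : is_pair M p x y <-> p = pr x y.
Proof.
have E z : (forall t, t ∈ z <-> t = x) \/ (forall t, t ∈ z <-> t = x \/ t = y) <->
  z ∈ pr x y.
  rewrite prE in_upr; split=> -[H|H]; [left|right|left|right].
  - by apply: ext => t; rewrite H in_upr; tauto.
  - by apply: ext => t; rewrite H in_upr.
  - by move=> t; rewrite H in_upr; tauto.
  - by move=> t; rewrite H in_upr.
by split=> [H|-> z]; [apply: ext => z; rewrite H E|rewrite E].
Qed.

Lemma pr_inj x y x' y' : pr x y = pr x' y' -> x = x' /\ y = y'.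
Proof.
have H u v : is_pair M (pr u v) u v by apply/is_pairP.
move=> E.
have Ex : x = x'.
  have /H K : upr x x ∈ pr x' y' by rewrite -E prE; apply/in_upr; left.
  have xx : x ∈ upr x x by apply/in_upr; left.
  case: K => K; first by apply/(K x).1.
  by have /in_upr [|] : x' ∈ upr x x by apply/K; left.
split=> //; subst x'.
have Hy u v : pr x u = pr x v -> u = v \/ u = x.
  move=> E'; have K : upr x u = upr x x \/ upr x u = upr x v.
    by apply/in_upr; rewrite -prE -E' prE; apply/in_upr; right.
  have uu : u ∈ upr x u by apply/in_upr; right.
  by case: K => K; rewrite K in uu; case/in_upr: uu; auto.
case: (Hy _ _ E) => // y_x; case: (Hy _ _ (esym E)) => // y'x; congruence.
Qed.

Lemma tdef_sep t (P : (nat -> M) -> M -> Prop) : tdef t ->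
  dfn (fun e => P (fun i => e i.+1) (e 0)) -> tdef (fun e => sep (t e) (P e)).
Proof. by move=> Ht HP; rewrite /sep; apply: tdef_setof; df. Qed.

Lemma tdef_img t (F : (nat -> M) -> M -> M) : tdef t ->
  tdef (fun e => F (fun i => e i.+1) (e 0)) -> tdef (fun e => img (t e) (F e)).
Proof. by move=> Ht HF; rewrite /img; apply: tdef_setof; df. Qed.

Lemma tdef_upr t u : tdef t -> tdef u -> tdef (fun e : nat -> M => upr (t e) (u e)).
Proof. by move=> Ht Hu; rewrite /upr; apply: tdef_setof; df. Qed.

Lemma tdef_bigU t : tdef t -> tdef (fun e : nat -> M => bigU (t e)).
Proof. by move=> Ht; rewrite /bigU; apply: tdef_setof; df. Qed.

Lemma tdef_pow t : tdef t -> tdef (fun e : nat -> M => pow (t e)).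
Proof. by move=> Ht; rewrite /pow /subset; apply: tdef_setof; df. Qed.

Lemma tdef_cup t u : tdef t -> tdef u -> tdef (fun e : nat -> M => cup (t e) (u e)).
Proof. by move=> Ht Hu; apply/tdef_bigU/tdef_upr. Qed.

Lemma tdef_pr t u : tdef t -> tdef u -> tdef (fun e : nat -> M => pr (t e) (u e)).
Proof. by move=> Ht Hu; apply: (tdef_ext (fun e => esym (prE _ _))); apply/tdef_upr; apply/tdef_upr. Qed.

End Sets.

Ltac dfn_reg1 ::= first
  [ simple apply tdef_setof | simple apply tdef_sep | simple apply tdef_img
  | simple apply tdef_upr | simple apply tdef_bigU | simple apply tdef_pow
  | simple apply tdef_cup | simple apply tdef_pr ].
Ltac dfn_reg3 ::= progress unfold subset, empty, nonempty, is_succ, inductive, is_pair, app,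
  is_map, is_nat, injects, finite, countable, op, in_prod.

Section Maps.
Context {M : structure} {hZF : ZF M}.
Implicit Types (a b c g n m k x y z p : M) (A B : M -> Prop).

Fact ap_sig : {f : M -> M -> M | forall g x, f g x = iota (fun y => pr x y ∈ g)}.
Proof. by eexists. Qed.
(** The value of [g] at [x]; junk if [g] has none or several. *)
Definition ap : M -> M -> M := proj1_sig ap_sig.
Definition apE g x : ap g x = iota (fun y => pr x y ∈ g) := proj2_sig ap_sig g x.
(** The function [x |-> F x] on [a]. *)
Definition lam a (F : M -> M) : M := img a (fun x => pr x (F x)).
(** Definition by cases. *)
Definition ite (P : Prop) x y : M := iota (fun z => P /\ z = x \/ ~ P /\ z = y).
(** The Cartesian product. *)
Definition prod a b : M := bigU (img a (fun x => img b (fun y => pr x y))).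

Lemma tdef_ap t u : tdef t -> tdef u -> tdef (fun e : nat -> M => ap (t e) (u e)).
Proof. by move=> Ht Hu; apply: (tdef_ext (fun e => esym (apE _ _))); df. Qed.

Lemma tdef_lam t (F : (nat -> M) -> M -> M) : tdef t ->
  tdef (fun e => F (fun i => e i.+1) (e 0)) -> tdef (fun e => lam (t e) (F e)).
Proof. by move=> Ht HF; rewrite /lam; df. Qed.

Lemma tdef_ite P t u : dfn P -> tdef t -> tdef u ->
  tdef (fun e : nat -> M => ite (P e) (t e) (u e)).
Proof. by move=> HP Ht Hu; rewrite /ite; df. Qed.

Lemma tdef_prod t u : tdef t -> tdef u -> tdef (fun e : nat -> M => prod (t e) (u e)).
Proof. by move=> Ht Hu; rewrite /prod; df. Qed.

Lemma ite_true (P : Prop) x y : P -> ite P x y = x.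
Proof. by move=> H; apply: iota_eq; [left|move=> z [[]|[]]]. Qed.

Lemma ite_false (P : Prop) x y : ~ P -> ite P x y = y.
Proof. by move=> H; apply: iota_eq; [right|move=> z [[]|[]]]. Qed.

Lemma in_prodP a b p : p ∈ prod a b <-> exists x y, x ∈ a /\ y ∈ b /\ p = pr x y.
Proof.
have D x : tdef (fun e : nat -> M => pr x (e 0)) by df.
rewrite in_bigU; split=> [[c [/in_img Hc Hp]]|[x [y [xa [yb ->]]]]].
  have [|x [xa ?]] := Hc; first by df.
  by subst c; move/in_img: Hp => /(_ (D x)) [y [yb ->]]; exists x, y.
exists (img b (fun y => pr x y)); split; apply/in_img; try by df.
- by exists x.
- by exists y.
Qed.

Lemma pr_in_prod a b x y : pr x y ∈ prod a b <-> x ∈ a /\ y ∈ b.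
Proof.
rewrite in_prodP; split=> [[u [v [ua [vb /pr_inj [-> ->]]]]] //|[xa yb]].
by exists x, y.
Qed.

Lemma in_prodE a b p : in_prod M a b p <-> p ∈ prod a b.
Proof.
by rewrite in_prodP; split=> -[x [y [xa [yb /is_pairP H]]]]; exists x, y.
Qed.

Lemma appP g x y : app M g x y <-> pr x y ∈ g.
Proof. by split=> [[p [/is_pairP ->]]|H] //; exists (pr x y); split=> //; apply/is_pairP. Qed.

Lemma opP g x y z : op M g x y z <-> pr (pr x y) z ∈ g.
Proof.
split=> [[p [/is_pairP -> /appP]]|H] //; exists (pr x y).
by split; [apply/is_pairP|apply/appP].
Qed.

Lemma map_intro g A B : (forall p, p ∈ g -> exists x y, A x /\ B y /\ p = pr x y) ->
  (forall x, A x -> exists! y, pr x y ∈ g) -> is_map M g A B.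
Proof.
move=> H1 H2; split=> [p /H1 [x [y [Ax [By ->]]]]|x /H2 [y [Hy U]]].
  by exists x, y; do 2!split=> //; apply/is_pairP.
by exists y; split; [exact/appP|move=> y' /appP /U].
Qed.

Lemma map_pr g A B x : is_map M g A B -> A x -> pr x (ap g x) ∈ g.
Proof.
move=> [_ H] /H [y [/appP Hy U]]; rewrite apE; apply: (iotaP (P := fun y => pr x y ∈ g)).
by exists y; split=> // y' Hy'; apply/U/appP.
Qed.

Lemma map_dom g A B x y : is_map M g A B -> pr x y ∈ g -> A x /\ B y.
Proof. by move=> [H _] /H [u [v [Au [Bv /is_pairP /pr_inj [-> ->]]]]]. Qed.

Lemma map_ap g A B x y : is_map M g A B -> pr x y ∈ g -> ap g x = y.
Proof.
move=> Hg H; have [Ax _] := map_dom Hg H; case: (Hg) => _ /(_ x Ax) [z [Hz U]].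
have E1 : z = y by apply/U/appP.
have E2 : z = ap g x by apply/U/appP; exact: (map_pr Hg Ax).
by rewrite -E1 -E2.
Qed.

Lemma map_val g A B x : is_map M g A B -> A x -> B (ap g x).
Proof. by move=> Hg Ax; have [] := map_dom Hg (map_pr Hg Ax). Qed.

Lemma map_in g A B p : is_map M g A B -> p ∈ g -> exists x, A x /\ p = pr x (ap g x).
Proof.
move=> Hg Hp; case: (Hg) => /(_ p Hp) [x [y [Ax [By /is_pairP E]]]] _.
by exists x; split=> //; rewrite (map_ap (y := y) Hg) // -E.
Qed.

Lemma map_app g A B x y : is_map M g A B -> app M g x y <-> A x /\ y = ap g x.
Proof.
move=> Hg; split=> [/appP H|[Ax ->]]; last by apply/appP; exact: (map_pr Hg Ax).
by split; [have [] := map_dom Hg H|rewrite (map_ap Hg H)].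
Qed.

Lemma map_sub g g' A B A' B' : is_map M g A B -> is_map M g' A' B' ->
  (forall x, A x -> A' x /\ ap g x = ap g' x) -> g ⊆ g'.
Proof.
move=> Hg Hg' H p /(map_in Hg) [x [Ax ->]].
by have [A'x ->] := H x Ax; apply: map_pr Hg' A'x.
Qed.

Lemma map_ext g g' A B A' B' : is_map M g A B -> is_map M g' A' B' ->
  (forall x, A x <-> A' x) -> (forall x, A x -> ap g x = ap g' x) -> g = g'.
Proof.
move=> Hg Hg' HA H; apply: ext => p; split.
- by apply: (map_sub Hg Hg') => x Ax; split; [apply/HA|apply: H].
- by apply: (map_sub Hg' Hg) => x /HA Ax; split=> //; rewrite H.
Qed.

Lemma map_mono g A B (A' B' : M -> Prop) : is_map M g A B ->
  (forall x, A x <-> A' x) -> (forall x, A x -> B (ap g x) -> B' (ap g x)) -> is_map M g A' B'.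
Proof.
move=> Hg HA HB; apply: map_intro => [p /(map_in Hg) [x [Ax ->]]|x /HA Ax].
  exists x, (ap g x); split; first exact/HA.
  by split=> //; apply: HB => //; apply: map_val Hg Ax.
by exists (ap g x); split; [apply: map_pr Hg Ax|move=> y /(map_ap Hg)].
Qed.

Section Lam.
Variables (a : M) (F : M -> M).
Hypothesis HF : tdef (fun e => F (e 0)).

Lemma in_lam p : p ∈ lam a F <-> exists x, x ∈ a /\ p = pr x (F x).
Proof. by apply: in_img; df. Qed.

Lemma lam_map A B : (forall x, x ∈ a <-> A x) -> (forall x, x ∈ a -> B (F x)) ->
  is_map M (lam a F) A B.
Proof.
move=> HA HB; apply: map_intro => [p /in_lam [x [xa ->]]|x /HA xa].
  by exists x, (F x); split; [apply/HA|split=> //; apply: HB].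
exists (F x); split; first by apply/in_lam; exists x.
by move=> y /in_lam [x' [_ /pr_inj [-> ->]]].
Qed.

Lemma lam_mapT : is_map M (lam a F) (fun x => x ∈ a) (fun _ => True).
Proof. exact: lam_map. Qed.

Lemma ap_lam x : x ∈ a -> ap (lam a F) x = F x.
Proof. by move=> xa; apply: (map_ap lam_mapT); apply/in_lam; exists x. Qed.
End Lam.

End Maps.

Ltac dfn_reg1 ::= first
  [ simple apply tdef_ap | simple apply tdef_pr | simple apply tdef_sep
  | simple apply tdef_img | simple apply tdef_lam | simple apply tdef_ite
  | simple apply tdef_prod | simple apply tdef_setof
  | simple apply tdef_upr | simple apply tdef_bigU | simple apply tdef_pow
  | simple apply tdef_cup ].

(** * Natural numbers of the model *)

Section Omega.
Context {M : structure} {hZF : ZF M}.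
Implicit Types (a b c g n m k x y z p : M) (A B : M -> Prop).

(** The successor [n ∪ {n}]. *)
Definition succ n : M := cup n (upr n n).

Lemma tdef_succ t : tdef t -> tdef (fun e : nat -> M => succ (t e)).
Proof. by move=> Ht; rewrite /succ; df. Qed.

Lemma in_succ n z : z ∈ succ n <-> z ∈ n \/ z = n.
Proof. by rewrite in_cup in_upr; tauto. Qed.

Lemma is_succP m n : is_succ M m n <-> m = succ n.
Proof. by split=> [H|-> z]; [apply: ext => z; rewrite H in_succ|rewrite in_succ]. Qed.

(** The set omega; [n ∈ m] and [n ⊆ m] are the orders [n < m] and [n <= m] on it. *)
Definition om : M := setof (is_nat M).

Lemma in_om n : n ∈ om <-> is_nat M n.
Proof.
apply: in_setof; have [w Hw] := zf_infinity hZF.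
exists (sep w (is_nat M)) => x; rewrite in_sep; last by df.
by split=> [[]|H] //; split=> //; apply: H.
Qed.

Lemma om_emp : emp ∈ om.
Proof. by apply/in_om => w [[o [/empP ->]]]. Qed.

Lemma om_succ n : n ∈ om -> succ n ∈ om.
Proof.
move=> /in_om Hn; apply/in_om => w Hw; case: (Hw) => _ /(_ n (Hn w Hw)).
by move=> [m [/is_succP ->]].
Qed.

(** Induction is available for definable predicates only. *)
Lemma om_ind (P : M -> Prop) : dfn (fun e => P (e 0)) ->
  P emp -> (forall n, n ∈ om -> P n -> P (succ n)) -> forall n, n ∈ om -> P n.
Proof.
move=> HP P0 PS n /in_om Hn.
have H : inductive M (sep om P); last by case: ((in_sep om HP n).1 (Hn _ H)).
split=> [|k /(in_sep om HP) [Hk Pk]].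
- exists emp; split; first exact/empP.
  by apply/in_sep => //; split=> //; exact: om_emp.
- exists (succ k); split; first exact/is_succP.
  by apply/in_sep => //; split; [exact: om_succ|exact: PS].
Qed.

Lemma om_trans n m k : n ∈ om -> m ∈ n -> k ∈ m -> k ∈ n.
Proof.
move=> Hn; move: n Hn m k.
apply: (om_ind (P := fun n => forall m k, m ∈ n -> k ∈ m -> k ∈ n)); first by df.
  by move=> m k /in_emp.
move=> n Hn IH m k /in_succ [H|->] K; apply/in_succ; left=> //; exact: IH H K.
Qed.

Lemma om_in n m : n ∈ om -> m ∈ n -> m ∈ om.
Proof.
move=> Hn; move: n Hn m.
apply: (om_ind (P := fun n => forall m, m ∈ n -> m ∈ om)); first by df.
  by move=> m /in_emp.
by move=> n Hn IH m /in_succ [/IH|->].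
Qed.

Lemma mem_asym x y : x ∈ y -> ~ y ∈ x.
Proof.
move=> xy yx; have [|z [/in_upr H K]] := zf_foundation hZF (a := upr x y).
  by exists x; apply/in_upr; left.
by case: H => ?; subst z; [apply: (K y)|apply: (K x)] => //; apply/in_upr; tauto.
Qed.

Lemma mem_irr x : ~ x ∈ x.
Proof. by move=> H; apply: (mem_asym H H). Qed.

Lemma om0 n : n ∈ om -> n = emp \/ emp ∈ n.
Proof.
move: n; apply: (om_ind (P := fun n => n = emp \/ emp ∈ n)); first by df.
  by left.
by move=> n _ [->|H]; right; apply/in_succ; auto.
Qed.

Lemma om_succ_le n m : n ∈ om -> m ∈ n -> succ m = n \/ succ m ∈ n.
Proof.
move=> Hn; move: n Hn m.
apply: (om_ind (P := fun n => forall m, m ∈ n -> succ m = n \/ succ m ∈ n)).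
- by rewrite /succ; df.
- by move=> m /in_emp.
- by move=> n Hn IH m /in_succ [/IH [<-|H]|->]; [right|right|left=> //]; apply/in_succ; auto.
Qed.

Lemma om_total n m : n ∈ om -> m ∈ om -> n ∈ m \/ n = m \/ m ∈ n.
Proof.
move=> Hn Hm; move: n Hn.
apply: (om_ind (P := fun n => n ∈ m \/ n = m \/ m ∈ n)); first by df.
  by case: (om0 Hm); auto.
move=> n Hn [/(om_succ_le Hm) [|]|[<-|H]]; auto.
- by right; right; apply/in_succ; auto.
- by right; right; apply/in_succ; auto.
Qed.

Lemma om_sub n m : n ∈ om -> m ∈ om -> n ⊆ m <-> n ∈ m \/ n = m.
Proof.
move=> Hn Hm; split=> [H|[H|->] z] //; last by move=> zn; apply: om_trans zn.
by case: (om_total Hn Hm) => [|[|/H /mem_irr]]; auto.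
Qed.

Lemma om_nle n m : n ∈ om -> m ∈ om -> ~ n ∈ m -> m ⊆ n.
Proof. by move=> Hn Hm H; apply/om_sub => //; case: (om_total Hn Hm) => [|[|]]; auto. Qed.

Lemma in_succ_sub n m : n ∈ om -> m ∈ om -> n ∈ succ m <-> n ⊆ m.
Proof. by move=> Hn Hm; rewrite in_succ om_sub. Qed.

Lemma succ_sub n m : n ∈ om -> m ∈ om -> succ n ⊆ m <-> n ∈ m.
Proof.
move=> Hn Hm; split=> [H|H z /in_succ [zn|->]] //; first by apply: H; apply/in_succ; right.
exact: om_trans zn.
Qed.

Lemma succ_inj n m : succ n = succ m -> n = m.
Proof.
move=> E; have /in_succ H : n ∈ succ m by rewrite -E; apply/in_succ; right.
have /in_succ K : m ∈ succ n by rewrite E; apply/in_succ; right.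
by case: H => // H; case: K => // /(mem_asym H).
Qed.

Lemma succ_neq0 n : succ n <> emp.
Proof. by move=> E; apply: (@in_emp _ _ n); rewrite -E; apply/in_succ; right. Qed.

Lemma succ_self n : n ∈ succ n. Proof. by apply/in_succ; right. Qed.

Lemma om_case n : n ∈ om -> n = emp \/ exists m, m ∈ om /\ n = succ m.
Proof.
move: n; apply: (om_ind (P := fun n => n = emp \/ exists m, m ∈ om /\ n = succ m)).
- by rewrite /succ; df.
- by left.
- by move=> n Hn _; right; exists n.
Qed.

Lemma om_ind_from (P : M -> Prop) n : dfn (fun e => P (e 0)) -> n ∈ om -> P n ->
  (forall m, m ∈ om -> n ⊆ m -> P m -> P (succ m)) -> forall m, m ∈ om -> n ⊆ m -> P m.
Proof.
move=> HP Hn Pn PS; apply: om_ind; first by df.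
  by move=> H; have <- : n = emp by apply/empP => z /H /in_emp.
move=> m Hm IH nm.
case: (excluded_middle_informative (m ∈ n)) => [mn|/(om_nle Hm Hn) nm']; last exact: PS (IH nm').
have <- // : n = succ m.
by apply: ext => z; split=> [/nm //|]; apply: (succ_sub Hm Hn).2.
Qed.

Lemma om_least (P : M -> Prop) : dfn (fun e => P (e 0)) -> (exists n, n ∈ om /\ P n) ->
  exists n, n ∈ om /\ P n /\ forall m, m ∈ n -> ~ P m.
Proof.
move=> HP [n [Hn Pn]].
have [|k [/(in_sep om HP) [Hk Pk] K]] := zf_foundation hZF (a := sep om P).
  by exists n; apply/(in_sep om HP).
exists k; do 2!split=> //; move=> m mk Pm; apply: (K m mk); apply/in_sep => //.
by split=> //; apply: om_in mk.
Qed.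

(* Values of a function on [0, ..., n] computed by iteration of [F] from [a]. *)
Definition attempt a (F : M -> M -> M) n g : Prop :=
  ap g emp = a /\ forall k, k ∈ n -> ap g (succ k) = F k (ap g k).

Fact rec_sig : {f : M -> (M -> M -> M) -> M -> M | forall a F n,
  f a F n = iota (fun z => exists g, attempt a F n g /\ ap g n = z)}.
Proof. by eexists. Qed.
(** Recursion on the natural numbers of the model, for a definable [F]:
    [rec a F 0 = a] and [rec a F (n + 1) = F n (rec a F n)]. *)
Definition rec : M -> (M -> M -> M) -> M -> M := proj1_sig rec_sig.

Lemma recE a F n : rec a F n = iota (fun z => exists g, attempt a F n g /\ ap g n = z).
Proof. exact: (proj2_sig rec_sig). Qed.

Lemma tdef_rec t (F : (nat -> M) -> M -> M -> M) u : tdef t ->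
  tdef (fun e => F (fun i => e i.+2) (e 1) (e 0)) -> tdef u ->
  tdef (fun e => rec (t e) (F e) (u e)).
Proof. by move=> Ht HF Hu; apply: (tdef_ext (fun e => esym (recE _ _ _))); rewrite /attempt /succ; df. Qed.

Section Rec.
Variables (a : M) (F : M -> M -> M).
Hypothesis HF : tdef (fun e => F (e 1) (e 0)).

Lemma attempt_uniq n g g' : n ∈ om -> attempt a F n g -> attempt a F n g' ->
  ap g n = ap g' n.
Proof.
move=> Hn [g0 gS] [g'0 g'S].
have H : forall k, k ∈ om -> k ⊆ n -> ap g k = ap g' k; last by apply: H.
apply: om_ind; [by df|by rewrite g0 g'0|].
move=> k Hk IH kn; have kn' : k ∈ n by apply: kn; apply: succ_self.
by rewrite gS // g'S // IH // => z zk; apply: om_trans kn' zk.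
Qed.

Lemma attempt_ex n : n ∈ om -> exists g, attempt a F n g.
Proof.
move: n; apply: om_ind; first by rewrite /attempt /succ; df.
  exists (lam (succ emp) (fun _ => a)); split=> [|k /in_emp] //.
  by apply: ap_lam; [df|exact: succ_self].
move=> n Hn [g [g0 gS]].
pose (G := fun k => ite (k = succ n) (F n (ap g n)) (ap g k)).
have HG : tdef (fun e => G (e 0)) by rewrite /G /succ; df.
have om_s : succ n ∈ om by apply: om_succ.
exists (lam (succ (succ n)) G).
have apG k : k ∈ om -> k ⊆ n -> ap (lam (succ (succ n)) G) k = ap g k.
  move=> Hk kn; rewrite ap_lam // /G ?ite_false //.
    by move=> E; move: kn; rewrite E => /(_ n (succ_self n)) /mem_irr.
  by apply/in_succ_sub => // z /kn zn; apply/in_succ; left.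
split.
  rewrite apG ?g0 //; first exact: om_emp.
  by move=> z /in_emp.
move=> k /in_succ [kn|->].
- have Hk : k ∈ om by apply: om_in kn.
  rewrite !apG ?gS //; first by move=> z zk; apply: om_trans zk.
    exact: om_succ.
  by apply/succ_sub.
- rewrite (apG n) // ap_lam //; last exact: succ_self.
  by rewrite /G ite_true.
Qed.

Lemma recP n : n ∈ om -> exists g, attempt a F n g /\ ap g n = rec a F n.
Proof.
move=> Hn; rewrite recE.
apply: (iotaP (P := fun z => exists g, attempt a F n g /\ ap g n = z)).
have [g Hg] := attempt_ex Hn; exists (ap g n); split; first by exists g.
by move=> z [g' [Hg' <-]]; apply: attempt_uniq Hg Hg'.
Qed.

Lemma rec0 : rec a F emp = a.
Proof. by have [g [[H _] <-]] := recP om_emp. Qed.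

Lemma recS n : n ∈ om -> rec a F (succ n) = F n (rec a F n).
Proof.
move=> Hn; have [g [[g0 gS] <-]] := recP (om_succ Hn).
rewrite gS; last exact: succ_self.
have [g' [Hg' <-]] := recP Hn; congr (F n _); apply: attempt_uniq Hg' => //.
by split=> // k kn; apply: gS; apply/in_succ; left.
Qed.
End Rec.

End Omega.

Ltac dfn_reg1 ::= first
  [ simple apply tdef_ap | simple apply tdef_pr | simple apply tdef_sep
  | simple apply tdef_img | simple apply tdef_lam | simple apply tdef_ite
  | simple apply tdef_prod | simple apply tdef_setof | simple apply tdef_succ
  | simple apply tdef_rec | simple apply tdef_upr | simple apply tdef_bigU
  | simple apply tdef_pow | simple apply tdef_cup ].

Global Opaque setof emp sep img upr bigU pow cup pr ap lam ite prod succ om rec.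

(** * Countable and finite sets *)

Section Countable.
Context {M : structure} {hZF : ZF M}.
Implicit Types (a b c g n m k x y z p : M) (A B : M -> Prop).

(** [g] restricts to an injection of [a] into [b]. *)
Definition codes g a b : Prop :=
  (forall x, x ∈ a -> ap g x ∈ b) /\
  (forall x y, x ∈ a -> y ∈ a -> ap g x = ap g y -> x = y).

Lemma dfn_codes t u v : tdef t -> tdef u -> tdef v ->
  dfn (fun e : nat -> M => codes (t e) (u e) (v e)).
Proof. by move=> Ht Hu Hv; rewrite /codes; df. Qed.

Lemma injectsP a B b : (forall x, B x <-> x ∈ b) -> injects M a B <-> exists g, codes g a b.
Proof.
move=> HB; split=> [[g [Hg I]]|[g [Hg I]]].
  exists g; split=> [x xa|x y xa ya E]; first by apply/HB; exact: (map_val Hg xa).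
  apply: (I _ _ (ap g x)); apply/appP; first exact: (map_pr Hg xa).
  by rewrite E; apply: (map_pr Hg ya).
have L : is_map M (lam a (fun x => ap g x)) (fun x => x ∈ a) B.
  by apply: lam_map => // [|x /Hg /HB]; first by df.
exists (lam a (fun x => ap g x)); split=> // x x' y.
rewrite !(map_app _ _ L) => -[xa ->] [x'a].
by rewrite !ap_lam //; [exact: I|df..].
Qed.

Lemma countableP a : countable M a <-> exists g, codes g a om.
Proof. by apply: injectsP => x; rewrite in_om. Qed.

Lemma finiteP a : finite M a <-> exists n g, n ∈ om /\ codes g a n.
Proof.
split=> [[n [/in_om Hn K]]|[n [g [/in_om Hn Hg]]]].
  by have [g Hg] := (injectsP a (b := n) (fun _ => iff_refl _)).1 K; exists n, g.
by exists n; split=> //; apply/(@injectsP _ _ n) => //; exists g.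
Qed.

Lemma codes_intro (c : M -> M) a b : tdef (fun e => c (e 0)) ->
  (forall x, x ∈ a -> c x ∈ b) ->
  (forall x y, x ∈ a -> y ∈ a -> c x = c y -> x = y) -> codes (lam a c) a b.
Proof.
move=> Hc H I; split=> [x xa|x y xa ya]; rewrite !ap_lam //; [exact: H|exact: I].
Qed.

Lemma countable_intro (c : M -> M) a : tdef (fun e => c (e 0)) ->
  (forall x, x ∈ a -> c x ∈ om) ->
  (forall x y, x ∈ a -> y ∈ a -> c x = c y -> x = y) -> countable M a.
Proof. by move=> Hc H I; apply/countableP; exists (lam a c); apply: codes_intro. Qed.

Lemma countable_om : countable M om.
Proof. by apply: (@countable_intro id) => //; df. Qed.

(** The element of [a] with property [P] whose code under [g] is least. *)
Definition pick g a (P : M -> Prop) : M :=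
  iota (fun x => x ∈ a /\ P x /\ forall y, y ∈ a -> P y -> ~ ap g y ∈ ap g x).

Lemma tdef_pick t u (P : (nat -> M) -> M -> Prop) : tdef t -> tdef u ->
  dfn (fun e => P (fun i => e i.+1) (e 0)) -> tdef (fun e => pick (t e) (u e) (P e)).
Proof. by move=> Ht Hu HP; rewrite /pick; df. Qed.

Lemma pickP g a (P : M -> Prop) : codes g a om -> dfn (fun e => P (e 0)) ->
  (exists x, x ∈ a /\ P x) -> pick g a P ∈ a /\ P (pick g a P).
Proof.
move=> [Hg I] HP [x [xa Px]].
pose (Q := fun n => exists y, y ∈ a /\ P y /\ ap g y = n).
have [||n [Hn [[y [ya [Py Ey]]] L]]] := @om_least _ _ Q; first by rewrite /Q; df.
  by exists (ap g x); split; [apply: Hg|exists x].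
have [] // := @iotaP _ _ (fun x => x ∈ a /\ P x /\ forall y, y ∈ a -> P y -> ~ ap g y ∈ ap g x).
- exists y; split.
    do 2!split=> //; move=> z za Pz; rewrite Ey => /L; apply; by exists z.
  move=> z [za [Pz Lz]]; apply: I => //.
  case: (om_total (Hg _ ya) (Hg _ za)) => [/Lz|[//|]]; first by case.
  by rewrite Ey => /L; case; exists z.
- by move=> ? [].
Qed.

Lemma countable_sub a b : a ⊆ b -> countable M b -> countable M a.
Proof.
move=> H /countableP [g [Hg I]]; apply/countableP; exists g.
by split=> [x /H /Hg|x y /H xb /H yb]; last exact: I.
Qed.

Lemma countable_inj (c : M -> M) a b : tdef (fun e => c (e 0)) ->
  (forall x, x ∈ a -> c x ∈ b) ->
  (forall x y, x ∈ a -> y ∈ a -> c x = c y -> x = y) -> countable M b -> countable M a.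
Proof.
move=> Hc H I /countableP [g [Hg J]].
apply: (@countable_intro (fun x => ap g (c x))); first by df.
  by move=> x /H /Hg.
by move=> x y xa ya E; apply: I => //; apply: J => //; apply: H.
Qed.

Lemma countable_img a (F : M -> M) : tdef (fun e => F (e 0)) ->
  countable M a -> countable M (img a F).
Proof.
move=> HF Ha; have [g Hg] := (countableP a).1 Ha.
have K y : y ∈ img a F ->
    pick g a (fun x => F x = y) ∈ a /\ F (pick g a (fun x => F x = y)) = y.
  move=> /(in_img _ HF) [x [xa ->]].
  by apply: (pickP (P := fun x' => F x' = F x) Hg); [df|exists x].
apply: (countable_inj (c := fun y => pick g a (fun x => F x = y)) (b := a)) => //.
- by rewrite /pick; df.
- by move=> y /K [].
- by move=> y y' /K [_ {2}<-] /K [_ {2}<-] ->.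
Qed.

Lemma om_max n m : n ∈ om -> m ∈ om -> exists k, k ∈ om /\ n ⊆ k /\ m ⊆ k.
Proof.
move=> Hn Hm; case: (excluded_middle_informative (n ∈ m)) => [H|/(om_nle Hn Hm) H].
- by exists m; split=> //; split=> //; apply/om_sub => //; left.
- by exists n; split=> //; split=> // z.
Qed.

(** A property that each member of a finite set has from some index on holds for all of them
    from a common index on. *)
Lemma finite_bound G (P : M -> M -> Prop) : finite M G -> dfn (fun e => P (e 1) (e 0)) ->
  (forall n m C, n ∈ om -> m ∈ om -> n ⊆ m -> P n C -> P m C) ->
  (forall C, C ∈ G -> exists n, n ∈ om /\ P n C) ->
  exists n, n ∈ om /\ forall C, C ∈ G -> P n C.
Proof.
move=> /finiteP [N [g [HN [Hg I]]]] HP mono H.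
have K : forall k, k ∈ om -> exists n, n ∈ om /\ forall C, C ∈ G -> ap g C ∈ k -> P n C.
  apply: om_ind; first by df.
    by exists emp; split; [exact: om_emp|move=> C _ /in_emp].
  move=> k Hk [n [Hn IH]].
  case: (excluded_middle_informative (exists C, C ∈ G /\ ap g C = k)) => [[C [CG EC]]|NC].
  - have [m [Hm PC]] := H C CG; have [r [Hr [nr mr]]] := om_max Hn Hm.
    exists r; split=> // C' C'G /in_succ [/(IH _ C'G)|E]; first exact: mono.
    have -> : C' = C by apply: I => //; rewrite E.
    exact: (mono m).
  - exists n; split=> // C CG /in_succ [/(IH _ CG) //|E].
    by case: NC; exists C.
have [n [Hn L]] := K N HN; exists n; split=> // C CG; apply: L => //; exact: Hg.
Qed.

Lemma finite_add a x : finite M a -> finite M (cup a (upr x x)).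
Proof.
move=> /finiteP [n [g [Hn [Hg I]]]]; apply/finiteP.
pose (c := fun y => ite (y ∈ a) (ap g y) n).
exists (succ n), (lam (cup a (upr x x)) c); split; first exact: om_succ.
apply: codes_intro; first by rewrite /c; df.
  move=> y _; rewrite /c; case: (excluded_middle_informative (y ∈ a)) => [H|H].
    by rewrite ite_true //; apply/in_succ; left; apply: Hg.
  by rewrite ite_false //; apply: succ_self.
move=> y z /in_cup Hy /in_cup Hz; rewrite /c.
case: (excluded_middle_informative (y ∈ a)) => [H|H];
  case: (excluded_middle_informative (z ∈ a)) => [K|K].
- by rewrite !ite_true //; apply: I.
- by rewrite ite_true // ite_false // => E; case: (@mem_irr _ _ n); rewrite -{1}E; apply: Hg.
- by rewrite ite_false // ite_true // => E; case: (@mem_irr _ _ n); rewrite {1}E; apply: Hg.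
- case: Hy => // /in_upr Hy; case: Hz => // /in_upr Hz _.
  by case: Hy => ->; case: Hz => ->.
Qed.

Lemma finite_cup a b : finite M a -> finite M b -> finite M (cup a b).
Proof.
move=> Ha /finiteP [N [g [HN [Hg I]]]].
have D k : dfn (fun e => ap g (e 0) ∈ k) by df.
have K : forall k, k ∈ om -> finite M (cup a (sep b (fun x => ap g x ∈ k))).
  apply: om_ind; first by df.
    have <- : a = cup a (sep b (fun x => ap g x ∈ emp)); last by [].
    apply: ext => z; rewrite in_cup in_sep //; split; first by left.
    by case=> // -[_ /in_emp].
  move=> k Hk IH.
  case: (excluded_middle_informative (exists x, x ∈ b /\ ap g x = k)) => [[x [xb Ex]]|Nx].
  - have := finite_add x IH.
    have -> : cup (cup a (sep b (fun x => ap g x ∈ k))) (upr x x)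
      = cup a (sep b (fun x => ap g x ∈ succ k)); last by [].
    apply: ext => z; rewrite !in_cup !in_sep // in_upr in_succ; split.
      by case=> [[|[? ?]]|[->|->]]; auto; right; auto.
    case=> [|[zb [?|E]]]; auto.
    by right; left; apply: I => //; rewrite E.
  - have <- : cup a (sep b (fun x => ap g x ∈ k))
      = cup a (sep b (fun x => ap g x ∈ succ k)); last by [].
    apply: ext => z; rewrite !in_cup !in_sep // in_succ; split; first tauto.
    by case=> [|[zb [?|E]]]; auto; case: Nx; exists z.
have -> : cup a b = cup a (sep b (fun x => ap g x ∈ N)); last by apply: K.
apply: ext => z; rewrite !in_cup in_sep //; split; last tauto.
by case=> [|zb]; auto; right; split=> //; apply: Hg.
Qed.

Lemma finite_sg x : finite M (upr x x).
Proof.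
have <- : cup emp (upr x x) = upr x x.
  by apply: ext => z; rewrite in_cup; split=> [[/in_emp|]|]; auto.
apply: finite_add; apply/finiteP; exists emp, emp; split; first exact: om_emp.
by split=> [y /in_emp|y z /in_emp].
Qed.

End Countable.

Ltac dfn_reg1 ::= first
  [ simple apply tdef_ap | simple apply tdef_pr | simple apply tdef_sep
  | simple apply tdef_img | simple apply tdef_lam | simple apply tdef_ite
  | simple apply tdef_prod | simple apply tdef_setof | simple apply tdef_succ
  | simple apply tdef_rec | simple apply tdef_upr | simple apply tdef_bigU
  | simple apply tdef_pow | simple apply tdef_cup | simple apply tdef_pick
  | simple apply dfn_codes ].

Global Opaque pick.

(** * The reals of the model as an ordered field *)

Existing Class complete_ordered_field.

(** The reals of the model, as a type of the ambient logic. The axioms are arguments of the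
    type so that the algebraic structures built on it can find them. *)
Definition RR {M : structure} {hZF : ZF M} {R : field_data M}
  (hR : complete_ordered_field R) : Type := {x : M | x ∈ car R}.

Section Field.
Context {M : structure} {hZF : ZF M} {R : field_data M} {hR : complete_ordered_field R}.
Local Notation RR := (RR hR).
Implicit Types (u v w : RR) (x y z : M).

Definition cval (u : RR) : M := proj1_sig u.

Lemma cvalP u : cval u ∈ car R. Proof. by case: u. Qed.

Lemma cval_inj u v : cval u = cval v -> u = v.
Proof. by case: u v => x Hx [y Hy] /= E; apply: eq_sig_hprop => // ? ? ?; exact: boolp.Prop_irrelevance. Qed.

Definition r0 : RR := exist (fun x : M => x ∈ car R) _ (cof_zero hR).
Definition r1 : RR := exist (fun x : M => x ∈ car R) _ (cof_one hR).

(** The real [x], or 0 if [x] is not a real. *)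
Definition cof (x : M) : RR :=
  match excluded_middle_informative (x ∈ car R) with
  | left H => exist (fun x : M => x ∈ car R) x H
  | right _ => r0
  end.

Lemma cofK x : x ∈ car R -> cval (cof x) = x.
Proof. by rewrite /cof; case: excluded_middle_informative. Qed.

Definition radd u v : RR := cof (ap (addg R) (pr (cval u) (cval v))).
Definition rmul u v : RR := cof (ap (mulg R) (pr (cval u) (cval v))).

Lemma in_prod_cval u v : in_prod M (car R) (car R) (pr (cval u) (cval v)).
Proof. by apply/in_prodE/pr_in_prod; split; exact: cvalP. Qed.

Lemma raddP u v w : op M (addg R) (cval u) (cval v) (cval w) <-> w = radd u v.
Proof.
have Ha := cof_add_map hR.
rewrite opP; split=> [H|->].
  by apply: cval_inj; rewrite cofK (map_ap Ha H) //; exact: cvalP.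
rewrite cofK; first exact: (map_pr Ha (in_prod_cval u v)).
exact: (map_val Ha (in_prod_cval u v)).
Qed.

Lemma rmulP u v w : op M (mulg R) (cval u) (cval v) (cval w) <-> w = rmul u v.
Proof.
have Ha := cof_mul_map hR.
rewrite opP; split=> [H|->].
  by apply: cval_inj; rewrite cofK (map_ap Ha H) //; exact: cvalP.
rewrite cofK; first exact: (map_pr Ha (in_prod_cval u v)).
exact: (map_val Ha (in_prod_cval u v)).
Qed.

Lemma raddC : commutative radd.
Proof. by move=> u v; apply/raddP/(cof_addC hR)/raddP. Qed.

Lemma raddA : associative radd.
Proof.
move=> u v w; symmetry; apply/raddP; apply: (cof_addA hR (z := cval w)); apply/raddP => //.
Qed.

Lemma radd0 : left_id r0 radd.
Proof. by move=> u; rewrite raddC; symmetry; apply/raddP/(cof_add0 hR)/cvalP. Qed.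

Lemma ropp_ex u : exists v, radd v u = r0.
Proof.
have [y Hy] := cof_opp hR (cval u) (cvalP u).
have yR : y ∈ car R.
  have [+ _] := map_dom (cof_add_map hR) ((opP _ _ _ _).1 Hy).
  by move=> /in_prodE /pr_in_prod [].
by exists (cof y); rewrite raddC; symmetry; apply/raddP; rewrite cofK.
Qed.

Definition ropp u : RR := proj1_sig (constructive_indefinite_description _ (ropp_ex u)).

Lemma raddN : left_inverse r0 ropp radd.
Proof. by move=> u; rewrite /ropp; case: constructive_indefinite_description. Qed.

Lemma rmulC : commutative rmul.
Proof. by move=> u v; apply/rmulP/(cof_mulC hR)/rmulP. Qed.

Lemma rmulA : associative rmul.
Proof.
move=> u v w; symmetry; apply/rmulP; apply: (cof_mulA hR (z := cval w)); apply/rmulP => //.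
Qed.

Lemma rmul1 : left_id r1 rmul.
Proof. by move=> u; rewrite rmulC; symmetry; apply/rmulP/(cof_mul1 hR)/cvalP. Qed.

Lemma rmulD : left_distributive rmul radd.
Proof.
move=> u v w; rewrite rmulC (rmulC u) (rmulC v); apply/raddP.
by apply: (cof_distr hR (x := cval w) (y := cval u) (z := cval v) (yz := cval (radd u v)));
  [apply/raddP|apply/rmulP|apply/rmulP|apply/rmulP].
Qed.

Lemma rinv_ex u : exists v, (u <> r0 -> rmul v u = r1) /\ (u = r0 -> v = r0).
Proof.
case: (excluded_middle_informative (u = r0)) => [->|nz]; first by exists r0.
have [|y Hy] := cof_inv hR (cvalP u); first by move=> E; apply: nz; apply: cval_inj.
have yR : y ∈ car R.
  have [+ _] := map_dom (cof_mul_map hR) ((opP _ _ _ _).1 Hy).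
  by move=> /in_prodE /pr_in_prod [].
by exists (cof y); split=> // _; rewrite rmulC; symmetry; apply/rmulP; rewrite cofK.
Qed.

Definition rinv u : RR := proj1_sig (constructive_indefinite_description _ (rinv_ex u)).

Lemma rinvP u : (u <> r0 -> rmul (rinv u) u = r1) /\ (u = r0 -> rinv u = r0).
Proof. by rewrite /rinv; case: constructive_indefinite_description. Qed.

Definition rltb u v : bool :=
  if excluded_middle_informative (lt R (cval u) (cval v)) then true else false.

Lemma rltP u v : rltb u v <-> lt R (cval u) (cval v).
Proof. by rewrite /rltb; case: excluded_middle_informative. Qed.

End Field.

HB.instance Definition _ M hZF R (hR : @complete_ordered_field M R) :=
  boolp.gen_eqMixin (@RR M hZF R hR).
HB.instance Definition _ M hZF R (hR : @complete_ordered_field M R) :=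
  boolp.gen_choiceMixin (@RR M hZF R hR).
HB.instance Definition _ M hZF R (hR : @complete_ordered_field M R) :=
  GRing.isZmodule.Build (@RR M hZF R hR) (@raddA M hZF R hR) (@raddC M hZF R hR)
    (@radd0 M hZF R hR) (@raddN M hZF R hR).

Lemma r1_neq0 M hZF R (hR : @complete_ordered_field M R) : (@r1 M hZF R hR) != 0%R.
Proof. by apply/eqP => /(congr1 cval) /esym /(cof_zero_one hR). Qed.

HB.instance Definition _ M hZF R (hR : @complete_ordered_field M R) :=
  GRing.Zmodule_isComNzRing.Build (@RR M hZF R hR) (@rmulA M hZF R hR) (@rmulC M hZF R hR)
    (@rmul1 M hZF R hR) (@rmulD M hZF R hR) (r1_neq0 hZF hR).

Section Field2.
Context {M : structure} {hZF : ZF M} {R : field_data M} {hR : complete_ordered_field R}.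
Local Notation RR := (RR hR).
Local Open Scope ring_scope.

Lemma rmulVf (u : RR) : u != 0 -> rinv u * u = 1.
Proof. by move=> /eqP; exact: (rinvP u).1. Qed.

Lemma rinv0 : rinv (0 : RR) = 0.
Proof. exact: (rinvP (0 : RR)).2. Qed.
End Field2.

HB.instance Definition _ M hZF R (hR : @complete_ordered_field M R) :=
  GRing.ComNzRing_isField.Build (@RR M hZF R hR) (@rmulVf M hZF R hR) (@rinv0 M hZF R hR).

Section Order.
Context {M : structure} {hZF : ZF M} {R : field_data M} {hR : complete_ordered_field R}.
Local Notation RR := (RR hR).
Local Open Scope ring_scope.
Implicit Types u v w : RR.

Definition rleb u v : bool := (u == v) || rltb u v.
Definition rnorm u : RR := if rleb 0 u then u else - u.

Lemma rlt_add2 u v w : rltb u v -> rltb (u + w) (v + w).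
Proof.
move=> /rltP H; apply/rltP; apply: (cof_lt_add hR (z := cval w) H); by apply/raddP.
Qed.

Lemma rlt_trans u v w : rltb u v -> rltb v w -> rltb u w.
Proof. by move=> /rltP H /rltP K; apply/rltP; apply: (cof_lt_trans hR H K). Qed.

Lemma rlt_irr u : ~~ rltb u u.
Proof. by apply/negP => /rltP /(cof_lt_irr hR). Qed.

Lemma rlt0_add u v : rltb 0 u -> rltb 0 v -> rltb 0 (u + v).
Proof. by move=> H K; apply: (rlt_trans K); rewrite -{1}(add0r v); apply: rlt_add2. Qed.

Lemma rlt0_mul u v : rltb 0 u -> rltb 0 v -> rltb 0 (u * v).
Proof.
move=> /rltP H /rltP K; apply/rltP; apply: (cof_lt_mul hR H K); by apply/rmulP.
Qed.

Lemma rlt0_ngt0 u : rltb 0 u -> ~~ rltb u 0.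
Proof. by move=> H; apply/negP => /(rlt_trans H); apply/negP/rlt_irr. Qed.

Lemma rsub_gt0 u v : rltb 0 (v - u) = rltb u v.
Proof.
apply/idP/idP => /rlt_add2 H; first by have := H u; rewrite add0r subrK.
by have := H (- u); rewrite subrr.
Qed.

Lemma rlt0_total u : u != 0 -> rltb 0 u || rltb u 0.
Proof.
move=> /eqP nz; apply/orP.
case: (cof_lt_total hR _ _ (cvalP (0 : RR)) (cvalP u)) => [/rltP|[/cval_inj E|/rltP]]; auto.
Qed.

Lemma rnormN u : rnorm (- u) = rnorm u.
Proof.
rewrite /rnorm /rleb ![0 == _]eq_sym oppr_eq0.
case: eqP => [->|/eqP nz] /=; first by rewrite oppr0.
have E : rltb 0 (- u) = rltb u 0 by rewrite -(rsub_gt0 u 0) sub0r.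
rewrite E; case/orP: (rlt0_total nz) => H; rewrite H.
- by rewrite (negbTE (rlt0_ngt0 H)) opprK.
- case: ifP => // K; by move: (rlt0_ngt0 K); rewrite H.
Qed.

Lemma rge0_norm u : rleb 0 u -> rnorm u = u. Proof. by rewrite /rnorm => ->. Qed.

Lemma rle_def u v : rleb u v = (u == v) || rltb u v. Proof. by []. Qed.
End Order.

HB.instance Definition _ M hZF R (hR : @complete_ordered_field M R) :=
  Num.IntegralDomain_isLtReal.Build (@RR M hZF R hR) (@rlt0_add M hZF R hR) (@rlt0_mul M hZF R hR)
    (@rlt0_ngt0 M hZF R hR) (@rsub_gt0 M hZF R hR) (@rlt0_total M hZF R hR)
    (@rnormN M hZF R hR) (@rge0_norm M hZF R hR) (@rle_def M hZF R hR).


Section Interface.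
Context {M : structure} {hZF : ZF M}.
Local Open Scope ring_scope.

(** An ordered field of the ambient logic whose elements name the reals of the model. Its
    operations are abstract, which keeps arithmetic over it from unfolding into the model. *)
Record field_reading (R : field_data M) := FieldReading {
  RF :> realFieldType;
  valR : RF -> M;
  valRP : forall u, valR u ∈ car R;
  valR_inj : forall u v, valR u = valR v -> u = v;
  valR_surj : forall x, x ∈ car R -> exists u, valR u = x;
  valR0 : valR 0 = zero R;
  valR1 : valR 1 = one R;
  valR_add : forall u v, op M (addg R) (valR u) (valR v) (valR (u + v));
  valR_mul : forall u v, op M (mulg R) (valR u) (valR v) (valR (u * v));
  valR_lt : forall u v, u < v <-> lt R (valR u) (valR v)
}.

Lemma read_field (R : field_data M) : complete_ordered_field R -> field_reading R.
Proof.
move=> hR; apply: (@FieldReading R (RR hR) (@cval _ _ _ hR)) => //.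
- exact: cvalP.
- exact: cval_inj.
- by move=> x xR; exists (cof x); exact: cofK.
- by move=> u v; apply/raddP.
- by move=> u v; apply/rmulP.
- exact: rltP.
Qed.
End Interface.

Section RealTerms.
Context {M : structure} {hZF : ZF M} {R : field_data M} {hR : complete_ordered_field R}.
Local Open Scope ring_scope.

(** The field of reals, and the element of the model named by a real. *)
Definition reals := read_field hR.
Local Notation RR := (RF reals).
Implicit Types (u v : (nat -> M) -> RR) (t : (nat -> M) -> M).

Definition rval (x : RR) : M := valR x.

Lemma rvalP x : rval x ∈ car R. Proof. exact: valRP. Qed.
Lemma rval_inj x y : rval x = rval y -> x = y. Proof. exact: valR_inj. Qed.
Lemma rval0 : rval 0 = zero R. Proof. exact: valR0. Qed.
Lemma rval1 : rval 1 = one R. Proof. exact: valR1. Qed.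

(** The real [x], or 0 if [x] is not a real. *)
Definition rho (x : M) : RR :=
  epsilon (inhabits 0) (fun u : RR => rval u = x \/ ~ x ∈ car R /\ u = 0).

Lemma rho_spec x : rval (rho x) = x \/ ~ x ∈ car R /\ rho x = 0.
Proof.
apply: (epsilon_spec (inhabits 0) (fun u : RR => rval u = x \/ ~ x ∈ car R /\ u = 0)).
case: (excluded_middle_informative (x ∈ car R)) => [H|H]; last by exists 0; right.
by have [x' E] := valR_surj reals H; exists x'; left.
Qed.

Lemma rhoK x : x ∈ car R -> rval (rho x) = x.
Proof. by move=> xR; case: (rho_spec x) => [|[]]. Qed.

Lemma rvalK (x : RR) : rho (rval x) = x.
Proof. by apply/rval_inj/rhoK/rvalP. Qed.

Lemma rltE (x y : RR) : lt R (rval x) (rval y) <-> x < y.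
Proof. by split=> /valR_lt. Qed.

Lemma rlt_graph (x y : RR) : x < y <-> pr (rval x) (rval y) ∈ ltg R.
Proof. by rewrite -appP; exact: valR_lt. Qed.

Lemma dfn_rlt u v : tdef (fun e => rval (u e)) -> tdef (fun e => rval (v e)) ->
  dfn (fun e => is_true (u e < v e)).
Proof.
move=> Hu Hv; apply: (dfn_ext (fun e => iff_sym (rlt_graph (u e) (v e)))); df.
Qed.

Lemma dfn_rle u v : tdef (fun e => rval (u e)) -> tdef (fun e => rval (v e)) ->
  dfn (fun e => is_true (u e <= v e)).
Proof.
move=> Hu Hv; apply: (@dfn_ext _ (fun e => ~ (v e < u e))).
  by move=> e; rewrite (leNgt (u e) (v e)); split=> /negP.
by apply: dfn_not; apply: dfn_rlt.
Qed.

Lemma dfn_req u v : tdef (fun e => rval (u e)) -> tdef (fun e => rval (v e)) ->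
  dfn (fun e => u e = v e).
Proof.
move=> Hu Hv; apply: (@dfn_ext _ (fun e => rval (u e) = rval (v e))); last by df.
by move=> e; split=> [/rval_inj|->].
Qed.

Lemma radd_graph (x y : RR) z : z = rval (x + y) <-> pr (pr (rval x) (rval y)) z ∈ addg R.
Proof.
have H : pr (pr (rval x) (rval y)) (rval (x + y)) ∈ addg R by apply/opP/valR_add.
split=> [->//|K].
by rewrite -(map_ap (cof_add_map hR) K) (map_ap (cof_add_map hR) H).
Qed.

Lemma rmul_graph (x y : RR) z : z = rval (x * y) <-> pr (pr (rval x) (rval y)) z ∈ mulg R.
Proof.
have H : pr (pr (rval x) (rval y)) (rval (x * y)) ∈ mulg R by apply/opP/valR_mul.
split=> [->//|K].
by rewrite -(map_ap (cof_mul_map hR) K) (map_ap (cof_mul_map hR) H).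
Qed.

Lemma rho_graph (x z : M) : z = rval (rho x) <-> x ∈ car R /\ z = x \/ ~ x ∈ car R /\ z = zero R.
Proof.
split=> [->|[[xR ->]|[xR ->]]]; last 1 first.
- by case: (rho_spec x) => [E|[_ ->]]; rewrite ?rval0 //; case: xR; rewrite -E; exact: rvalP.
- case: (rho_spec x) => [E|[xR ->]]; last by right; rewrite rval0.
  by left; split=> //; rewrite -E; exact: rvalP.
- by rewrite rhoK.
Qed.

Lemma tdef_radd u v : tdef (fun e => rval (u e)) -> tdef (fun e => rval (v e)) ->
  tdef (fun e => rval (u e + v e)).
Proof.
move=> Hu Hv; apply: (dfn_ext (fun e => iff_sym (radd_graph _ _ _))).
have Hu' := tdef_ren S Hu; have Hv' := tdef_ren S Hv; df.
Qed.

Lemma tdef_rmul u v : tdef (fun e => rval (u e)) -> tdef (fun e => rval (v e)) ->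
  tdef (fun e => rval (u e * v e)).
Proof.
move=> Hu Hv; apply: (dfn_ext (fun e => iff_sym (rmul_graph _ _ _))).
have Hu' := tdef_ren S Hu; have Hv' := tdef_ren S Hv; df.
Qed.

Lemma tdef_rho t : tdef t -> tdef (fun e => rval (rho (t e))).
Proof.
by move=> Ht; apply: (dfn_ext (fun e => iff_sym (rho_graph _ _))); df.
Qed.

End RealTerms.

Ltac dfn_reg2 ::= lazymatch goal with
  | |- dfn (fun e => is_true (Order.lt (@?u e) (@?v e))) => apply (dfn_rlt (u := u) (v := v))
  | |- dfn (fun e => is_true (Order.le (@?u e) (@?v e))) => apply (dfn_rle (u := u) (v := v))
  | |- dfn (fun e => @?u e = @?v e) => apply (dfn_req (u := u) (v := v))
  | |- tdef (fun e => rval (GRing.add (@?u e) (@?v e))) => apply (tdef_radd (u := u) (v := v))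
  | |- tdef (fun e => rval (GRing.mul (@?u e) (@?v e))) => apply (tdef_rmul (u := u) (v := v))
  | |- tdef (fun e => rval (rho (@?t e))) => apply (tdef_rho (t := t))
  end.

(** * Natural numbers and powers of 1/3 among the reals *)

Section Reals.
Context {M : structure} {hZF : ZF M} {R : field_data M} {hR : complete_ordered_field R}.
Local Notation RR := (RF (reals (hR := hR))).
Local Open Scope ring_scope.
Implicit Types (u v : RR) (n m k a b : M).

Fact iR_sig : {f : M -> RR | forall n,
  f n = rho (rec (zero R) (fun _ r => rval (rho (hR := hR) r + 1)) n)}.
Proof. by eexists. Qed.
(** The natural number [n] as a real. *)
Definition iR : M -> RR := proj1_sig iR_sig.

Lemma iRE n : iR n = rho (rec (zero R) (fun _ r => rval (rho (hR := hR) r + 1)) n).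
Proof. exact: (proj2_sig iR_sig). Qed.

Lemma tdef_iR t : tdef t -> tdef (fun e => rval (iR (t e))).
Proof. by move=> Ht; apply: (tdef_ext (fun e => esym (congr1 rval (iRE _)))); df. Qed.

Lemma iR0 : iR emp = 0.
Proof. by rewrite iRE rec0; [rewrite -rval0; exact: rvalK|df]. Qed.

Lemma iRS n : n ∈ om -> iR (succ n) = iR n + 1.
Proof. by move=> Hn; rewrite !iRE recS //; [rewrite rvalK|df]. Qed.

Fact wR_sig : {f : M -> RR | forall n,
  f n = rho (rec (one R) (fun _ r => rval (rho (hR := hR) r * 3^-1)) n)}.
Proof. by eexists. Qed.
(** The real [3^-n]. *)
Definition wR : M -> RR := proj1_sig wR_sig.

Lemma wRE n : wR n = rho (rec (one R) (fun _ r => rval (rho (hR := hR) r * 3^-1)) n).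
Proof. exact: (proj2_sig wR_sig). Qed.

Lemma tdef_wR t : tdef t -> tdef (fun e => rval (wR (t e))).
Proof. by move=> Ht; apply: (tdef_ext (fun e => esym (congr1 rval (wRE _)))); df. Qed.

Lemma wR0 : wR emp = 1.
Proof. by rewrite wRE rec0; [rewrite -rval1; exact: rvalK|df]. Qed.

Lemma wRS n : n ∈ om -> wR (succ n) = wR n * 3^-1.
Proof. by move=> Hn; rewrite !wRE recS //; [rewrite rvalK|df]. Qed.

End Reals.

Ltac dfn_reg2 ::= lazymatch goal with
  | |- dfn (fun e => is_true (Order.lt (@?u e) (@?v e))) => apply (dfn_rlt (u := u) (v := v))
  | |- dfn (fun e => is_true (Order.le (@?u e) (@?v e))) => apply (dfn_rle (u := u) (v := v))
  | |- dfn (fun e => @?u e = @?v e) => apply (dfn_req (u := u) (v := v))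
  | |- tdef (fun e => rval (GRing.add (@?u e) (@?v e))) => apply (tdef_radd (u := u) (v := v))
  | |- tdef (fun e => rval (GRing.mul (@?u e) (@?v e))) => apply (tdef_rmul (u := u) (v := v))
  | |- tdef (fun e => rval (rho (@?t e))) => apply (tdef_rho (t := t))
  | |- tdef (fun e => rval (iR (@?t e))) => apply (tdef_iR (t := t))
  | |- tdef (fun e => rval (wR (@?t e))) => apply (tdef_wR (t := t))
  end.

Section Reals2.
Context {M : structure} {hZF : ZF M} {R : field_data M} {hR : complete_ordered_field R}.
Local Notation RR := (RF (reals (hR := hR))).
Local Open Scope ring_scope.
Implicit Types (u v : RR) (n m k a b : M).
Local Notation iR := (iR (hR := hR)).
Local Notation wR := (wR (hR := hR)).

Lemma iR_ge0 n : n ∈ om -> 0 <= iR n.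
Proof.
move: n; apply: om_ind; first by df.
  by rewrite iR0.
by move=> n Hn IH; rewrite iRS //; lra.
Qed.

Lemma iR_lt n m : n ∈ om -> m ∈ n -> iR m + 1 <= iR n.
Proof.
move=> Hn; move: n Hn m.
apply: (om_ind (P := fun n => forall m, m ∈ n -> iR m + 1 <= iR n)); first by df.
  by move=> m /in_emp.
move=> n Hn IH m /in_succ [K|->]; rewrite iRS //.
by have := IH m K; lra.
Qed.

Lemma iR_inj n m : n ∈ om -> m ∈ om -> iR n = iR m -> n = m.
Proof.
move=> Hn Hm E.
case: (om_total Hn Hm) => [|[]] // H; exfalso; [have := iR_lt Hm H|have := iR_lt Hn H]; lra.
Qed.

(** Least upper bounds of the values of definable functions on a set. *)
Lemma real_lub (a : M) (F : M -> RR) : tdef (fun e => rval (F (e 0%N))) ->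
  nonempty M a -> (exists u, forall x, x ∈ a -> F x <= u) ->
  exists s, (forall x, x ∈ a -> F x <= s) /\ forall u, (forall x, x ∈ a -> F x <= u) -> s <= u.
Proof.
move=> HF [x0 Hx0] [u Hu].
have E x y : ~ lt R (rval x) (rval y) <-> y <= x :> RR.
  by rewrite leNgt; split=> [H|/negP H K]; [apply/negP => K|]; apply: H; exact/valR_lt.
have I y : y ∈ img a (fun x => rval (F x)) <-> exists x, x ∈ a /\ y = rval (F x) by exact: in_img.
have [|||s [sR [H1 H2]]] := cof_complete hR (a := img a (fun x => rval (F x))).
- by move=> y /I [x [_ ->]]; exact: rvalP.
- by exists (rval (F x0)); apply/I; exists x0.
- by exists (rval u); split=> [|y /I [x [xa ->]]]; [exact: rvalP|apply/E; exact: Hu].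
exists (rho s); split=> [x xa|v Hv].
  by apply/E; rewrite rhoK //; apply: H1; apply/I; exists x.
apply/E; rewrite rhoK //; apply: H2; first exact: rvalP.
by move=> y /I [x [xa ->]]; apply/E; exact: Hv.
Qed.

Lemma archimedes u : exists n, n ∈ om /\ u < iR n.
Proof.
apply: NNPP => H.
have B n : n ∈ om -> iR n <= u.
  by move=> Hn; rewrite leNgt; apply/negP => K; apply: H; exists n.
have [|||s [Hs Ls]] := @real_lub om iR; first by df.
- by exists emp; exact: om_emp.
- by exists u.
suff : s <= s - 1 by lra.
apply: Ls => n Hn; have := Hs _ (om_succ Hn); rewrite iRS //; lra.
Qed.

Lemma wR_gt0 n : n ∈ om -> 0 < wR n.
Proof.
move: n; apply: om_ind; first by df.
  by rewrite wR0; lra.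
by move=> n Hn IH; rewrite wRS //; lra.
Qed.

Lemma wR_small u : 0 < u -> exists n, n ∈ om /\ wR n < u.
Proof.
move=> u0; have B n : n ∈ om -> wR n * (iR n + 1) <= 1.
  move: n; apply: om_ind; first by df.
    by rewrite wR0 iR0; lra.
  move=> n Hn IH; rewrite wRS // iRS //.
  have w0 := wR_gt0 Hn; have i0 := iR_ge0 Hn; nra.
have [n [Hn L]] := archimedes u^-1; exists n; split=> //.
have := B n Hn; have w0 := wR_gt0 Hn.
have uV : u * u^-1 = 1 by rewrite mulfV // gt_eqF.
rewrite ltNge => K1; apply/negP => K.
have H1 : u * u^-1 <= wR n * u^-1 by apply: ler_wpM2r => //; rewrite invr_ge0 ltW.
have H2 : wR n * u^-1 < wR n * iR n by rewrite ltr_pM2l.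
by lra.
Qed.

Lemma wR_mono n m : n ∈ om -> m ∈ om -> n ⊆ m -> wR m <= wR n.
Proof.
move=> Hn; move: m; apply: om_ind_from => //; first by df.
by move=> m Hm _ IH; have w0 := wR_gt0 Hm; rewrite wRS //; lra.
Qed.

(** The reals that are natural numbers. *)
Definition isN u : Prop := exists k, k ∈ om /\ u = iR k.

Lemma isN_add u v : isN u -> isN v -> isN (u + v).
Proof.
move=> [a [Ha ->]] [b [Hb ->]]; move: b Hb.
apply: (om_ind (P := fun b => isN (iR a + iR b))); rewrite /isN; first by df.
  by exists a; rewrite iR0 addr0.
move=> b Hb [k [Hk E]]; exists (succ k); split; first exact: om_succ.
by rewrite !iRS // -E; lra.
Qed.

Lemma isN_mul u v : isN u -> isN v -> isN (u * v).
Proof.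
move=> [a [Ha ->]] [b [Hb ->]]; move: b Hb.
apply: (om_ind (P := fun b => isN (iR a * iR b))); first by rewrite /isN; df.
  by exists emp; rewrite iR0 mulr0; split=> //; exact: om_emp.
move=> b Hb IH; rewrite iRS // mulrDr mulr1; apply: isN_add => //.
by exists a.
Qed.

Fact np_sig : {f : M -> M -> M | forall a b, f a b =
  iota (fun k => k ∈ om /\ iR k = (iR a + iR b) * (iR a + iR b) + iR a)}.
Proof. by eexists. Qed.
(** An injection of pairs of natural numbers into the natural numbers,
    [(a, b) |-> (a + b)^2 + a], computed in the reals. *)
Definition np : M -> M -> M := proj1_sig np_sig.

Lemma npE a b : np a b = iota (fun k => k ∈ om /\ iR k = (iR a + iR b) * (iR a + iR b) + iR a).
Proof. exact: (proj2_sig np_sig). Qed.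

Lemma npP a b : a ∈ om -> b ∈ om ->
  np a b ∈ om /\ iR (np a b) = (iR a + iR b) * (iR a + iR b) + iR a.
Proof.
move=> Ha Hb; rewrite npE; apply: (iotaP (P := fun k => k ∈ om /\ iR k = (iR a + iR b) * (iR a + iR b) + iR a)).
have [||k [Hk E]] := @isN_add ((iR a + iR b) * (iR a + iR b)) (iR a).
- by apply: isN_mul; apply: isN_add; [exists a|exists b|exists a|exists b].
- by exists a.
exists k; split=> // k' [Hk' E']; apply: iR_inj => //; by rewrite -E E'.
Qed.

(* [(x + y)^2 + x] lies between the squares of [x + y] and [x + y + 1]. *)
Lemma np_gap (x y x' y' : RR) : 0 <= x -> 0 <= y -> 0 <= x' -> 0 <= y' ->
  x + y + 1 <= x' + y' -> (x + y) * (x + y) + x = (x' + y') * (x' + y') + x' -> False.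
Proof.
move=> x0 y0 x'0 y'0 H E.
have K : (x + y + 1) * (x + y + 1) <= (x' + y') * (x' + y').
  by apply: ler_pM => //; lra.
by lra.
Qed.

Lemma np_inj a b a' b' : a ∈ om -> b ∈ om -> a' ∈ om -> b' ∈ om ->
  np a b = np a' b' -> a = a' /\ b = b'.
Proof.
move=> Ha Hb Ha' Hb' E.
have [_ E1] := npP Ha Hb; have [_ E2] := npP Ha' Hb'.
have {}E : (iR a + iR b) * (iR a + iR b) + iR a = (iR a' + iR b') * (iR a' + iR b') + iR a'.
  by rewrite -E1 -E2 E.
have [||s [Hs Es]] := @isN_add (iR a) (iR b); [by exists a|by exists b|].
have [||s' [Hs' Es']] := @isN_add (iR a') (iR b'); [by exists a'|by exists b'|].
have := iR_ge0 Ha; have := iR_ge0 Hb; have := iR_ge0 Ha'; have := iR_ge0 Hb'.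
move=> y'0 x'0 y0 x0.
case: (om_total Hs Hs') => [/(iR_lt Hs')|[S|/(iR_lt Hs)]]; rewrite -?Es -?Es'.
- by move=> H; case: (np_gap x0 y0 x'0 y'0 H).
- rewrite Es Es' S in E.
  have Ea : iR a = iR a' by move/addrI: E.
  have Eb : iR b = iR b' by apply: (@addrI _ (iR a)); rewrite {2}Ea Es Es' S.
  by split; apply: iR_inj.
- by move=> H; case: (np_gap x'0 y'0 x0 y0 H).
Qed.

Lemma tdef_np s t : tdef s -> tdef t -> tdef (fun e : nat -> M => np (s e) (t e)).
Proof. by move=> Hs Ht; apply: (tdef_ext (fun e => esym (npE _ _))); df. Qed.
End Reals2.

Global Opaque np.

(** * Finite sequences *)

Section Sequences.
Context {M : structure} {hZF : ZF M}.
Implicit Types (a b c g n m k x y z p s t : M).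

(** The components of a pair. *)
Definition pfst p : M := iota (fun x => exists y, p = pr x y).
Definition psnd p : M := iota (fun y => exists x, p = pr x y).

Lemma pfst_pr x y : pfst (pr x y) = x.
Proof. by apply: iota_eq => [|z [w /pr_inj []]]; [exists y|]. Qed.

Lemma psnd_pr x y : psnd (pr x y) = y.
Proof. by apply: iota_eq => [|z [w /pr_inj []]]; [exists x|]. Qed.

Lemma tdef_pfst (t : (nat -> M) -> M) : tdef t -> tdef (fun e : nat -> M => pfst (t e)).
Proof. by move=> Ht; rewrite /pfst; df. Qed.

Lemma tdef_psnd (t : (nat -> M) -> M) : tdef t -> tdef (fun e : nat -> M => psnd (t e)).
Proof. by move=> Ht; rewrite /psnd; df. Qed.

(** The length of a finite sequence. *)
Definition dom s : M :=
  iota (fun n => n ∈ om /\ forall i, i ∈ n <-> exists y, pr i y ∈ s).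

Lemma tdef_dom (t : (nat -> M) -> M) : tdef t -> tdef (fun e : nat -> M => dom (t e)).
Proof. by move=> Ht; rewrite /dom; df. Qed.

(** [s] is a sequence of length [n] in [A]. *)
Definition isseq s n (A : M -> Prop) : Prop := is_map M s (fun i => i ∈ n) A.

Lemma dfn_isseq (t u : (nat -> M) -> M) (A : (nat -> M) -> M -> Prop) : tdef t -> tdef u ->
  dfn (fun e => A (fun i => e i.+1) (e 0%N)) -> dfn (fun e => isseq (t e) (u e) (A e)).
Proof. by move=> Ht Hu HA; rewrite /isseq; df. Qed.

Lemma dom_eq s n (A : M -> Prop) : n ∈ om -> isseq s n A -> dom s = n.
Proof.
move=> Hn Hs; have K i : i ∈ n <-> exists y, pr i y ∈ s.
  by split=> [H|[y /(map_dom Hs) []] //]; exists (ap s i); exact: (map_pr Hs H).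
by apply: iota_eq => // m [_ Hm]; apply: ext => i; rewrite Hm K.
Qed.

(** The set of finite sequences of elements of [a]. *)
Definition seqs a : M :=
  sep (pow (prod om a)) (fun s => exists n, n ∈ om /\ isseq s n (fun x => x ∈ a)).

Lemma in_seqs a s : s ∈ seqs a <-> exists n, n ∈ om /\ isseq s n (fun x => x ∈ a).
Proof.
rewrite in_sep; last by rewrite /isseq; df.
split=> [[_ //]|[n [Hn Hs]]]; split; last by exists n.
apply/in_pow => p /(map_in Hs) [i [ni ->]]; apply/pr_in_prod.
by split; [exact: om_in ni|exact: (map_val Hs ni)].
Qed.

Lemma tdef_seqs (t : (nat -> M) -> M) : tdef t -> tdef (fun e : nat -> M => seqs (t e)).
Proof. by move=> Ht; rewrite /seqs /isseq; df. Qed.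

(** The restriction of [s] to [n = {0, ..., n - 1}]. *)
Definition restr s n : M := sep s (fun p => exists i y, i ∈ n /\ p = pr i y).

Lemma tdef_restr (t u : (nat -> M) -> M) : tdef t -> tdef u ->
  tdef (fun e : nat -> M => restr (t e) (u e)).
Proof. by move=> Ht Hu; rewrite /restr; df. Qed.

Lemma in_restr s n i y : pr i y ∈ restr s n <-> pr i y ∈ s /\ i ∈ n.
Proof.
rewrite in_sep; last by df.
split=> [[H [j [z [jn /pr_inj [E _]]]]]|[H ni]]; split=> //; first by rewrite E.
by exists i, y.
Qed.

Lemma restr_sub s n : restr s n ⊆ s.
Proof. by move=> z; rewrite in_sep; [case|df]. Qed.

Lemma restr_isseq s n (A B : M -> Prop) : is_map M s A B -> (forall i, i ∈ n -> A i) ->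
  isseq (restr s n) n B.
Proof.
move=> Hs H; have K p : p ∈ restr s n <-> exists i, i ∈ n /\ p = pr i (ap s i).
  split=> [|[i [ni ->]]]; last by apply/in_restr; split=> //; exact: (map_pr Hs (H i ni)).
  rewrite in_sep; last by df.
  by case=> /[swap] -[i [y [ni ->]]] /(map_ap Hs) <-; exists i.
apply: map_intro => [p /K [i [ni ->]]|i ni].
  by exists i, (ap s i); do 2!split=> //; exact: (map_val Hs (H i ni)).
exists (ap s i); split; first by apply/K; exists i.
by move=> y /K [j [_ /pr_inj [-> ->]]].
Qed.

Lemma ap_restr s n (A B : M -> Prop) i : is_map M s A B -> (forall i, i ∈ n -> A i) -> i ∈ n ->
  ap (restr s n) i = ap s i.
Proof.
move=> Hs H ni; apply: (map_ap (restr_isseq Hs H)); apply/in_restr.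
by split=> //; exact: (map_pr Hs (H i ni)).
Qed.

End Sequences.

Ltac dfn_reg3 ::= first
  [ simple apply tdef_pfst | simple apply tdef_psnd | simple apply tdef_dom
  | simple apply tdef_seqs | simple apply tdef_restr | simple apply tdef_np
  | simple apply dfn_isseq
  | progress unfold subset, empty, nonempty, is_succ, inductive, is_pair, app,
      is_map, is_nat, injects, finite, countable, op, in_prod ].

Global Opaque pfst psnd dom seqs restr.

Section Enc.
Context {M : structure} {hZF : ZF M} {R : field_data M} {hR : complete_ordered_field R}.
Implicit Types (a b c g n m k x y z p s t : M).
Local Notation RR := (RF (reals (hR := hR))).
Local Notation np := (np (hR := hR)).

Lemma np_om a b : a ∈ om -> b ∈ om -> np a b ∈ om.
Proof. by move=> Ha Hb; have [] := npP (hR := hR) Ha Hb. Qed.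

Lemma countable_prod a b : countable M a -> countable M b -> countable M (prod a b).
Proof.
move=> /countableP [g [Hg I]] /countableP [h [Hh J]].
apply: (@countable_intro _ _ (fun p => np (ap g (pfst p)) (ap h (psnd p)))); first by df.
  by move=> p /in_prodP [x [y [xa [yb ->]]]]; rewrite pfst_pr psnd_pr; apply: np_om; auto.
move=> p q /in_prodP [x [y [xa [yb ->]]]] /in_prodP [x' [y' [x'a [y'b ->]]]].
rewrite !pfst_pr !psnd_pr => /np_inj [||||E1 E2]; auto.
by rewrite (I _ _ xa x'a E1) (J _ _ yb y'b E2).
Qed.

(** The code of a sequence is the pair of its length and the pairing, iterated along it, of
    the codes of its terms. *)
Lemma countable_seqs a : countable M a -> countable M (seqs a).
Proof.
move=> /countableP [g [Hg I]].
pose (c := fun s n => rec emp (fun k z => np z (ap g (ap s k))) n).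
have Dc s : tdef (fun e => c s (e 0%N)) by rewrite /c; df.
have cS s k : k ∈ om -> c s (succ k) = np (c s k) (ap g (ap s k)).
  by move=> Hk; rewrite /c recS //; df.
have cP s n : n ∈ om -> isseq s n (fun x => x ∈ a) ->
    forall k, k ∈ om -> k ⊆ n -> c s k ∈ om.
  move=> Hn Hs; have Ds := Dc s; apply: om_ind; first by df.
    by move=> _; rewrite /c rec0; [exact: om_emp|df].
  move=> k Hk IH H; have kn := (succ_sub Hk Hn).1 H.
  rewrite cS //; apply: np_om; first by apply: IH; apply/om_sub; auto.
  by apply: Hg; exact: (map_val Hs kn).
have cI s t n : n ∈ om -> isseq s n (fun x => x ∈ a) -> isseq t n (fun x => x ∈ a) ->
    forall k, k ∈ om -> k ⊆ n -> c s k = c t k -> forall i, i ∈ k -> ap s i = ap t i.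
  move=> Hn Hs Ht; have Ds := Dc s; have Dt := Dc t; apply: om_ind; [by df|by move=> _ _ i /in_emp|].
  move=> k Hk IH H; have kn := (succ_sub Hk Hn).1 H.
  have Hkn : k ⊆ n by apply/om_sub; auto.
  rewrite !cS //.
  have Hsk := map_val Hs kn; have Htk := map_val Ht kn.
  move=> /np_inj [||||E1 E2].
  - exact: (cP s n).
  - exact: Hg.
  - exact: (cP t n).
  - exact: Hg.
  - by move=> i /in_succ [|->]; [exact: IH|exact: I].
apply: (@countable_intro _ _ (fun s => np (dom s) (c s (dom s)))); first by rewrite /c; df.
  move=> s /in_seqs [n [Hn Hs]]; rewrite (dom_eq Hn Hs); apply: np_om => //.
  exact: (cP s n).
move=> s t /in_seqs [n [Hn Hs]] /in_seqs [m [Hm Ht]].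
rewrite (dom_eq Hn Hs) (dom_eq Hm Ht) => /np_inj [//||//||E1 E2]; subst.
- exact: (cP s n).
- exact: (cP t m).
- by apply: (map_ext Hs Ht) => // i; apply: (cI s t m).
Qed.

Local Open Scope ring_scope.

(** * Coding subsets of omega by reals, and countable choice *)

(** Partial sums of the ternary expansion whose [n]-th digit is 1 if [n ∈ S], else 0. *)
Definition psum (S n : M) : RR :=
  rho (rec (zero R) (fun k r => ite (k ∈ S) (rval (rho r + wR (hR := hR) k)) r) n).

Lemma psum0 S : psum S emp = 0.
Proof. by rewrite /psum rec0; [rewrite -rval0; exact: rvalK|df]. Qed.

Lemma psumS S n : n ∈ om -> psum S (succ n) =
  if excluded_middle_informative (n ∈ S) then psum S n + wR (hR := hR) n else psum S n.
Proof.
move=> Hn; rewrite {1}/psum recS //; last by df.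
by case: excluded_middle_informative => H; [rewrite ite_true ?rvalK|rewrite ite_false].
Qed.

Lemma tdef_psum (s t : (nat -> M) -> M) : tdef s -> tdef t ->
  tdef (fun e => rval (psum (s e) (t e))).
Proof. by move=> Hs Ht; rewrite /psum; df. Qed.
End Enc.

Ltac dfn_reg4 ::= lazymatch goal with
  | |- tdef (fun e => rval (psum (@?t e) (@?u e))) => apply (tdef_psum (s := t) (t := u))
  end.

Section Enc2.
Context {M : structure} {hZF : ZF M} {R : field_data M} {hR : complete_ordered_field R}.
Implicit Types (a b c g n m k x y z p s t : M).
Local Notation RR := (RF (reals (hR := hR))).
Local Open Scope ring_scope.
Local Notation wR := (wR (hR := hR)).
Local Notation psum := (psum (hR := hR)).

Lemma psum_bound S n m : n ∈ om -> m ∈ om -> n ⊆ m ->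
  psum S n <= psum S m /\ psum S m + 3 / 2 * wR m <= psum S n + 3 / 2 * wR n.
Proof.
move=> Hn; move: m; apply: om_ind_from => //; first by df.
move=> m Hm _ [IH1 IH2]; have w0 := wR_gt0 (hR := hR) Hm.
by rewrite psumS // wRS //; case: (excluded_middle_informative (m ∈ S)) => ? /=; split; lra.
Qed.

(** [z] is the supremum of the partial sums. *)
Definition isenc (S z : M) : Prop :=
  z ∈ car R /\ (forall n, n ∈ om -> psum S n <= rho z) /\
  forall u : RR, (forall n, n ∈ om -> psum S n <= u) -> rho z <= u.

Lemma isenc_ex S : exists! z, isenc S z.
Proof.
have Ds : tdef (fun e : nat -> M => rval (psum S (e 0%N))) by df.
have [||s [H1 H2]] := @real_lub _ _ _ hR om (psum S) Ds.
- by exists emp; exact: om_emp.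
- exists (3 / 2) => n Hn.
  have [|_ B] := @psum_bound S emp n om_emp Hn; first by move=> z /in_emp.
  move: B; by have := wR_gt0 (hR := hR) Hn; rewrite psum0 wR0; lra.
exists (rval s); split.
  by split; [exact: rvalP|rewrite rvalK].
move=> z [zR [K1 K2]]; rewrite -(rhoK (hR := hR) zR); congr rval.
by apply/eqP; rewrite eq_le H2 // K2.
Qed.

(** The real coding the subset [S] of omega. *)
Definition enc (S : M) : M := iota (fun z => z ∈ car R /\
  (forall n, n ∈ om -> psum S n <= rho z) /\
  forall y, (forall n, n ∈ om -> psum S n <= rho y) -> rho (hR := hR) z <= rho y).

Lemma encP S : isenc S (enc S).
Proof.
have E z : isenc S z <-> z ∈ car R /\
  (forall n, n ∈ om -> psum S n <= rho z) /\
  forall y, (forall n, n ∈ om -> psum S n <= rho y) -> rho (hR := hR) z <= rho y.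
  split=> -[zR [H1 H2]]; split=> //; split=> // u Hu; first exact: H2.
  by have := H2 (rval u); rewrite rvalK; apply.
have [z [Hz U]] := isenc_ex S.
by have -> : enc S = z by apply: iota_eq; [apply/E|move=> y /E /U].
Qed.

(* At the first difference [n], the digit 1 outweighs all later digits: the tail of the
   expansion of [T] is at most [3/2 * 3^-(n+1) = 3^-n / 2]. *)
Lemma enc_lt S T n : n ∈ om -> psum S n = psum T n -> n ∈ S -> ~ n ∈ T ->
  rho (hR := hR) (enc T) < rho (enc S).
Proof.
move=> Hn E nS nT; have Hs := om_succ Hn.
have [_ [H1 _]] := encP S; have [_ [_ H2]] := encP T.
have := H1 _ Hs; rewrite psumS //.
case: (excluded_middle_informative (n ∈ S)) => //= ? HS.
have w0 := wR_gt0 (hR := hR) Hn.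
have : rho (enc T) <= psum T n + 3 / 2 * (wR n * 3^-1); last by lra.
apply: H2 => m Hm; have [k [Hk [nk mk]]] := om_max Hs Hm.
have [K1 _] := psum_bound T Hm Hk mk; have [_ K2] := psum_bound T Hs Hk nk.
have := wR_gt0 (hR := hR) Hk.
move: K2; rewrite psumS // wRS //.
by case: (excluded_middle_informative (n ∈ T)) => //= ?; lra.
Qed.

Lemma enc_inj S T : S ⊆ om -> T ⊆ om -> enc S = enc T -> S = T.
Proof.
move=> HS HT E; apply: NNPP => ne.
have [||n [Hn [D L]]] := @om_least _ _ (fun n => ~ (n ∈ S <-> n ∈ T)); first by df.
  apply: NNPP => K; apply: ne; apply: ext => n; apply: NNPP => D; apply: K; exists n.
  by split=> //; apply: NNPP => nO; apply: D; split=> [/HS|/HT].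
have Ek : forall k, k ∈ om -> k ⊆ n -> psum S k = psum T k.
  apply: om_ind; [by df|by rewrite !psum0|move=> k Hk IH kn].
  have kn' := (succ_sub Hk Hn).1 kn.
  rewrite !psumS // IH; last by apply/om_sub; auto.
  have := NNPP _ (L _ kn').
  by case: (excluded_middle_informative (k ∈ S)) => ?;
    case: (excluded_middle_informative (k ∈ T)) => ?; tauto.
have {}Ek := Ek n Hn (fun z h => h).
case: (excluded_middle_informative (n ∈ S)) => nS;
  case: (excluded_middle_informative (n ∈ T)) => nT; try tauto.
- by have := enc_lt Hn Ek nS nT; rewrite E ltxx.
- by have := enc_lt Hn (esym Ek) nT nS; rewrite E ltxx.
Qed.

Lemma tdef_enc (s : (nat -> M) -> M) : tdef s -> tdef (fun e => enc (s e)).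
Proof. by move=> Hs; rewrite /enc; df. Qed.

End Enc2.

Section Choice.
Context {M : structure} {hZF : ZF M} {R : field_data M} {hR : complete_ordered_field R}.
Hypothesis hAC : AC_omega_R R.
Implicit Types (a b c g i n m k x y z : M).

(** Countable choice for nonempty sets that inject, by [j], into the subsets of a countable
    set. *)
Lemma countable_choice I (S j : M -> M) C : countable M I -> countable M C ->
  tdef (fun e => S (e 0%N)) -> tdef (fun e => j (e 0%N)) ->
  (forall i x, i ∈ I -> x ∈ S i -> j x ⊆ C) ->
  (forall i x y, i ∈ I -> x ∈ S i -> y ∈ S i -> j x = j y -> x = y) ->
  (forall i, i ∈ I -> nonempty M (S i)) ->
  exists c, forall i, i ∈ I -> ap c i ∈ S i.
Proof.
move=> HI HC DS Dj jC jI SN; have [g [Hg gI]] := (countableP C).1 HC.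
pose (h := fun x => enc (hR := hR) (img (j x) (fun y => ap g y))).
have Dg : tdef (fun e : nat -> M => ap g (e 0%N)) by df.
have Dh : tdef (fun e => h (e 0%N)) by apply: tdef_enc; df.
have hI i x y : i ∈ I -> x ∈ S i -> y ∈ S i -> h x = h y -> x = y.
  move=> iI xS yS /enc_inj E; apply: (jI i) => //.
  have {}E : img (j x) (fun y => ap g y) = img (j y) (fun y => ap g y).
    by apply: E => z /(in_img _ Dg) [w [wj ->]]; apply: Hg; [exact: (jC i x)|exact: (jC i y)].
  have K u v : u ∈ S i -> v ∈ S i ->
      img (j u) (fun y => ap g y) = img (j v) (fun y => ap g y) -> forall z, z ∈ j u -> z ∈ j v.
    move=> uS vS E' z zu.
    have /(in_img _ Dg) [w [wv Ew]] : ap g z ∈ img (j v) (fun y => ap g y).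
      by rewrite -E'; apply/in_img => //; exists z.
    by have -> : z = w by apply: gI => //; [exact: (jC i u)|exact: (jC i v)].
  by apply: ext => z; split; apply: K.
have DF : tdef (fun e => img (S (e 0%N)) h) by df.
have [||c [Hc cP]] := hAC (F := img I (fun i => img (S i) h)).
- exact: countable_img.
- move=> a /(in_img _ DF) [i [iI ->]]; split.
    by move=> z /(in_img _ Dh) [x [_ ->]]; have [] := encP (hR := hR) (img (j x) (fun y => ap g y)).
  by have [x xS] := SN i iI; exists (h x); apply/in_img => //; exists x.
exists (lam I (fun i => iota (fun x => x ∈ S i /\ h x = ap c (img (S i) h)))) => i iI.
rewrite ap_lam //; last by df.
have ai : img (S i) h ∈ img I (fun i => img (S i) h) by apply/in_img => //; exists i.
have /(in_img _ Dh) [x [xS Ex]] : ap c (img (S i) h) ∈ img (S i) h.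
  by apply: cP; apply/(map_app _ _ Hc); split.
rewrite (iota_eq (z := x)) // => y [yS Ey]; apply: (hI i) => //; by rewrite Ey.
Qed.
End Choice.

(** * Separable metrizable spaces *)

Section Spaces.
Context {M : structure} {hZF : ZF M}.
Implicit Types (X : space M) (U V B C x y z : M).

Definition disjoint U V : Prop := forall z, z ∈ U -> ~ z ∈ V.

(** Points all of whose neighbourhoods meet [B]. *)
Definition adherent X B z : Prop :=
  z ∈ pts X /\ forall V, V ∈ opens X -> z ∈ V -> exists w, w ∈ V /\ w ∈ B.

(** The topological facts on metrizable spaces used below. *)
Record topological X : Prop := {
  open_sub : forall U, U ∈ opens X -> U ⊆ pts X;
  open_local : forall U, U ⊆ pts X ->
    (forall x, x ∈ U -> exists V, V ∈ opens X /\ x ∈ V /\ V ⊆ U) -> U ∈ opens X;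
  open_all : pts X ∈ opens X;
  open_cap : forall U V x, U ∈ opens X -> V ∈ opens X -> x ∈ U -> x ∈ V ->
    exists W, W ∈ opens X /\ x ∈ W /\ W ⊆ U /\ W ⊆ V;
  open_T1 : forall x y, x ∈ pts X -> y ∈ pts X ->
    (forall V, V ∈ opens X -> x ∈ V -> y ∈ V) -> x = y
}.

(** [B] is a countable basis; [pr n b ∈ S] says that [b ∈ B] is small at scale [n]. *)
Record basis X B S : Prop := {
  basis_countable : countable M B;
  basis_open : forall b, b ∈ B -> b ∈ opens X;
  basis_at : forall U x n, U ∈ opens X -> x ∈ U -> n ∈ om ->
    exists b, b ∈ B /\ pr n b ∈ S /\ x ∈ b /\ b ⊆ U /\ forall z, adherent X b z -> z ∈ U;
  basis_small : forall V x, V ∈ opens X -> x ∈ V ->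
    exists n, n ∈ om /\ forall m b, m ∈ om -> n ⊆ m -> pr m b ∈ S -> x ∈ b -> b ⊆ V
}.

(** A countable family of triples of open sets: the first two members of a triple are
    apart, the last two cover the space, and the third can be taken inside a given
    neighbourhood of a point of the first. *)
Record apart_family X P w1 w2 w3 : Prop := {
  apart_countable : countable M P;
  apart_open1 : forall p, p ∈ P -> ap w1 p ∈ opens X;
  apart_open2 : forall p, p ∈ P -> ap w2 p ∈ opens X;
  apart_open3 : forall p, p ∈ P -> ap w3 p ∈ opens X;
  apart_sep : forall p l, p ∈ P -> l ∈ pts X -> exists V, V ∈ opens X /\ l ∈ V /\
    (disjoint V (ap w1 p) \/ disjoint V (ap w2 p));
  apart_at : forall V y, V ∈ opens X -> y ∈ V ->
    exists p, p ∈ P /\ y ∈ ap w1 p /\ ap w3 p ⊆ V;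
  apart_cover : forall p y, p ∈ P -> y ∈ pts X -> y ∈ ap w2 p \/ y ∈ ap w3 p
}.
End Spaces.

Section Metric.
Context {M : structure} {hZF : ZF M} {R : field_data M} {hR : complete_ordered_field R}.
Local Open Scope ring_scope.
Local Notation RR := (RF (reals (hR := hR))).
Local Notation wR := (wR (hR := hR)).
Variables (X : space M) (d : M).
Hypothesis Hd : metric R (pts X) d.
Hypothesis HX : forall U, U ∈ opens X <-> metric_open R (pts X) d U.
Implicit Types (U V x y z q : M).

(** The distance, as a real of the ambient logic. *)
Definition dist x y : RR := rho (ap d (pr x y)).

Lemma distP x y : x ∈ pts X -> y ∈ pts X -> op M d x y (rval (dist x y)).
Proof.
move=> xX yX; have [Hm _] := Hd; apply/opP.
have K : in_prod M (pts X) (pts X) (pr x y) by apply/in_prodE/pr_in_prod.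
by rewrite rhoK; [exact: (map_pr Hm K)|exact: (map_val Hm K)].
Qed.

Lemma dist_uniq x y r : op M d x y r -> r = rval (dist x y).
Proof.
have [Hm _] := Hd; move=> /opP H.
by rewrite /dist (map_ap Hm H) rhoK //; have [] := map_dom Hm H.
Qed.

Lemma dist_ge0 x y : x ∈ pts X -> y ∈ pts X -> 0 <= dist x y.
Proof.
move=> xX yX; have [_ [H _]] := Hd; rewrite leNgt; apply/negP => K.
by apply: (H _ _ _ (distP xX yX)); rewrite -rval0; apply/rltE.
Qed.

Lemma dist_sym x y : x ∈ pts X -> y ∈ pts X -> dist x y = dist y x.
Proof.
move=> xX yX; have [_ [_ [_ [H _]]]] := Hd.
by apply/rval_inj/dist_uniq/H/distP.
Qed.

Lemma dist_xx x : x ∈ pts X -> dist x x = 0.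
Proof.
move=> xX; have [_ [_ [H _]]] := Hd; symmetry; apply/rval_inj/dist_uniq.
by rewrite rval0; apply/H.
Qed.

Lemma dist_eq0 x y : x ∈ pts X -> y ∈ pts X -> dist x y = 0 -> x = y.
Proof.
move=> xX yX E; have [_ [_ [H _]]] := Hd; apply/H => //.
by rewrite -rval0 -E; apply: distP.
Qed.

Lemma dist_tri x y z : x ∈ pts X -> y ∈ pts X -> z ∈ pts X ->
  dist x z <= dist x y + dist y z.
Proof.
move=> xX yX zX; have [_ [_ [_ [_ H]]]] := Hd; rewrite leNgt; apply/negP => K.
apply: (H _ _ _ _ _ _ _ (distP xX yX) (distP yX zX) (distP xX zX)); first exact: valR_add.
exact/rltE.
Qed.

Lemma openE U : U ∈ opens X <-> U ⊆ pts X /\ forall x, x ∈ U ->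
  exists e : RR, 0 < e /\ forall y, y ∈ pts X -> dist x y < e -> y ∈ U.
Proof.
rewrite HX /metric_open; split=> -[UX H]; split=> // x xU; have [e [e0 K]] := H x xU.
- have eR : e ∈ car R.
    have /appP K0 := e0; have /in_prodE K1 := cof_lt_rel hR _ K0.
    by have /pr_in_prod [] := K1.
  exists (rho e); split=> [|y yX L].
    by apply/rltE; rewrite rval0 rhoK.
  apply: (K y _ yX (distP (UX _ xU) yX)).
  by have /rltE := L; rewrite rhoK.
- exists (rval e); split=> [|y r yX /dist_uniq -> L]; last by apply: K => //; apply/rltE.
  by rewrite -rval0; apply/rltE.
Qed.

Definition ball q (r : RR) : M := sep (pts X) (fun y => dist q y < r).

Lemma in_ball q r y : y ∈ ball q r <-> y ∈ pts X /\ dist q y < r.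
Proof. by apply: in_sep; rewrite /dist; df. Qed.

Lemma ball_open q r : q ∈ pts X -> ball q r ∈ opens X.
Proof.
move=> qX; apply/openE; split=> [y /in_ball [] //|x /in_ball [xX L]].
exists (r - dist q x); split=> [|y yX K]; first by lra.
by apply/in_ball; split=> //; have := dist_tri qX xX yX; lra.
Qed.

Lemma metric_topological : topological X.
Proof.
split.
- by move=> U /openE [].
- move=> U UX H; apply/openE; split=> // x xU.
  have [V [/openE [_ HV] [xV VU]]] := H x xU; have [e [e0 K]] := HV x xV.
  by exists e; split=> // y yX L; apply: VU; apply: K.
- by apply/openE; split=> // x xX; exists 1.
- move=> U V x /openE [UX HU] /openE [VX HV] xU xV.
  have [e [e0 K]] := HU x xU; have [f [f0 L]] := HV x xV; have xX := UX x xU.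
  have [g [g0 [ge gf]]] : exists g : RR, 0 < g /\ g <= e /\ g <= f.
    by case: (lerP e f) => ?; [exists e|exists f]; lra.
  exists (ball x g); split; first exact: ball_open.
  split; first by apply/in_ball; rewrite dist_xx.
  by split=> y /in_ball [yX D]; [apply: K|apply: L] => //; lra.
- move=> x y xX yX H; apply: dist_eq0 => //; apply: NNPP => ne.
  have := dist_ge0 xX yX; rewrite le_eqVlt => /orP [/eqP/esym //|pos].
  have /in_ball [_] : y ∈ ball x (dist x y).
    by apply: H; [exact: ball_open|apply/in_ball; rewrite dist_xx].
  by rewrite ltxx.
Qed.

Hypothesis HS : separable X.

Lemma dense_near x (r : RR) D : x ∈ pts X -> 0 < r -> D ⊆ pts X ->
  (forall U, U ∈ opens X -> nonempty M U -> exists x, x ∈ D /\ x ∈ U) ->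
  exists q, q ∈ D /\ q ∈ pts X /\ dist q x < r.
Proof.
move=> xX r0 DX H; have [||q [qD /in_ball [qX L]]] := H (ball x r); first exact: ball_open.
  by exists x; apply/in_ball; rewrite dist_xx.
by exists q; rewrite dist_sym.
Qed.

Lemma tdef_ball (s t : (nat -> M) -> M) : tdef s -> tdef t ->
  tdef (fun e => ball (s e) (wR (t e))).
Proof.
move=> Hs Ht; rewrite /ball /dist.
by have Hs' := tdef_ren S Hs; have Ht' := tdef_ren S Ht; df.
Qed.

(** The balls [B(q, 3^-m)] with [q] in the dense set; such a ball is small at scale [n] if
    [n <= m]. *)
Lemma metric_basis : exists B S, basis X B S.
Proof.
have [D [DX [Dc Dd]]] := HS.
pose (F := fun p => ball (pfst p) (wR (psnd p))).
have DF : tdef (fun e => F (e 0%N)) by apply: tdef_ball; df.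
pose (B := img (prod D om) F).
pose (Q := fun p => exists q m, q ∈ D /\ m ∈ om /\ pfst p ⊆ m /\ psnd p = F (pr q m)).
have DQ : dfn (fun e => Q (e 0%N)) by rewrite /Q; df.
have FE q m : F (pr q m) = ball q (wR m) by rewrite /F pfst_pr psnd_pr.
have BE q m : q ∈ D -> m ∈ om -> ball q (wR m) ∈ B.
  by move=> qD Hm; apply/in_img => //; exists (pr q m); rewrite FE; split=> //; apply/pr_in_prod.
have SE n b : pr n b ∈ sep (prod om B) Q <-> n ∈ om /\
    exists q m, q ∈ D /\ m ∈ om /\ n ⊆ m /\ b = ball q (wR m).
  rewrite in_sep // pr_in_prod /Q pfst_pr psnd_pr; split.
    by move=> [[Hn _] [q [m [qD [Hm [nm ->]]]]]]; split=> //; exists q, m; rewrite FE.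
  move=> [Hn [q [m [qD [Hm [nm ->]]]]]]; split; first by split=> //; apply: BE.
  by exists q, m; rewrite FE.
exists B, (sep (prod om B) Q); split.
- by apply: countable_img => //; apply: countable_prod => //; exact: countable_om.
- move=> b /(in_img _ DF) [p [/in_prodP [q [m [qD [Hm ->]]]] ->]].
  by rewrite FE; apply: ball_open; apply: DX.
- move=> U x n /openE [UX HU] xU Hn; have [e [e0 K]] := HU x xU; have xX := UX x xU.
  have [|m0 [Hm0 L0]] := wR_small (hR := hR) (u := e / 3); first by lra.
  have [m [Hm [m0m nm]]] := om_max Hm0 Hn.
  have L := wR_mono (hR := hR) Hm0 Hm m0m; have w0 := wR_gt0 (hR := hR) Hm.
  have [q [qD [qX Lq]]] := dense_near xX w0 DX Dd.
  exists (ball q (wR m)); split; first exact: BE.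
  split; first by apply/SE; split=> //; exists q, m.
  split; first by apply/in_ball.
  split=> [y /in_ball [yX Ly]|z [zX Hz]].
    by apply: K => //; have := dist_tri xX qX yX; rewrite (dist_sym xX qX); lra.
  have [||y [/in_ball [yX Ly] /in_ball [_ Ly']]] := Hz (ball z (wR m)); first exact: ball_open.
    by apply/in_ball; rewrite dist_xx.
  apply: K => //; have := dist_tri xX qX zX; have := dist_tri qX yX zX.
  by rewrite (dist_sym xX qX) (dist_sym yX zX); lra.
- move=> V x /openE [VX HV] xV; have [e [e0 K]] := HV x xV; have xX := VX x xV.
  have [|n [Hn L0]] := wR_small (hR := hR) (u := e / 2); first by lra.
  exists n; split=> // m b Hm nm /SE [_ [q [k [qD [Hk [mk ->]]]]]] /in_ball [_ Lx] y.
  move=> /in_ball [yX Ly]; apply: K => //; have qX := DX q qD.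
  have L1 := wR_mono (hR := hR) Hn Hm nm; have L2 := wR_mono (hR := hR) Hm Hk mk.
  by have := dist_tri xX qX yX; rewrite (dist_sym xX qX); lra.
Qed.

(** For [q] in the dense set and [r = 3^-m]: the ball [B(q, r)], the complement of the closed
    ball of radius [2r], and the ball [B(q, 3r)]. *)
Lemma metric_apart_family : exists P w1 w2 w3, apart_family X P w1 w2 w3.
Proof.
have [D [DX [Dc Dd]]] := HS.
pose (F1 := fun p => ball (pfst p) (wR (psnd p))).
pose (F2 := fun p => sep (pts X) (fun y => 2 * wR (psnd p) < dist (pfst p) y)).
pose (F3 := fun p => ball (pfst p) (3 * wR (psnd p))).
have DF1 : tdef (fun e => F1 (e 0%N)) by apply: tdef_ball; df.
have DF2 : tdef (fun e => F2 (e 0%N)) by rewrite /F2 /dist; df.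
have DF3 : tdef (fun e => F3 (e 0%N)) by rewrite /F3 /ball /dist; df.
have E1 q m : q ∈ D -> m ∈ om -> ap (lam (prod D om) F1) (pr q m) = ball q (wR m).
  by move=> qD Hm; rewrite ap_lam ?/F1 ?pfst_pr ?psnd_pr //; apply/pr_in_prod.
have E3 q m : q ∈ D -> m ∈ om -> ap (lam (prod D om) F3) (pr q m) = ball q (3 * wR m).
  by move=> qD Hm; rewrite ap_lam ?/F3 ?pfst_pr ?psnd_pr //; apply/pr_in_prod.
have E2 q m y : q ∈ D -> m ∈ om -> y ∈ ap (lam (prod D om) F2) (pr q m) <->
    y ∈ pts X /\ 2 * wR m < dist q y.
  move=> qD Hm; rewrite ap_lam //; last by apply/pr_in_prod.
  by rewrite /F2 in_sep ?pfst_pr ?psnd_pr // /dist; df.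
exists (prod D om), (lam (prod D om) F1), (lam (prod D om) F2), (lam (prod D om) F3); split.
- by apply: countable_prod => //; exact: countable_om.
- by move=> p /in_prodP [q [m [qD [Hm ->]]]]; rewrite E1 //; apply/ball_open/DX.
- move=> p /in_prodP [q [m [qD [Hm ->]]]]; have qX := DX q qD; apply/openE.
  split=> [y /E2 []//|x /E2 [] // xX L]; exists (dist q x - 2 * wR m).
  split=> [|y yX Ly]; first by lra.
  by apply/E2 => //; split=> //; have := dist_tri qX yX xX; rewrite (dist_sym yX xX); lra.
- by move=> p /in_prodP [q [m [qD [Hm ->]]]]; rewrite E3 //; apply/ball_open/DX.
- move=> p l /in_prodP [q [m [qD [Hm ->]]]] lX; have qX := DX q qD.
  have w0 := wR_gt0 (hR := hR) Hm.
  exists (ball l (wR m / 2)); split; first exact: ball_open.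
  split; first by apply/in_ball; rewrite dist_xx //; split=> //; lra.
  case: (lerP (dist q l) (3 / 2 * wR m)) => L; [right|left] => z /in_ball [zX Lz].
    by move=> /E2 [] // _; have := dist_tri qX lX zX; lra.
  by rewrite E1 // => /in_ball [_]; have := dist_tri qX zX lX; rewrite (dist_sym zX lX); lra.
- move=> V y /openE [VX HV] yV; have [e [e0 K]] := HV y yV; have yX := VX y yV.
  have [|m [Hm L]] := wR_small (hR := hR) (u := e / 4); first by lra.
  have w0 := wR_gt0 (hR := hR) Hm.
  have [q [qD [qX Lq]]] := dense_near yX w0 DX Dd.
  exists (pr q m); split; first by apply/pr_in_prod.
  rewrite E1 // E3 //; split; first by apply/in_ball.
  move=> z /in_ball [zX Lz]; apply: K => //.
  by have := dist_tri yX qX zX; rewrite (dist_sym yX qX); lra.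
- move=> p y /in_prodP [q [m [qD [Hm ->]]]] yX; rewrite E3 //.
  have w0 := wR_gt0 (hR := hR) Hm.
  case: (lerP (dist q y) (2 * wR m)) => L; [right|left]; last exact/E2.
  by apply/in_ball; split=> //; lra.
Qed.
End Metric.

Section SepMetrizable.
Context {M : structure} {hZF : ZF M} {R : field_data M} {hR : complete_ordered_field R}.
Variable X : space M.
Hypothesis HX : sep_metrizable R X.

Lemma sep_topological : topological X.
Proof. by have [[d [Hd H]] _] := HX; exact: (metric_topological Hd H). Qed.

Lemma sep_basis : exists B S, basis X B S.
Proof. by have [[d [Hd H]] HS] := HX; exact: (metric_basis Hd H HS). Qed.

Lemma sep_apart_family : exists P w1 w2 w3, apart_family X P w1 w2 w3.
Proof. by have [[d [Hd H]] HS] := HX; exact: (metric_apart_family Hd H HS). Qed.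
End SepMetrizable.

(** * Compactness and Baire category *)

Ltac dfn_reg3 ::= first
  [ simple apply tdef_pfst | simple apply tdef_psnd | simple apply tdef_dom
  | simple apply tdef_seqs | simple apply tdef_restr | simple apply tdef_np
  | simple apply dfn_isseq
  | progress unfold subset, empty, nonempty, is_succ, inductive, is_pair, app,
      is_map, is_nat, injects, finite, countable, op, in_prod, adherent, disjoint,
      ran, move_I, decreasing, partial_play_I, partial_play_II, init_seg,
      converges_opens, converges_pts ].

Section Compact.
Context {M : structure} {hZF : ZF M}.
Variable X : space M.
Hypothesis HX : topological X.
Implicit Types (U V B C x y z n m b p : M).

Lemma adherent_in B z : B ⊆ pts X -> z ∈ B -> adherent X B z.
Proof. by move=> HB zB; split; [exact: HB|move=> V _ zV; exists z]. Qed.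

Lemma coadherent_open B : sep (pts X) (fun z => ~ adherent X B z) ∈ opens X.
Proof.
have D : dfn (fun e => ~ adherent X B (e 0)) by df.
apply: (open_local HX) => [z /(in_sep _ D) [] //|x /(in_sep _ D) [xX nx]].
have [V [Vo [xV HV]]] : exists V, V ∈ opens X /\ x ∈ V /\ forall w, w ∈ V -> ~ w ∈ B.
  apply: NNPP => H; apply: nx; split=> // V Vo xV; apply: NNPP => K; apply: H.
  by exists V; do 2!split=> //; move=> w wV wB; apply: K; exists w.
exists V; do 2!split=> //; move=> z zV; apply/in_sep => //.
split; first exact: (open_sub HX Vo).
by move=> [_ H]; have [w [wV wB]] := H V Vo zV; apply: (HV w).
Qed.

(** A sequence of sets meeting the compact set [K], each adherent to its predecessor,
    has a common point in [K]. *)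
Lemma compact_nested K (u : M -> M) : compact X K -> K ⊆ pts X -> tdef (fun e => u (e 0)) ->
  (forall n, n ∈ om -> exists x, x ∈ K /\ x ∈ u n) ->
  (forall n, n ∈ om -> u n ⊆ pts X) ->
  (forall n z, n ∈ om -> adherent X (u (succ n)) z -> z ∈ u n) ->
  exists x, x ∈ K /\ forall n, n ∈ om -> x ∈ u n.
Proof.
move=> HK KX Du meet uX nest.
have dec n m : n ∈ om -> m ∈ om -> n ⊆ m -> u m ⊆ u n.
  move=> Hn Hm; apply: (om_ind_from (P := fun m => u m ⊆ u n) _ Hn) => //; first by df.
  move=> i Hi _ IH z zu; apply/IH/nest => //.
  by apply: adherent_in => //; apply: uX; exact: om_succ.
pose (co := fun n => sep (pts X) (fun z => ~ adherent X (u n) z)).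
have Dco : tdef (fun e => co (e 0)) by rewrite /co; df.
have inco n z : z ∈ co n <-> z ∈ pts X /\ ~ adherent X (u n) z by apply: in_sep; df.
apply: NNPP => H.
have [||G [GF [Gfin Gcov]]] := HK (img om co).
- by move=> _ /(in_img _ Dco) [n [_ ->]]; exact: coadherent_open.
- move=> x xK.
  have [n [Hn nx]] : exists n, n ∈ om /\ ~ x ∈ u n.
    apply: NNPP => L; apply: H; exists x; split=> // n Hn; apply: NNPP => nx.
    by apply: L; exists n.
  exists (co (succ n)); split; first by apply/in_img => //; exists (succ n); split=> //; exact: om_succ.
  by apply/inco; split; [exact: KX|move/(nest _ _ Hn)].
have [|||N [HN cov]] := @finite_bound _ _ G (fun n C => C ⊆ co n) Gfin; first by df.
- move=> n m C Hn Hm nm HC z /HC /inco [zX nz]; apply/inco; split=> // -[_ L]; apply: nz.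
  by split=> // V Vo zV; have [w [wV /(dec _ _ Hn Hm nm) wu]] := L V Vo zV; exists w.
- by move=> C /GF /(in_img _ Dco) [n [Hn ->]]; exists n; split=> // z.
have [x [xK xu]] := meet N HN; have [C [CG xC]] := Gcov x xK.
by have /inco [_] := cov C CG x xC; apply; apply: adherent_in => //; exact: uX.
Qed.

Variables (BX SX : M).
Hypothesis HB : basis X BX SX.

(** Baire category on a compact set covered by countably many pieces: one piece is dense
    in a nonempty relatively open part. *)
Lemma baire K P (Q : M -> M -> Prop) : compact X K -> K ⊆ pts X -> nonempty M K ->
  countable M P -> dfn (fun e => Q (e 1) (e 0)) ->
  (forall x, x ∈ K -> exists p, p ∈ P /\ Q p x) ->
  exists p O, p ∈ P /\ O ∈ opens X /\ (exists x, x ∈ K /\ x ∈ O) /\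
    forall U, U ∈ opens X -> U ⊆ O -> (exists x, x ∈ K /\ x ∈ U) ->
      exists x, x ∈ K /\ x ∈ U /\ Q p x.
Proof.
move=> HK KX [x0 x0K] /countableP [h [Hh hI]] DQ cov; apply: NNPP => no.
have avoid p O : p ∈ P -> O ∈ opens X -> (exists x, x ∈ K /\ x ∈ O) ->
    exists U, U ∈ opens X /\ U ⊆ O /\ (exists x, x ∈ K /\ x ∈ U) /\
      forall x, x ∈ K -> x ∈ U -> ~ Q p x.
  move=> pP Oo KO; apply: NNPP => L; apply: no; exists p, O; do 3!split=> //.
  move=> U Uo UO KU; apply: NNPP => L'; apply: L; exists U; do 3!split=> //.
  by move=> x xK xU Qx; apply: L'; exists x.
have [g Hg] := (countableP BX).1 (basis_countable HB).
(* The next basic open set avoids the piece with code [n], if there is one. *)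
pose (good := fun n b b' => (exists x, x ∈ K /\ x ∈ b') /\
  (forall z, adherent X b' z -> z ∈ b) /\
  forall p, p ∈ P -> ap h p = n -> forall x, x ∈ K -> x ∈ b' -> ~ Q p x).
have step n b : b ∈ BX -> (exists x, x ∈ K /\ x ∈ b) -> n ∈ om ->
    pick g BX (good n b) ∈ BX /\ good n b (pick g BX (good n b)).
  move=> bB Kb Hn; apply: pickP => //; first by rewrite /good; df.
  have bo := basis_open HB bB.
  have [U [Uo [Ub [[x [xK xU]] HU]]]] : exists U, U ∈ opens X /\ U ⊆ b /\
      (exists x, x ∈ K /\ x ∈ U) /\
      forall p, p ∈ P -> ap h p = n -> forall x, x ∈ K -> x ∈ U -> ~ Q p x.
    case: (excluded_middle_informative (exists p, p ∈ P /\ ap h p = n)) => [[p [pP Ep]]|np].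
      have [U [Uo [Ub [KU HU]]]] := avoid p b pP bo Kb; exists U; do 3!split=> //.
      by move=> p' p'P Ep'; have -> : p' = p by apply: hI => //; rewrite Ep.
    by exists b; do 3!split=> //; move=> p pP Ep; case: np; exists p.
  have [b' [b'B [_ [xb' [b'U ad]]]]] := basis_at HB Uo xU om_emp.
  exists b'; split=> //; split; first by exists x.
  by split=> [z /ad /Ub //|p pP Ep y yK /b'U]; apply: HU.
have [b0 [b0B [_ [xb0 _]]]] := basis_at HB (open_all HX) (KX _ x0K) om_emp.
pose (u := fun n => rec b0 (fun n b => pick g BX (good n b)) n).
have Du : tdef (fun e => u (e 0)) by rewrite /u /good; df.
have u0 : u emp = b0 by rewrite /u rec0 // /good; df.
have uS n : n ∈ om -> u (succ n) = pick g BX (good n (u n)).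
  by move=> Hn; rewrite /u recS // /good; df.
have inv : forall n, n ∈ om -> u n ∈ BX /\ exists x, x ∈ K /\ x ∈ u n.
  apply: om_ind; [by df|by rewrite u0; split=> //; exists x0|].
  by move=> n Hn [uB Ku]; rewrite uS //; have [? [? _]] := step n (u n) uB Ku Hn.
have ug n : n ∈ om -> good n (u n) (u (succ n)).
  by move=> Hn; have [uB Ku] := inv n Hn; rewrite uS //; have [] := step n (u n) uB Ku Hn.
have [||n z Hn|x [xK xu]] := compact_nested HK KX Du.
- by move=> n /inv [].
- by move=> n /inv [uB _]; apply: (open_sub HX); exact: (basis_open HB).
- by move=> Hz; have [_ [H _]] := ug n Hn; exact: H.
have [p [pP Qp]] := cov x xK; have Hn := Hh p pP.
have [_ [_ H]] := ug _ Hn; apply: (H p pP erefl x xK) => //.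
by apply: xu; exact: om_succ.
Qed.

End Compact.

Section Sequences.
Context {M : structure} {hZF : ZF M}.
Implicit Types (U V B C x y z n m i s t : M).

Lemma seq_om s (A : M -> Prop) : is_map M s (is_nat M) A <-> is_map M s (fun n => n ∈ om) A.
Proof.
by split=> H; apply: (map_mono H) => // x; [exact: (iff_sym (in_om x))|exact: in_om].
Qed.

Lemma isseq_eq s t n (A B : M -> Prop) : isseq s n A -> isseq t n B ->
  (forall i, i ∈ n -> ap s i = ap t i) -> s = t.
Proof. by move=> Hs Ht; apply: (map_ext Hs Ht). Qed.

(** Initial segments of an infinite sequence are its restrictions. *)
Lemma init_segP s n y (A : M -> Prop) : n ∈ om -> is_map M y (fun n => n ∈ om) A ->
  init_seg M s n y <-> s = restr y n.
Proof.
move=> Hn Hy; have sub i : i ∈ n -> i ∈ om by exact: om_in.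
split=> [[sy Hs]|->]; last by split; [exact: restr_sub|exact: (map_mono (restr_isseq Hy sub))].
apply: (isseq_eq Hs (restr_isseq (B := A) Hy sub)) => i ni.
rewrite (ap_restr Hy sub) //; apply/esym/(map_ap Hy)/sy; exact: (map_pr Hs).
Qed.

Lemma dec_le s n m k : k ∈ om -> n ∈ om -> m ∈ k -> n ⊆ m ->
  (forall i, succ i ∈ k -> ap s (succ i) ⊆ ap s i) -> ap s m ⊆ ap s n.
Proof.
move=> Hk Hn mk nm H; have Hm := om_in Hk mk.
apply: (om_ind_from (P := fun m => m ∈ k -> ap s m ⊆ ap s n) _ Hn _ _ Hm nm mk).
- by df.
- by move=> _ z.
move=> i Hi _ IH ik z /(H _ ik); apply: IH.
by apply: (om_trans Hk ik); exact: succ_self.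
Qed.

Lemma dec_om s n m : n ∈ om -> m ∈ om -> n ⊆ m ->
  (forall i, i ∈ om -> ap s (succ i) ⊆ ap s i) -> ap s m ⊆ ap s n.
Proof.
move=> Hn Hm nm H; apply: (dec_le (k := succ m)) => //; try exact: om_succ.
  exact: succ_self.
by move=> i si; apply: H; apply: (om_in (om_succ Hm)); apply: (om_trans (om_succ Hm) si (succ_self i)).
Qed.

Lemma decreasingP s k (A : M -> Prop) : is_map M s (fun i => i ∈ k) A ->
  (forall i j, j ∈ k -> i ∈ j -> i ∈ k) ->
  decreasing M s <-> forall i, succ i ∈ k -> ap s (succ i) ⊆ ap s i.
Proof.
move=> Hs tr; split=> [H i ik|H i j a b /is_succP -> /(map_app _ _ Hs) [_ ->]].
- apply: (H i (succ i)); first exact/is_succP.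
  + by apply/appP/(map_pr Hs); apply: tr ik (succ_self i).
  + exact/appP/(map_pr Hs).
- by move=> /(map_app _ _ Hs) [ik ->]; exact: H.
Qed.

Lemma decreasing_omP s (A : M -> Prop) : is_map M s (fun i => i ∈ om) A ->
  decreasing M s <-> forall i, i ∈ om -> ap s (succ i) ⊆ ap s i.
Proof.
move=> Hs; rewrite (decreasingP Hs); last by move=> i j Hj; exact: om_in.
split=> H i Hi; apply: H; first exact: om_succ.
exact: om_in Hi (succ_self i).
Qed.

Lemma decreasing_natP s n (A : M -> Prop) : n ∈ om -> isseq s n A ->
  decreasing M s <-> forall i, succ i ∈ n -> ap s (succ i) ⊆ ap s i.
Proof. by move=> Hn Hs; apply: (decreasingP Hs) => i j; exact: om_trans. Qed.
End Sequences.

(** * A winning strategy for Player I *)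

Section PointChoice.
Context {M : structure} {hZF : ZF M} {R : field_data M} {hR : complete_ordered_field R}.
Hypothesis hAC : AC_omega_R R.
Variables (X : space M) (BX SX : M).
Hypotheses (HX : topological X) (HB : basis X BX SX).
Implicit Types (U V B C x y z n m i p s t : M).

(** A point is determined by the basic open sets that contain it. *)
Lemma point_code x y : x ∈ pts X -> y ∈ pts X ->
  sep BX (fun b => x ∈ b) = sep BX (fun b => y ∈ b) -> x = y.
Proof.
move=> xX yX E; have D z : dfn (fun e : nat -> M => z ∈ e 0) by df.
apply: (open_T1 HX) => // V Vo xV; have [b [bB [_ [xb [bV _]]]]] := basis_at HB Vo xV om_emp.
have /(in_sep _ (D y)) [_ yb] : b ∈ sep BX (fun b => y ∈ b) by rewrite -E; apply/in_sep.
exact: bV.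
Qed.

Lemma point_choice I (S : M -> M) : countable M I -> tdef (fun e => S (e 0)) ->
  (forall i, i ∈ I -> S i ⊆ pts X) -> (forall i, i ∈ I -> nonempty M (S i)) ->
  exists c, forall i, i ∈ I -> ap c i ∈ S i.
Proof.
move=> HI DS SX' SN.
apply: (countable_choice hAC (j := fun x => sep BX (fun b => x ∈ b)) HI (basis_countable HB) DS _ _ _ SN).
- by df.
- by move=> i x _ _ b /(in_sep _ _) [] //; df.
- by move=> i x y iI xS yS; apply: point_code; apply: (SX' i).
Qed.
End PointChoice.

Section Plays.
Context {M : structure} {hZF : ZF M}.
Variables (X Y : space M) (f : M).
Hypotheses (HX : topological X) (Hf : function X Y f).
Implicit Types (U V B C x y z n m i p s t : M).

Lemma ranP y : ran M f y <-> exists x, x ∈ pts X /\ y = ap f x.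
Proof.
split=> [[x /(map_app _ _ Hf) [xX ->]]|[x [xX ->]]]; exists x => //.
exact/(map_app _ _ Hf).
Qed.

Lemma ran_sub y : ran M f y -> y ∈ pts Y.
Proof. by move=> /ranP [x [xX ->]]; exact: (map_val Hf xX). Qed.

(** The sets of finite plays of the two players. *)
Definition playsII : M :=
  sep (pow (prod om (pts Y))) (fun s => exists n, n ∈ om /\ isseq s n (ran M f)).

Lemma in_playsII s : s ∈ playsII <-> exists n, n ∈ om /\ isseq s n (ran M f).
Proof.
rewrite in_sep; last by df.
split=> [[_ //]|[n [Hn Hs]]]; split; last by exists n.
apply/in_pow => p /(map_in Hs) [i [ni ->]]; apply/pr_in_prod.
by split; [exact: om_in ni|apply/ran_sub/(map_val Hs ni)].
Qed.

Lemma playsIIP s : partial_play_II M f s <-> s ∈ playsII.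
Proof. by rewrite in_playsII; split=> -[n [Hn Hs]]; exists n; split=> //; apply/in_om. Qed.

Definition playsI : M :=
  sep (pow (prod om (opens X))) (fun s => exists n, n ∈ om /\ n <> emp /\
    isseq s n (move_I X) /\ decreasing M s).

Lemma in_playsI s : s ∈ playsI <-> exists n, n ∈ om /\ n <> emp /\
    isseq s n (move_I X) /\ decreasing M s.
Proof.
rewrite in_sep; last by df.
split=> [[_ //]|[n [Hn [n0 [Hs Hd]]]]]; split; last by exists n.
apply/in_pow => p /(map_in Hs) [i [ni ->]]; apply/pr_in_prod.
by split; [exact: om_in ni|have [] := map_val Hs ni].
Qed.

Lemma playsIP s : partial_play_I X s <-> s ∈ playsI.
Proof.
rewrite in_playsI; split=> -[n [Hn [n0 [Hs Hd]]]]; exists n; split; try exact/in_om.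
  by split=> //; apply/nonemptyP.
by split=> //; apply/nonemptyP.
Qed.
End Plays.

Section StrategyI.
Context {M : structure} {hZF : ZF M} {R : field_data M} {hR : complete_ordered_field R}.
Hypothesis hAC : AC_omega_R R.
Variables (X Y : space M) (f BX SX P w1 w2 w3 : M).
Hypotheses (HX : topological X) (HB : basis X BX SX) (HY : topological Y).
Hypotheses (HP : apart_family Y P w1 w2 w3) (Hf : function X Y f).
Implicit Types (U V B C O x y z n m i p s t k : M).

Lemma f_pts x : x ∈ pts X -> ap f x ∈ pts Y.
Proof. exact: (map_val Hf). Qed.

(** A compact set without continuity points contains a relatively open part in which two
    sets with separated images are both dense. *)
Lemma oscillation K : compact X K -> K ⊆ pts X -> nonempty M K ->
  ~ (exists x, continuity_point X Y f K x) ->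
  exists p O, p ∈ P /\ O ∈ opens X /\ (exists x, x ∈ K /\ x ∈ O) /\
    forall U, U ∈ opens X -> U ⊆ O -> (exists x, x ∈ K /\ x ∈ U) ->
      (exists x, x ∈ K /\ x ∈ U /\ ap f x ∈ ap w1 p) /\
      (exists x, x ∈ K /\ x ∈ U /\ ap f x ∈ ap w2 p).
Proof.
move=> HK KX K0 nc.
pose (Q := fun p x => ap f x ∈ ap w1 p /\ forall U, U ∈ opens X -> x ∈ U ->
  exists x', x' ∈ K /\ x' ∈ U /\ ap f x' ∈ ap w2 p).
have [|x xK|p [O [pP [Oo [KO HO]]]]] := baire HX HB (Q := Q) HK KX K0 (apart_countable HP).
- by rewrite /Q; df.
- apply: NNPP => no; apply: nc; exists x; split=> // y V /(map_app _ _ Hf) [xX ->] Vo yV.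
  apply: NNPP => nU; apply: no; have [p [pP [yw1 w3V]]] := apart_at HP Vo yV.
  exists p; split=> //; split=> // U Uo xU; apply: NNPP => nx; apply: nU; exists U.
  split=> //; split=> // x' y' x'U x'K /(map_app _ _ Hf) [x'X ->].
  case: (apart_cover HP pP (f_pts x'X)) => [H|/w3V //].
  by case: nx; exists x'.
exists p, O; split=> //; split=> //; split=> // U Uo UO KU.
have [x [xK [xU [fx Hx]]]] := HO U Uo UO KU; split; first by exists x.
by have [x' [x'K [x'U fx']]] := Hx U Uo xU; exists x'.
Qed.

Section Chase.
Variables (K O p : M).
Hypotheses (HK : compact X K) (KX : K ⊆ pts X) (pP : p ∈ P) (Oo : O ∈ opens X).
Hypothesis KO : exists x, x ∈ K /\ x ∈ O.
Hypothesis HO : forall U, U ∈ opens X -> U ⊆ O -> (exists x, x ∈ K /\ x ∈ U) ->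
  (exists x, x ∈ K /\ x ∈ U /\ ap f x ∈ ap w1 p) /\
  (exists x, x ∈ K /\ x ∈ U /\ ap f x ∈ ap w2 p).

Lemma apart_disj l : l ∈ pts Y -> l ∈ ap w1 p -> ~ l ∈ ap w2 p.
Proof.
move=> lY l1 l2; have [V [_ [lV [H|H]]]] := apart_sep HP pP lY; exact: (H l).
Qed.

(** Player I aims at a point of [K] whose image is in one of the two separated open sets,
    shrinking the open sets around it; each time that Player II answers in the same
    open set, Player I turns to a point whose image is in the other one. *)
Lemma chase_wins : exists tau, winning_I X Y f tau.
Proof.
have [g Hg] := (countableP BX).1 (basis_countable HB).
pose (J := sep BX (fun b => b ⊆ O /\ exists x, x ∈ K /\ x ∈ b)).
have inJ b : b ∈ J <-> b ∈ BX /\ b ⊆ O /\ exists x, x ∈ K /\ x ∈ b by apply: in_sep; df.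
have Jc : countable M J by apply: (countable_sub _ (basis_countable HB)) => b /inJ [].
have choose w : (w = ap w1 p \/ w = ap w2 p) ->
    exists c, forall b, b ∈ J -> ap c b ∈ K /\ ap c b ∈ b /\ ap f (ap c b) ∈ w.
  move=> Hw; pose (S := fun b => sep K (fun x => x ∈ b /\ ap f x ∈ w)).
  have DS : tdef (fun e => S (e 0)) by rewrite /S; df.
  have inS b x : x ∈ S b <-> x ∈ K /\ x ∈ b /\ ap f x ∈ w by apply: in_sep; df.
  have [||c Hc] := point_choice hAC HX HB Jc DS.
  - by move=> b _ x /inS [/KX].
  - move=> b /inJ [/(basis_open HB) bo [bO Kb]]; have [[x Hx] [y Hy]] := HO bo bO Kb.
    by case: Hw => E; [exists x|exists y]; apply/inS; rewrite E.
  - by exists c => b /Hc /inS.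
have [c1 Hc1] := choose (ap w1 p) (or_introl erefl).
have [c2 Hc2] := choose (ap w2 p) (or_intror erefl).
(* The next target, from the target [x], the last open set [U] and the answer [y]. *)
pose (turn := fun x U y => ite (ap f x ∈ ap w1 p /\ y ∈ ap w1 p) (ap c2 U)
  (ite (ap f x ∈ ap w2 p /\ y ∈ ap w2 p) (ap c1 U) x)).
(* The next open set contains the target, is well inside the last one, and is small. *)
pose (fits := fun k x U b => x ∈ b /\ (forall z, adherent X b z -> z ∈ U) /\ pr k b ∈ SX).
(* A state is the pair of the target and the last open set. *)
pose (step := fun k q y => pr (turn (pfst q) (psnd q) y)
  (pick g BX (fits k (turn (pfst q) (psnd q) y) (psnd q)))).
have [x0 [x0K x0O]] := KO.
have [U0 [U0B [_ [x0U0 [U0O _]]]]] := basis_at HB Oo x0O om_emp.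
have JU0 : U0 ∈ J by apply/inJ; do 2!split=> //; exists x0.
pose (st := fun s k => rec (pr (ap c1 U0) U0) (fun k q => step k q (ap s k)) k).
have Dst : tdef (fun e => st (e 1) (e 0)) by rewrite /st /step /turn /fits; df.
have st0 s : st s emp = pr (ap c1 U0) U0.
  by rewrite /st rec0 // /step /turn /fits; df.
have stS s k : k ∈ om -> st s (succ k) = step k (st s k) (ap s k).
  by move=> Hk; rewrite /st recS // /step /turn /fits; df.
pose (x_ := fun s k => pfst (st s k)); pose (U_ := fun s k => psnd (st s k)).
pose (inv := fun x U => x ∈ K /\ x ∈ U /\ U ∈ J /\ (ap f x ∈ ap w1 p \/ ap f x ∈ ap w2 p)).
have turn_inv x U y : inv x U -> inv (turn x U y) U.
  move=> [xK [xU [UJ fx]]]; rewrite /turn /inv.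
  case: (excluded_middle_informative (ap f x ∈ ap w1 p /\ y ∈ ap w1 p)) => H.
    by rewrite ite_true //; have [? [? ?]] := Hc2 U UJ; auto.
  rewrite ite_false //.
  case: (excluded_middle_informative (ap f x ∈ ap w2 p /\ y ∈ ap w2 p)) => H'.
    by rewrite ite_true //; have [? [? ?]] := Hc1 U UJ; auto.
  by rewrite ite_false.
have st_inv s : forall k, k ∈ om -> inv (x_ s k) (U_ s k) /\
    fits k (x_ s (succ k)) (U_ s k) (U_ s (succ k)).
  have pickU x U k : inv x U -> k ∈ om ->
      pick g BX (fits k x U) ∈ BX /\ fits k x U (pick g BX (fits k x U)).
    move=> [xK [xU [/inJ [UB _] _]]] Hk; apply: pickP => //; first by rewrite /fits; df.
    have [b [bB [bS [xb [_ ad]]]]] := basis_at HB (basis_open HB UB) xU Hk.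
    by exists b.
  have one k : k ∈ om -> inv (x_ s k) (U_ s k) ->
      fits k (x_ s (succ k)) (U_ s k) (U_ s (succ k)) /\ inv (x_ s (succ k)) (U_ s (succ k)).
    move=> Hk I; rewrite /x_ /U_ stS // /step pfst_pr psnd_pr -/(x_ s k) -/(U_ s k).
    have I' : inv (turn (x_ s k) (U_ s k) (ap s k)) (U_ s k) by exact: turn_inv.
    have [bB Hb] := pickU _ _ _ I' Hk; split=> //.
    move: I' => [xK [xU [/inJ [UB [UO _]] fx]]]; have [xb [ad _]] := Hb.
    split=> //; split=> //; split=> //; apply/inJ; split=> //; split; last by exists (turn (x_ s k) (U_ s k) (ap s k)).
    move=> z zb; apply/UO/ad/adherent_in => //.
    by apply: (open_sub HX); exact: (basis_open HB bB).
  have all : forall k, k ∈ om -> inv (x_ s k) (U_ s k).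
    apply: om_ind; first by rewrite /inv /x_ /U_; df.
      rewrite /x_ /U_ st0 pfst_pr psnd_pr /inv.
      by have [? [? ?]] := Hc1 U0 JU0; auto.
    by move=> k Hk /(one k Hk) [].
  by move=> k Hk; split; [exact: all|exact: (one k Hk (all k Hk)).1].
have U_move s k : k ∈ om -> move_I X (U_ s k).
  move=> /(st_inv s) [[xK [xU [/inJ [UB _] _]]] _].
  by split; [exact: (basis_open HB)|exists (x_ s k)].
have U_dec s k : k ∈ om -> U_ s (succ k) ⊆ U_ s k.
  move=> Hk; have [_ [_ [ad _]]] := st_inv s k Hk; move=> z zU; apply/ad/adherent_in => //.
  have [/(open_sub HX) H _] := U_move s _ (om_succ Hk); exact: H.
(* The state after [n] rounds depends only on the first [n] answers. *)
have local s t n : n ∈ om -> (forall i, i ∈ n -> ap s i = ap t i) -> st s n = st t n.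
  move=> Hn E.
  have H : forall k, k ∈ om -> k ⊆ n -> st s k = st t k; last by apply: H.
  apply: om_ind; [by df|by rewrite !st0|move=> k Hk IH kn].
  have kn' := (succ_sub Hk Hn).1 kn.
  by rewrite !stS // E // IH //; apply/om_sub; auto.
have U_mono s n m : n ∈ om -> m ∈ om -> n ⊆ m -> U_ s m ⊆ U_ s n.
  move=> Hn Hm nm; have D : tdef (fun e => U_ s (e 0)) by rewrite /U_; df.
  have E k : k ∈ om -> ap (lam om (U_ s)) k = U_ s k by exact: ap_lam.
  rewrite -!E //; apply: dec_om => // i Hi; rewrite !E //; [exact: U_dec|exact: om_succ].
exists (lam (playsII Y f) (fun s => U_ s (dom s))).
have Dtau : tdef (fun e => U_ (e 0) (dom (e 0))) by rewrite /U_; df.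
have apt s n : n ∈ om -> isseq s n (ran M f) ->
    app M (lam (playsII Y f) (fun s => U_ s (dom s))) s (U_ s n).
  move=> Hn Hs; apply/appP/in_lam => //; exists s; split; last by rewrite (dom_eq Hn Hs).
  by apply/(in_playsII Hf); exists n.
have tau_map : is_map M (lam (playsII Y f) (fun s => U_ s (dom s)))
    (partial_play_II M f) (move_I X).
  apply: lam_map => // [s|s /(in_playsII Hf) [n [Hn Hs]]]; first exact: (iff_sym (playsIIP Hf s)).
  by rewrite (dom_eq Hn Hs); exact: U_move.
split; first split=> //.
  move=> t t' A A' tt' /(map_app _ _ tau_map) [/(playsIIP Hf) Ht ->].
  move=> /(map_app _ _ tau_map) [/(playsIIP Hf) Ht' ->]; rewrite !ap_lam //.
  have [n [Hn St]] := (in_playsII Hf t).1 Ht; have [m [Hm St']] := (in_playsII Hf t').1 Ht'.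
  rewrite (dom_eq Hn St) (dom_eq Hm St').
  have nm : n ⊆ m by move=> i ni; have [] := map_dom St' (tt' _ (map_pr St ni)).
  have -> : U_ t n = U_ t' n.
    rewrite /U_; congr psnd; apply: local => // i ni.
    by rewrite (map_ap St' (tt' _ (map_pr St ni))).
  exact: U_mono.
move=> U y [/seq_om HU _] /seq_om Hy fol.
have EU n : n ∈ om -> ap U n = U_ y n.
  move=> Hn; have [|s [/(init_segP _ Hn Hy) -> H]] := fol n (ap U n).
    by apply/appP/(map_pr HU).
  have sub i : i ∈ n -> i ∈ om by exact: om_in.
  have Hr : isseq (restr y n) n (ran M f) by exact: (restr_isseq Hy sub).
  have /(map_app _ _ tau_map) [_ ->] := H.
  have /(map_app _ _ tau_map) [_ <-] := apt _ _ Hn Hr.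
  rewrite /U_; congr psnd; apply: local => // i ni.
  exact: (ap_restr Hy sub).
have DU : tdef (fun e => U_ y (e 0)) by rewrite /U_; df.
have [|||x [xK xU]] := compact_nested HX HK KX DU.
- by move=> n /(st_inv y) [[xK [xU _]] _]; exists (x_ y n).
- by move=> n /(U_move y) [/(open_sub HX)].
- by move=> n z Hn; have [_ [_ [ad _]]] := st_inv y n Hn; exact: ad.
have xX : x ∈ pts X by exact: KX.
have small V : V ∈ opens X -> x ∈ V -> exists n, n ∈ om /\ U_ y n ⊆ V.
  move=> Vo xV; have [n [Hn H]] := basis_small HB Vo xV.
  exists (succ n); split; first exact: om_succ.
  have [_ [_ [_ sm]]] := st_inv y n Hn.
  by apply: (H n) => //; apply: xU; exact: om_succ.
have conv : converges_opens X U x.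
  split=> //; split; first by apply/(decreasing_omP HU) => i Hi; rewrite !EU //; [exact: U_dec|exact: om_succ].
  split=> [n A /(map_app _ _ HU) [Hn ->]|V Vo xV]; first by rewrite EU //; exact: xU.
  have [n [Hn H]] := small V Vo xV; exists n, (U_ y n); split=> //.
  by rewrite -EU //; apply/appP/(map_pr HU).
case=> [[]|[x' [fx [[x'X [_ [x'U cx']]] [/(map_app _ _ Hf) [_ ->] [_ cy]]]]]]; first by exists x.
have {x' x'X x'U cx' cy} [l ycv] : exists l, l = ap f x /\ forall V, V ∈ opens Y -> l ∈ V ->
    exists N, N ∈ om /\ forall n, n ∈ om -> N ⊆ n -> ap y n ∈ V.
  have -> : x = x'.
    apply: esym; apply: (open_T1 HX) => // V Vo x'V; have [n [A [/(map_app _ _ HU) [Hn ->] AV]]] := cx' V Vo x'V.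
    by apply: AV; rewrite EU //; exact: xU.
  exists (ap f x'); split=> // V Vo lV; have [N [/in_om HN H]] := cy V Vo lV.
  exists N; split=> // n Hn Nn; apply: (H n) => //; exact/appP/(map_pr Hy).
move: ycv => [-> ycv].
have fxY k : k ∈ om -> ap f (x_ y k) ∈ pts Y.
  by move=> /(st_inv y) [[/KX xkX _] _]; exact: f_pts.
have x_S k : k ∈ om -> x_ y (succ k) = turn (x_ y k) (U_ y k) (ap y k).
  by move=> Hk; rewrite /x_ stS // /step pfst_pr.
have [V [Vo [lV sepV]]] := apart_sep HP pP (f_pts xX).
(* [wa] is avoided by the answers from some round on; the other set is [wb]. *)
have endgame wa wb : disjoint V wa -> wb ∈ opens Y ->
    (forall k, k ∈ om -> ap f (x_ y k) ∈ wa \/ ap f (x_ y k) ∈ wb) ->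
    (forall k, k ∈ om -> ap f (x_ y k) ∈ wa -> ~ ap y k ∈ wa -> x_ y (succ k) = x_ y k) ->
    (forall k, k ∈ om -> ap f (x_ y k) ∈ wb -> ~ ap y k ∈ wb -> x_ y (succ k) = x_ y k) ->
    (forall k, k ∈ om -> ap f (x_ y k) ∈ wb -> ap y k ∈ wb -> ap f (x_ y (succ k)) ∈ wa) ->
    False.
  move=> dV wbo ab sa sb ba; have [N [HN VN]] := ycv V Vo lV.
  have Dx : tdef (fun e => x_ y (e 0)) by rewrite /x_; df.
  have stay n : n ∈ om ->
      (forall m, m ∈ om -> n ⊆ m -> x_ y m = x_ y n -> x_ y (succ m) = x_ y m) ->
      x = x_ y n /\ forall m, m ∈ om -> n ⊆ m -> x_ y m = x_ y n.
    move=> Hn H.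
    have Hc : forall m, m ∈ om -> n ⊆ m -> x_ y m = x_ y n.
      apply: om_ind_from => //; first by df.
      by move=> m Hm nm IH; rewrite (H m).
    split=> //; have [[xnK [_ _]] _] := st_inv y n Hn.
    apply: (open_T1 HX) => //; first exact: KX.
    move=> W Wo xW; have [k [Hk kW]] := small W Wo xW.
    have [m [Hm [nm km]]] := om_max Hn Hk.
    apply: kW; rewrite -(Hc m) //; apply: (U_mono y k m Hk Hm km).
    by have [[_ [? _]] _] := st_inv y m Hm.
  have noa n : n ∈ om -> N ⊆ n -> ~ ap f (x_ y n) ∈ wa.
    move=> Hn Nn fa; have [|Ex _] := stay n Hn.
      move=> m Hm nm E; apply: sa => //; first by rewrite E.
      by apply: dV; apply: VN => // z /Nn /nm.
    by apply: (dV _ lV); rewrite Ex.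
  have [|Ex _] := stay N HN.
    move=> m Hm Nm _; have fb : ap f (x_ y m) ∈ wb by case: (ab m Hm) => // /(noa m Hm Nm).
    apply: sb => // yb; apply: (noa (succ m)); [exact: om_succ| |exact: ba].
    by move=> z /Nm zm; apply/in_succ; left.
  have fb : ap f x ∈ wb by rewrite Ex; case: (ab N HN) => // /noa []; auto.
  have [N' [HN' H]] := ycv wb wbo fb; have [m [Hm [Nm N'm]]] := om_max HN HN'.
  apply: (noa (succ m)); [exact: om_succ|by move=> z /Nm zm; apply/in_succ; left|].
  apply: ba => //; last exact: H.
  by case: (ab m Hm) => // /(noa m Hm Nm).
have ab k : k ∈ om -> ap f (x_ y k) ∈ ap w1 p \/ ap f (x_ y k) ∈ ap w2 p.
  by move=> /(st_inv y) [[_ [_ [_ H]]] _].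
have UJ k : k ∈ om -> U_ y k ∈ J by move=> /(st_inv y) [[_ [_ [H _]]] _].
have s1 k : k ∈ om -> ap f (x_ y k) ∈ ap w1 p -> ~ ap y k ∈ ap w1 p -> x_ y (succ k) = x_ y k.
  move=> Hk H1 H2; rewrite x_S // /turn ite_false; last by case.
  by rewrite ite_false // => -[K1 _]; exact: (apart_disj (fxY k Hk) H1 K1).
have s2 k : k ∈ om -> ap f (x_ y k) ∈ ap w2 p -> ~ ap y k ∈ ap w2 p -> x_ y (succ k) = x_ y k.
  move=> Hk H1 H2; rewrite x_S // /turn ite_false; last by case=> K1 _; exact: (apart_disj (fxY k Hk) K1 H1).
  by rewrite ite_false // => -[].
have b1 k : k ∈ om -> ap f (x_ y k) ∈ ap w1 p -> ap y k ∈ ap w1 p ->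
    ap f (x_ y (succ k)) ∈ ap w2 p.
  by move=> Hk H1 H2; rewrite x_S // /turn ite_true //; have [_ []] := Hc2 _ (UJ k Hk).
have b2 k : k ∈ om -> ap f (x_ y k) ∈ ap w2 p -> ap y k ∈ ap w2 p ->
    ap f (x_ y (succ k)) ∈ ap w1 p.
  move=> Hk H1 H2; rewrite x_S // /turn ite_false; last by case=> K1 _; exact: (apart_disj (fxY k Hk) K1 H1).
  by rewrite ite_true //; have [_ []] := Hc1 _ (UJ k Hk).
case: sepV => dV.
- by apply: (endgame (ap w1 p) (ap w2 p)) => //; exact: (apart_open2 HP).
- apply: (endgame (ap w2 p) (ap w1 p)) => //; first exact: (apart_open1 HP).
  by move=> k /ab []; auto.
Qed.
End Chase.

Theorem I_wins_of_compact K : compact X K -> K ⊆ pts X -> nonempty M K ->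
  ~ (exists x, continuity_point X Y f K x) -> exists tau, winning_I X Y f tau.
Proof.
move=> HK KX K0 nc; have [p [O [pP [Oo [KO HO]]]]] := oscillation HK KX K0 nc.
exact: (chase_wins HK KX pP Oo KO HO).
Qed.
End StrategyI.

(** * Functions of Baire class 1 *)

Section BaireOne.
Context {M : structure} {hZF : ZF M} {R : field_data M} {hR : complete_ordered_field R}.
Hypothesis hAC : AC_omega_R R.
Variables (X Y : space M) (f BX SX BY SY : M).
Hypotheses (HX : topological X) (HB : basis X BX SX).
Hypotheses (HY : topological Y) (HBY : basis Y BY SY) (Hf : function X Y f).
Implicit Types (U V B C E x y z n m i p q s t k : M).

(** A countable family of pairs of a closed set [C] and an open set [V] with [f(C) ⊆ V],
    fine enough to recover [f]. *)
Record closed_cover (I : M) : Prop := {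
  cover_countable : countable M I;
  cover_closed : forall q, q ∈ I -> is_closed X (pfst q);
  cover_open : forall q, q ∈ I -> psnd q ∈ opens Y;
  cover_map : forall q x, q ∈ I -> x ∈ pfst q -> ap f x ∈ psnd q;
  cover_at : forall x V, x ∈ pts X -> V ∈ opens Y -> ap f x ∈ V ->
    exists q, q ∈ I /\ x ∈ pfst q /\ psnd q ⊆ V
}.

Lemma closed_nbhd C x : is_closed X C -> x ∈ pts X -> ~ x ∈ C ->
  exists U, U ∈ opens X /\ x ∈ U /\ forall z, z ∈ U -> ~ z ∈ C.
Proof.
move=> [CX [U [Uo HU]]] xX nx; exists U; split=> //; split.
  by apply: NNPP => nU; apply: nx; apply/HU.
by move=> z zU zC; have zX := CX z zC; exact: (((HU z zX).1 zC) zU).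
Qed.

(** The [n]-th closed set of the sequence of closed sets coded by [E ⊆ om × BX]: the points
    outside all the basic open sets [b] with [(n, b) ∈ E]. *)
Definition coded E n : M := sep (pts X) (fun x => forall b, b ∈ BX -> pr n b ∈ E -> ~ x ∈ b).

Lemma in_coded E n x : x ∈ coded E n <->
  x ∈ pts X /\ forall b, b ∈ BX -> pr n b ∈ E -> ~ x ∈ b.
Proof. by apply: in_sep; df. Qed.

Lemma coded_closed E n : is_closed X (coded E n).
Proof.
split=> [x /in_coded [] //|].
pose (U := sep (pts X) (fun x => exists b, b ∈ BX /\ pr n b ∈ E /\ x ∈ b)).
have inU x : x ∈ U <-> x ∈ pts X /\ exists b, b ∈ BX /\ pr n b ∈ E /\ x ∈ b.
  by apply: in_sep; df.
exists U; split.
  apply: (open_local HX) => [x /inU [] //|x /inU [xX [b [bB [bE xb]]]]].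
  exists b; split; first exact: (basis_open HB).
  split=> // z zb; apply/inU; split; last by exists b.
  exact: (open_sub HX (basis_open HB bB)).
move=> x xX; rewrite in_coded inU; split=> [[_ H] [_ [b [bB [bE xb]]]]|H]; first exact: (H b).
by split=> // b bB bE xb; apply: H; split=> //; exists b.
Qed.

Lemma coded_exists V : Baire_class_1 X Y f -> V ∈ opens Y ->
  exists E, E ⊆ prod om BX /\ forall x, x ∈ pts X ->
    ap f x ∈ V <-> exists n, n ∈ om /\ x ∈ coded E n.
Proof.
move=> Hb /Hb [F [/countableP [g [Hg gI]] [Fc FV]]].
have FVE x : x ∈ pts X -> ap f x ∈ V <-> exists C, C ∈ F /\ x ∈ C.
  move=> xX; rewrite -FV; split=> [H|[y [/(map_app _ _ Hf) [_ ->]]] //].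
  by exists (ap f x); split=> //; apply/(map_app _ _ Hf).
pose (Q := fun e => forall C, C ∈ F -> ap g C = pfst e -> forall z, z ∈ C -> ~ z ∈ psnd e).
have DQ : dfn (fun e => Q (e 0)) by rewrite /Q; df.
exists (sep (prod om BX) Q); split=> [e /(in_sep _ DQ) [] //|x xX].
have inE n b : n ∈ om -> b ∈ BX -> pr n b ∈ sep (prod om BX) Q <->
    forall C, C ∈ F -> ap g C = n -> forall z, z ∈ C -> ~ z ∈ b.
  move=> Hn bB; rewrite in_sep // /Q pfst_pr psnd_pr pr_in_prod.
  by split=> [[]|].
rewrite FVE //; split=> [[C [CF xC]]|[n [Hn /in_coded [_ H]]]].
  exists (ap g C); split; first exact: Hg.
  apply/in_coded; split=> // b bB /(inE _ _ (Hg C CF) bB) H; exact: (H C).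
have [b0 [b0B [_ [xb0 _]]]] := basis_at HB (open_all HX) xX om_emp.
have [C [CF En]] : exists C, C ∈ F /\ ap g C = n.
  apply: NNPP => no; apply: (H b0) => //; apply/inE => // C CF En.
  by case: no; exists C.
exists C; split=> //; apply: NNPP => nx.
have [U [Uo [xU HU]]] := closed_nbhd (Fc C CF) xX nx.
have [b [bB [_ [xb [bU _]]]]] := basis_at HB Uo xU om_emp.
apply: (H b) => //; apply/inE => // C' C'F En' z zC' /bU zU; apply: (HU z zU).
by have <- : C' = C by apply: gI => //; rewrite En.
Qed.

Lemma Baire1_cover : Baire_class_1 X Y f -> exists I, closed_cover I.
Proof.
move=> Hb.
pose (S := fun V => sep (pow (prod om BX)) (fun E =>
  forall x, x ∈ pts X -> ap f x ∈ V <-> exists n, n ∈ om /\ x ∈ coded E n)).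
have DS : tdef (fun e => S (e 0)) by rewrite /S /coded; df.
have inS V E : E ∈ S V <-> E ⊆ prod om BX /\
    forall x, x ∈ pts X -> ap f x ∈ V <-> exists n, n ∈ om /\ x ∈ coded E n.
  by rewrite /S in_sep ?in_pow // /coded; df.
have [||||||c Hc] := countable_choice hAC (S := S) (j := id) (C := prod om BX) (basis_countable HBY).
- by apply: countable_prod; [exact: countable_om|exact: (basis_countable HB)].
- exact: DS.
- by df.
- by move=> V E _ /inS [].
- by [].
- by move=> V /(basis_open HBY) /(coded_exists Hb) [E HE]; exists E; apply/inS.
pose (F := fun q => pr (coded (ap c (pfst q)) (psnd q)) (pfst q)).
have DF : tdef (fun e => F (e 0)) by rewrite /F /coded; df.
have inI q : q ∈ img (prod BY om) F <->
    exists V n, V ∈ BY /\ n ∈ om /\ q = pr (coded (ap c V) n) V.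
  rewrite in_img //; split=> [[e [/in_prodP [V [n [VB [Hn ->]]]] ->]]|[V [n [VB [Hn ->]]]]].
    by exists V, n; rewrite /F pfst_pr psnd_pr.
  by exists (pr V n); rewrite /F pfst_pr psnd_pr pr_in_prod.
exists (img (prod BY om) F); split.
- apply: countable_img => //; apply: countable_prod; [exact: (basis_countable HBY)|exact: countable_om].
- by move=> q /inI [V [n [VB [Hn ->]]]]; rewrite pfst_pr; exact: coded_closed.
- by move=> q /inI [V [n [VB [Hn ->]]]]; rewrite psnd_pr; exact: (basis_open HBY).
- move=> q x /inI [V [n [VB [Hn ->]]]]; rewrite pfst_pr psnd_pr => xC.
  have /inS [_ H] := Hc V VB; apply/H; first by have /in_coded [] := xC.
  by exists n.
- move=> x V xX Vo fV; have [b [bB [_ [fb [bV _]]]]] := basis_at HBY Vo fV om_emp.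
  have /inS [_ H] := Hc b bB; have [n [Hn xC]] := (H x xX).1 fb.
  exists (pr (coded (ap c b) n) b); rewrite pfst_pr psnd_pr; split=> //.
  by apply/inI; exists b, n.
Qed.

Section Cover.
Variable I : M.
Hypothesis HI : closed_cover I.

Lemma cover_continuity K : compact X K -> K ⊆ pts X -> nonempty M K ->
  exists x, continuity_point X Y f K x.
Proof.
move=> HK KX' K0; apply: NNPP => nc.
pose (Q := fun q x => x ∈ pfst q /\ forall U, U ∈ opens X -> x ∈ U ->
  exists x', x' ∈ K /\ x' ∈ U /\ ~ x' ∈ pfst q).
have [|x xK|q [O [qI [Oo [KO HO]]]]] := baire HX HB (Q := Q) HK KX' K0 (cover_countable HI).
- by rewrite /Q; df.
- apply: NNPP => no; apply: nc; exists x; split=> // y V /(map_app _ _ Hf) [xX ->] Vo yV.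
  apply: NNPP => nU; apply: no; have [q [qI [xq qV]]] := cover_at HI xX Vo yV.
  exists q; split=> //; split=> // U Uo xU; apply: NNPP => nx; apply: nU; exists U.
  split=> //; split=> // x' y' x'U x'K /(map_app _ _ Hf) [x'X ->].
  apply: qV; apply: (cover_map HI qI); apply: NNPP => nq.
  by apply: nx; exists x'.
have [x [xK [xO [xq Hx]]]] := HO O Oo (fun z h => h) KO.
have [x' [x'K [x'O nq]]] := Hx O Oo xO.
have x'X : x' ∈ pts X by exact: KX'.
have [U [Uo [x'U HU]]] := closed_nbhd (cover_closed HI qI) x'X nq.
have [W [Wo [x'W [WO WU]]]] := open_cap HX Oo Uo x'O x'U.
have [|z [zK [zW [zq _]]]] := HO W Wo WO; first by exists x'.
by apply: (HU z) => //; exact: WU.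
Qed.

(** The range of [f] has a countable dense subset. *)
Lemma dense_range : exists D, countable M D /\ (forall y, y ∈ D -> ran M f y) /\
  forall V y, V ∈ opens Y -> ran M f y -> y ∈ V -> exists z, z ∈ D /\ z ∈ V.
Proof.
pose (J := sep BY (fun b => exists y, ran M f y /\ y ∈ b)).
have inJ b : b ∈ J <-> b ∈ BY /\ exists y, ran M f y /\ y ∈ b by apply: in_sep; df.
pose (S := fun b => sep b (ran M f)).
have DS : tdef (fun e => S (e 0)) by rewrite /S; df.
have inS b y : y ∈ S b <-> y ∈ b /\ ran M f y by apply: in_sep; df.
have Jc : countable M J by apply: (countable_sub _ (basis_countable HBY)) => b /inJ [].
have [||c Hc] := point_choice hAC HY HBY Jc DS.
- by move=> b _ y /inS [_] /(ran_sub Hf).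
- by move=> b /inJ [bB [y [fy yb]]]; exists y; apply/inS.
have Dc : tdef (fun e => ap c (e 0)) by df.
exists (img J (fun b => ap c b)); split; first exact: countable_img.
split=> [y /(in_img _ Dc) [b [/Hc /inS [_ H] ->]] //|V y Vo fy yV].
have [b [bB [_ [yb [bV _]]]]] := basis_at HBY Vo yV om_emp.
have bJ : b ∈ J by apply/inJ; split=> //; exists y.
have /inS [H _] := Hc b bJ; exists (ap c b); split; last exact: bV.
by apply/in_img => //; exists b.
Qed.

(** Player II answers with a point of a countable dense subset of the range that satisfies
    as many as possible of the first constraints [y ∈ V], for the pairs [(C, V)] of the
    cover such that [C] still meets the open set played. *)
Lemma cover_wins : exists sigma, winning_II X Y f sigma.
Proof.
have [D [Dcount [Dran Dd]]] := dense_range.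
have [h [Hh hI]] := (countableP I).1 (cover_countable HI).
have [g Hg] := (countableP D).1 Dcount.
(* [good k s y]: [y] satisfies the active constraints among those with code below [k]. *)
pose (meets := fun s C => exists x, x ∈ C /\ forall i, i ∈ dom s -> x ∈ ap s i).
pose (good := fun k s y => forall q, q ∈ I -> ap h q ∈ k -> meets s (pfst q) -> y ∈ psnd q).
pose (best := fun s y => forall k, k ∈ succ (dom s) ->
  (exists y', y' ∈ D /\ good k s y') -> good k s y).
pose (sg := fun s => pick g D (best s)).
have Dsg : tdef (fun e => sg (e 0)) by rewrite /sg /best /good /meets; df.
have sgP s : s ∈ playsI X -> sg s ∈ D /\ best s (sg s).
  move=> /(in_playsI) [n [Hn [n0 [Hs _]]]]; apply: pickP => //.
    by rewrite /best /good /meets; df.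
  have H : forall k, k ∈ om -> exists y, y ∈ D /\ forall j, j ∈ succ k ->
      (exists y', y' ∈ D /\ good j s y') -> good j s y.
    have good0 y : good emp s y by move=> q _ /in_emp.
    apply: om_ind; first by rewrite /good /meets; df.
      have ne : emp ∈ n by case: (om0 Hn).
      have [Uo [x xU]] := map_val Hs ne; have xX := open_sub HX Uo xU.
      have fr : ran M f (ap f x) by apply/(ranP Hf); exists x.
      have [y [yD _]] := Dd _ _ (open_all HY) fr (ran_sub Hf fr).
      by exists y; split=> // j /in_succ [/in_emp|->].
    move=> k Hk [y [yD Hy]].
    case: (excluded_middle_informative (exists y', y' ∈ D /\ good (succ k) s y')) => [[y' [y'D gy']]|no].
      exists y'; split=> // j jk _ q qI qj; apply: gy' => //.
      by move: jk => /in_succ [jk|<- //]; apply: (om_trans (om_succ Hk) jk qj).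
    by exists y; split=> // j /in_succ [/Hy //|->] /no.
  by have [y [yD Hy]] := H (dom s) (eq_ind_r (fun d => d ∈ om) Hn (dom_eq Hn Hs)); exists y.
have sm : is_map M (lam (playsI X) sg) (partial_play_I X) (ran M f).
  apply: lam_map => // [s|s /sgP [/Dran]] //; exact: (iff_sym (playsIP X s)).
exists (lam (playsI X) sg); split=> // U y [/seq_om HU dU] /seq_om Hy fol.
case: (excluded_middle_informative (exists x, converges_opens X U x)) => [[x cx]|]; last by left.
right; exists x, (ap f x); have [xX [_ [xU cV]]] := cx.
split=> //; split; first by apply/(map_app _ _ Hf).
split=> [|V Vo fV]; first exact: (map_val Hf xX).
have {}xU n : n ∈ om -> x ∈ ap U n by move=> Hn; apply: (xU n); apply/appP/(map_pr HU).
have {}cV W : W ∈ opens X -> x ∈ W -> exists n, n ∈ om /\ ap U n ⊆ W.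
  by move=> Wo xW; have [n [A [/(map_app _ _ HU) [Hn ->] H]]] := cV W Wo xW; exists n.
have Udec n m : n ∈ om -> m ∈ om -> n ⊆ m -> ap U m ⊆ ap U n.
  by move=> Hn Hm nm; apply: dec_om => //; apply/(decreasing_omP HU).
have [q0 [q0I [xq0 q0V]]] := cover_at HI xX Vo fV.
have Hk : succ (ap h q0) ∈ om by apply/om_succ/Hh.
have [N [HN sep_N]] : exists N, N ∈ om /\ forall q, q ∈ I -> ap h q ∈ succ (ap h q0) ->
    ~ x ∈ pfst q -> forall z, z ∈ pfst q -> ~ z ∈ ap U N.
  move: (succ (ap h q0)) Hk; apply: om_ind; first by df.
    by exists emp; split; [exact: om_emp|move=> q _ /in_emp].
  move=> k Hk [N [HN IH]].
  case: (excluded_middle_informative (exists q, q ∈ I /\ ap h q = k /\ ~ x ∈ pfst q)) => [[q [qI [Eq nq]]]|no].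
    have [W [Wo [xW HW]]] := closed_nbhd (cover_closed HI qI) xX nq.
    have [n [Hn nW]] := cV W Wo xW; have [m [Hm [Nm nm]]] := om_max HN Hn.
    exists m; split=> // q' q'I /in_succ [q'k|Eq'] nq' z zq' zU.
      by apply: (IH q' q'I q'k nq' z zq'); exact: (Udec N m).
    have E : q' = q by apply: hI => //; rewrite Eq.
    by apply: (HW z); [apply: nW; exact: (Udec n m)|rewrite -E].
  exists N; split=> // q qI /in_succ [qk|Eq] nq; first exact: (IH q).
  by case: no; exists q.
have [W [Wo [fW HW]]] : exists W, W ∈ opens Y /\ ap f x ∈ W /\
    forall q, q ∈ I -> ap h q ∈ succ (ap h q0) -> x ∈ pfst q -> W ⊆ psnd q.
  move: (succ (ap h q0)) Hk; apply: om_ind; first by df.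
    exists (pts Y); split; first exact: (open_all HY).
    by split; [exact: (map_val Hf xX)|move=> q _ /in_emp].
  move=> k Hk [W [Wo [fW IH]]].
  case: (excluded_middle_informative (exists q, q ∈ I /\ ap h q = k /\ x ∈ pfst q)) => [[q [qI [Eq xq]]]|no].
    have [W' [W'o [fW' [W'W W'q]]]] := open_cap HY Wo (cover_open HI qI) fW (cover_map HI qI xq).
    exists W'; split=> //; split=> // q' q'I /in_succ [q'k|Eq'] xq' z zW'.
      by apply: (IH q' q'I q'k xq'); exact: W'W.
    by have -> : q' = q; [apply: hI => //; rewrite Eq|exact: W'q].
  exists W; split=> //; split=> // q qI /in_succ [qk|Eq] xq; first exact: (IH q).
  by case: no; exists q.
have [K [HK [NK kK]]] := om_max HN Hk.
exists K; split; first exact/in_om.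
move=> n v Kn yn; have [Hn _] := (map_app _ _ Hy).1 yn.
have [_ [s [/is_succP -> [+ /(map_app _ _ sm) [/(playsIP X) sp ->]]]]] := fol n v yn.
move=> /(init_segP _ (om_succ Hn) HU) Es; rewrite ap_lam // -/(sg s).
have [_ bs] := sgP s sp.
have sub i : i ∈ succ n -> i ∈ om by apply: om_in; exact: om_succ.
have Ds : dom s = succ n by rewrite Es; apply: (dom_eq (om_succ Hn) (restr_isseq HU sub)).
have aps i : i ∈ succ n -> ap s i = ap U i by move=> Hi; rewrite Es (ap_restr HU sub Hi).
have le_n m : m ∈ om -> m ⊆ K -> m ∈ succ n by move=> Hm mK; apply/in_succ_sub => // z /mK /Kn.
apply/q0V; apply: (bs (succ (ap h q0))) => //; last 2 first.
- exact: succ_self.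
- by exists x; split=> // i; rewrite Ds => Hi; rewrite aps //; apply: xU; exact: sub.
- by rewrite Ds; apply/in_succ; left; exact: le_n.
have fr : ran M f (ap f x) by apply/(ranP Hf); exists x.
have [y' [y'D y'W]] := Dd W _ Wo fr fW; exists y'; split=> // q qI qk [z [zq zs]].
apply: (HW q qI qk) => //; apply: NNPP => nq; apply: (sep_N q qI qk nq z zq).
by rewrite -aps; [apply: zs; rewrite Ds|]; exact: le_n.
Qed.
End Cover.

Theorem II_wins_of_Baire1 : Baire_class_1 X Y f -> exists sigma, winning_II X Y f sigma.
Proof. by move=> /Baire1_cover [I HI]; exact: (cover_wins HI). Qed.

Theorem Baire1_continuity K : Baire_class_1 X Y f -> compact X K -> K ⊆ pts X -> nonempty M K ->
  exists x, continuity_point X Y f K x.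
Proof. by move=> /Baire1_cover [I HI]; exact: (cover_continuity HI). Qed.
End BaireOne.

(** * Extending finite plays *)

Section Extend.
Context {M : structure} {hZF : ZF M}.
Implicit Types (x y z n m i s t k : M).

(** The sequence [s] of length [n] followed by [y]. *)
Definition snoc s n y : M := cup s (upr (pr n y) (pr n y)).

Lemma tdef_snoc (t u v : (nat -> M) -> M) : tdef t -> tdef u -> tdef v ->
  tdef (fun e => snoc (t e) (u e) (v e)).
Proof. by move=> Ht Hu Hv; rewrite /snoc; df. Qed.

Lemma in_snoc s n y p : p ∈ snoc s n y <-> p ∈ s \/ p = pr n y.
Proof. by rewrite in_cup in_upr; tauto. Qed.

Lemma snoc_isseq s n y (A : M -> Prop) : isseq s n A -> A y -> isseq (snoc s n y) (succ n) A.
Proof.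
move=> Hs Ay; apply: map_intro => [p /in_snoc [/(map_in Hs) [i [ni ->]]|->]|i /in_succ [ni|->]].
- exists i, (ap s i); split; first by apply/in_succ; left.
  by split=> //; exact: (map_val Hs ni).
- by exists n, y; split=> //; apply/in_succ; right.
- exists (ap s i); split; first by apply/in_snoc; left; exact: (map_pr Hs ni).
  move=> z /in_snoc [/(map_ap Hs) //|/pr_inj [E _]].
  by case: (@mem_irr _ _ n); rewrite -{1}E.
- exists y; split; first by apply/in_snoc; right.
  move=> z /in_snoc [H|/pr_inj [_ //]].
  by have [/mem_irr] := map_dom Hs H.
Qed.

Lemma snoc_sub s n y : s ⊆ snoc s n y.
Proof. by move=> p H; apply/in_snoc; left. Qed.

Lemma ap_snoc s n y (A : M -> Prop) : isseq s n A -> A y -> ap (snoc s n y) n = y.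
Proof. by move=> Hs Ay; apply: (map_ap (snoc_isseq Hs Ay)); apply/in_snoc; right. Qed.

Lemma sub_ap s t n (m A B : M -> Prop) i : isseq s n A -> is_map M t m B -> s ⊆ t -> i ∈ n ->
  ap t i = ap s i.
Proof. by move=> Hs Ht st ni; apply: (map_ap Ht); apply: st; exact: (map_pr Hs). Qed.

Lemma sub_restr s t n (m A B : M -> Prop) : isseq s n A -> is_map M t m B ->
  s ⊆ t -> s = restr t n.
Proof.
move=> Hs Ht st.
have sub i : i ∈ n -> m i by move=> ni; have [] := map_dom Ht (st _ (map_pr Hs ni)).
apply: (isseq_eq Hs (restr_isseq Ht sub)) => i ni.
by rewrite (ap_restr Ht sub ni) (sub_ap Hs Ht st ni).
Qed.

Section Chain.
Variables (u : M -> M) (A : M -> Prop).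
Hypothesis Du : tdef (fun e => u (e 0)).
Hypothesis useq : forall n, n ∈ om -> exists d, d ∈ om /\ isseq (u n) d A.
Hypothesis usub : forall n, n ∈ om -> u n ⊆ u (succ n).
Hypothesis udom : forall n, n ∈ om -> n ∈ dom (u n).

(** The union of an increasing chain of finite sequences of unbounded lengths: an infinite
    sequence that extends all of them. *)
Definition chain : M := bigU (img om u).

Lemma in_chain p : p ∈ chain <-> exists n, n ∈ om /\ p ∈ u n.
Proof.
rewrite in_bigU; split=> [[s [/(in_img _ Du) [n [Hn ->]] H]]|[n [Hn H]]]; first by exists n.
by exists (u n); split=> //; apply/in_img => //; exists n.
Qed.

Lemma chain_le n m : n ∈ om -> m ∈ om -> n ⊆ m -> u n ⊆ u m.
Proof.
move=> Hn Hm; apply: (om_ind_from (P := fun m => u n ⊆ u m) _ Hn) => //; first by df.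
by move=> i Hi _ IH z /IH /(usub Hi).
Qed.

Lemma chain_seq n : n ∈ om -> dom (u n) ∈ om /\ isseq (u n) (dom (u n)) A.
Proof. by move=> /useq [d [Hd Hs]]; rewrite (dom_eq Hd Hs). Qed.

Lemma chain_map : is_map M chain (fun i => i ∈ om) A.
Proof.
apply: map_intro => [p /in_chain [n [Hn Hp]]|i Hi].
  have [Hd Hs] := chain_seq Hn; have [i [id ->]] := map_in Hs Hp.
  by exists i, (ap (u n) i); split; [exact: (om_in Hd)|split=> //; exact: (map_val Hs)].
have [Hd Hs] := chain_seq Hi; exists (ap (u i) i); split.
  by apply/in_chain; exists i; split=> //; exact: (map_pr Hs (udom Hi)).
move=> y /in_chain [n [Hn H]]; have [m [Hm [nm im]]] := om_max Hn Hi.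
have [Hdm Hsm] := chain_seq Hm.
rewrite -(map_ap Hsm (chain_le Hn Hm nm H)).
by apply/esym/(map_ap Hsm)/(chain_le Hi Hm im)/(map_pr Hs)/udom.
Qed.

Lemma chain_sub n : n ∈ om -> u n ⊆ chain.
Proof. by move=> Hn p Hp; apply/in_chain; exists n. Qed.

Lemma chain_ap n i : n ∈ om -> i ∈ dom (u n) -> ap chain i = ap (u n) i.
Proof.
move=> Hn ni; have [Hd Hs] := chain_seq Hn.
exact: (sub_ap Hs chain_map (chain_sub Hn) ni).
Qed.

Lemma chain_restr n : n ∈ om -> restr chain (dom (u n)) = u n.
Proof.
move=> Hn; have [Hd Hs] := chain_seq Hn.
exact: (esym (sub_restr Hs chain_map (chain_sub Hn))).
Qed.
End Chain.
End Extend.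

Ltac dfn_reg4 ::= lazymatch goal with
  | |- tdef (fun e => rval (psum (@?t e) (@?u e))) => apply (tdef_psum (s := t) (t := u))
  | |- tdef (fun e => snoc _ _ _) => simple apply tdef_snoc
  end.

(** * From a winning strategy of Player II to Baire class 1 *)

Section BaireOneOfII.
Context {M : structure} {hZF : ZF M} {R : field_data M} {hR : complete_ordered_field R}.
Variables (X Y : space M) (f BX SX P w1 w2 w3 sigma : M).
Hypotheses (HX : topological X) (HB : basis X BX SX) (HY : topological Y).
Hypotheses (HP : apart_family Y P w1 w2 w3) (Hf : function X Y f).
Hypothesis Hsig : winning_II X Y f sigma.
Implicit Types (U V B C O x y z n m i p s t k b q : M).

Lemma limit_uniq U x x' : converges_opens X U x -> converges_opens X U x' -> x = x'.
Proof.
move=> [xX [_ [xU cx]]] [x'X [_ [x'U cx']]]; apply: (open_T1 HX) => // V Vo xV.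
by have [n [A [H AV]]] := cx V Vo xV; apply: AV; exact: (x'U n).
Qed.

(** Plays of Player I with basic open sets. *)
Definition bplays : M := sep (playsI X) (fun s => forall i, i ∈ dom s -> ap s i ∈ BX).

(** [x] belongs to all the open sets of the play [s]. *)
Definition thru s x : Prop := forall i, i ∈ dom s -> x ∈ ap s i.

Lemma in_bplays s : s ∈ bplays <-> s ∈ playsI X /\ forall i, i ∈ dom s -> ap s i ∈ BX.
Proof. by apply: in_sep; df. Qed.

Lemma play_seq s : s ∈ playsI X -> exists j, j ∈ om /\ dom s = succ j /\
  isseq s (succ j) (move_I X) /\ forall i, succ i ∈ succ j -> ap s (succ i) ⊆ ap s i.
Proof.
move=> /in_playsI [n [Hn [n0 [Hs Hd]]]]; case: (om_case Hn) => [//|[j [Hj En]]]; subst n.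
exists j; split=> //; split; first exact: (dom_eq Hn Hs).
by split=> //; apply/(decreasing_natP Hn Hs).
Qed.

Lemma play_last s : s ∈ playsI X -> exists j, j ∈ om /\ dom s = succ j /\ ap s j ∈ opens X /\
  forall z, z ∈ ap s j -> thru s z.
Proof.
move=> /play_seq [j [Hj [Ej [Hs Hd]]]]; exists j; split=> //; split=> //.
split=> [|z zs i]; first by have [] := map_val Hs (succ_self j).
rewrite Ej => ij; have Hi := om_in (om_succ Hj) ij.
apply: (dec_le (om_succ Hj) Hi (succ_self j) _ Hd zs); exact/(in_succ_sub Hi Hj).
Qed.

Lemma bplays_countable : countable M bplays.
Proof.
apply: (countable_sub _ (countable_seqs (hR := hR) (basis_countable HB))).
move=> s /in_bplays [/play_seq [j [Hj [Ej [Hs _]]]] sB].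
apply/in_seqs; exists (succ j); split; first exact: om_succ.
by apply: (map_mono Hs) => // i ij _; apply: sB; rewrite Ej.
Qed.

Lemma playsI_intro s n : n ∈ om -> n <> emp -> isseq s n (move_I X) ->
  (forall i, succ i ∈ n -> ap s (succ i) ⊆ ap s i) -> s ∈ playsI X.
Proof.
by move=> Hn n0 Hs Hd; apply/in_playsI; exists n; do 3!split=> //; apply/(decreasing_natP Hn Hs).
Qed.

Lemma restr_play U n : is_map M U (fun i => i ∈ om) (move_I X) -> decreasing M U -> n ∈ om ->
  restr U (succ n) ∈ playsI X.
Proof.
move=> HU /(decreasing_omP HU) Hd Hn.
have sub i : i ∈ succ n -> i ∈ om by apply: om_in; exact: om_succ.
apply: (playsI_intro (om_succ Hn) (@succ_neq0 _ _ n) (restr_isseq HU sub)) => i Hi.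
have Hi' : i ∈ succ n by apply: (om_trans (om_succ Hn) Hi); exact: succ_self.
by rewrite !(ap_restr HU sub) //; apply: Hd; exact: sub.
Qed.

Lemma snoc_bplay s x b : s ∈ bplays -> thru s x -> b ∈ BX -> x ∈ b ->
  (forall j, dom s = succ j -> b ⊆ ap s j) ->
  snoc s (dom s) b ∈ bplays /\ thru (snoc s (dom s) b) x /\
  dom (snoc s (dom s) b) = succ (dom s) /\
  ap (snoc s (dom s) b) (dom s) = b.
Proof.
move=> /in_bplays [/play_seq [j [Hj [Ej [Hs Hd]]]] sB] sx bB xb /(_ j Ej) bs.
rewrite Ej in sB sx *; have Hj' := om_succ Hj.
have mb : move_I X b by split; [exact: (basis_open HB)|exists x].
have Hs' : isseq (snoc s (succ j) b) (succ (succ j)) (move_I X) by exact: snoc_isseq.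
have Ed : dom (snoc s (succ j) b) = succ (succ j) by apply: (dom_eq _ Hs'); exact: om_succ.
have Eb : ap (snoc s (succ j) b) (succ j) = b by exact: (ap_snoc Hs mb).
have Es i : i ∈ succ j -> ap (snoc s (succ j) b) i = ap s i.
  by apply: (sub_ap Hs Hs'); exact: snoc_sub.
have thr (A : M -> M -> Prop) : (forall i, i ∈ succ j -> A i (ap s i)) -> A (succ j) b ->
    forall i, i ∈ dom (snoc s (succ j) b) -> A i (ap (snoc s (succ j) b) i).
  by move=> H1 H2 i; rewrite Ed => /in_succ [Hi|->]; rewrite ?Eb ?Es //; exact: H1.
split; last first.
  by split=> //; apply: (thr (fun i a => x ∈ a)) => // i Hi; apply: sx; rewrite Ej.
apply/in_bplays; split; last by apply: (thr (fun i a => a ∈ BX)).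
apply: (playsI_intro (om_succ Hj') _ Hs'); first exact: succ_neq0.
move=> i /in_succ [Hi|/succ_inj ->]; last by rewrite Eb Es //; exact: succ_self.
rewrite !Es //; first exact: Hd.
by apply: (om_trans Hj' Hi); exact: succ_self.
Qed.

(** A run of Player I through basic open sets that converges to [x], extends a given play,
    and infinitely often satisfies a condition that can always be reached. *)
Lemma run_build s0 x (Q : M -> Prop) : s0 ∈ bplays -> thru s0 x -> x ∈ pts X ->
  dfn (fun e => Q (e 0)) ->
  (forall s, s ∈ bplays -> thru s x -> exists t, t ∈ bplays /\ thru t x /\ s ⊆ t /\ Q t) ->
  exists U, is_map M U (fun i => i ∈ om) (move_I X) /\ converges_opens X U x /\ s0 ⊆ U /\
    (forall i, i ∈ om -> ap U i ∈ BX) /\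
    forall N, N ∈ om -> exists n, n ∈ om /\ N ⊆ n /\ Q (restr U (succ n)).
Proof.
move=> s0B s0x xX DQ HQ; have [g Hg] := (countableP bplays).1 bplays_countable.
pose (nxt := fun n s t => s ⊆ t /\ thru t x /\ Q t /\ dom s ∈ dom t /\
  exists i, i ∈ dom t /\ pr n (ap t i) ∈ SX).
have step n s : n ∈ om -> s ∈ bplays -> thru s x ->
    pick g bplays (nxt n s) ∈ bplays /\ nxt n s (pick g bplays (nxt n s)).
  move=> Hn sB sx; apply: pickP => //; first by rewrite /nxt /thru; df.
  have [/play_last [j [Hj [Ej [so _]]]] _] := (in_bplays s).1 sB.
  have xs : x ∈ ap s j by apply: sx; rewrite Ej; exact: succ_self.
  have [b [bB [bS [xb [bs _]]]]] := basis_at HB so xs Hn.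
  have [|sB' [sx' [Ed Eb]]] := snoc_bplay sB sx bB xb.
    by move=> j'; rewrite Ej => /succ_inj <-.
  have [t [tB [tx [st Qt]]]] := HQ _ sB' sx'; exists t; split=> //.
  have [/play_seq [k [Hk [Ek [Ht _]]]] _] := (in_bplays t).1 tB.
  have [/play_seq [l [Hl [El [Hs' _]]]] _] := (in_bplays _).1 sB'.
  have dl : dom s ∈ succ l by rewrite -El Ed; exact: succ_self.
  have dk : dom s ∈ succ k by have [] := map_dom Ht (st _ (map_pr Hs' dl)).
  split; first by move=> p Hp; apply: st; exact: snoc_sub.
  do 2!split=> //; split; first by rewrite Ek.
  exists (dom s); split; first by rewrite Ek.
  by rewrite (sub_ap Hs' Ht st dl) Eb.
pose (u := fun n => rec s0 (fun n s => pick g bplays (nxt n s)) n).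
have Du : tdef (fun e => u (e 0)) by rewrite /u /nxt /thru; df.
have u0 : u emp = s0 by rewrite /u rec0 // /nxt /thru; df.
have uS n : n ∈ om -> u (succ n) = pick g bplays (nxt n (u n)).
  by move=> Hn; rewrite /u recS // /nxt /thru; df.
have inv : forall n, n ∈ om -> u n ∈ bplays /\ thru (u n) x.
  apply: om_ind; [by rewrite /thru; df|by rewrite u0|].
  move=> n Hn [uB ux]; rewrite uS //.
  by have [? [_ [? _]]] := step n (u n) Hn uB ux.
have un n : n ∈ om -> nxt n (u n) (u (succ n)).
  by move=> Hn; have [uB ux] := inv n Hn; rewrite uS //; exact: (step n (u n) Hn uB ux).2.
have useq n : n ∈ om -> exists d, d ∈ om /\ isseq (u n) d (move_I X).
  move=> /inv [/in_bplays [/play_seq [j [Hj [_ [Hs _]]]] _] _].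
  by exists (succ j); split=> //; exact: om_succ.
have usub n : n ∈ om -> u n ⊆ u (succ n) by move=> /un [].
have udom : forall n, n ∈ om -> n ∈ dom (u n).
  apply: om_ind; first by df.
    have [/in_bplays [/play_seq [j [Hj [-> _]]] _] _] := inv emp om_emp.
    by case: (om0 (om_succ Hj)) => // /succ_neq0.
  move=> n Hn nd; have [_ [_ [_ [H _]]]] := un n Hn.
  have [Hd _] := chain_seq useq Hn; have [Hd' _] := chain_seq useq (om_succ Hn).
  case: (om_succ_le Hd nd) => [E|K]; [by rewrite {1}E|exact: (om_trans Hd' H K)].
have HU := chain_map Du useq usub udom.
have apU := chain_ap Du useq usub udom.
have xU i : i ∈ om -> x ∈ ap (chain u) i.
  by move=> Hi; rewrite (apU i) //; [apply: (inv i Hi).2|]; exact: udom.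
exists (chain u); split=> //; split; last first.
  split; first by rewrite -u0; apply: chain_sub => //; exact: om_emp.
  split=> [i Hi|N HN].
    by rewrite (apU i) //; [have [/in_bplays [_ H] _] := inv i Hi; apply: H|]; exact: udom.
  have HN' := om_succ HN; have [_ [_ [Qt _]]] := un N HN.
  have [/in_bplays [/play_seq [j [Hj [Ej _]]] _] _] := inv _ HN'.
  exists j; split=> //; split; last by rewrite -Ej (chain_restr Du useq usub udom HN').
  have := udom _ HN'; rewrite Ej => /(in_succ_sub HN' Hj) H z zN.
  by apply: H; apply/in_succ; left.
split=> //; split.
  apply/(decreasing_omP HU) => i Hi; have Hi' := om_succ Hi.
  have [/in_bplays [/play_seq [j [Hj [Ej [_ Hd]]]] _] _] := inv _ Hi'.
  have dS := udom _ Hi'.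
  have di : i ∈ dom (u (succ i)).
    by rewrite Ej in dS *; apply: (om_trans (om_succ Hj) dS); exact: succ_self.
  by rewrite !(apU _ _ Hi') //; apply: Hd; rewrite -Ej.
split=> [n A /(map_app _ _ HU) [Hn ->]|V Vo xV]; first exact: xU.
have [n [Hn small]] := basis_small HB Vo xV.
have [_ [_ [_ [_ [i [id iS]]]]]] := un n Hn; have Hn' := om_succ Hn.
have [Hd _] := chain_seq useq Hn'; have Hi := om_in Hd id.
exists i, (ap (chain u) i); split; first by apply/appP/(map_pr HU).
apply: (small n) => //; last exact: xU.
by rewrite (apU _ _ Hn').
Qed.

Lemma sigma_ran s : s ∈ playsI X -> ran M f (ap sigma s).
Proof. by move=> /playsIP sp; have [Hm _] := Hsig; exact: (map_val Hm sp). Qed.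

(** The answers of Player II to a run that converges to [x] converge to [f x]. *)
Lemma sigma_converges U x V : is_map M U (fun i => i ∈ om) (move_I X) ->
  converges_opens X U x -> V ∈ opens Y -> ap f x ∈ V ->
  exists N, N ∈ om /\ forall n, n ∈ om -> N ⊆ n -> ap sigma (restr U (succ n)) ∈ V.
Proof.
move=> HU cx Vo fV; have [Hm win] := Hsig; have [_ [dU _]] := cx.
pose (F := fun n => ap sigma (restr U (succ n))).
have DF : tdef (fun e => F (e 0)) by rewrite /F; df.
have HF n : n ∈ om -> ran M f (F n) by move=> Hn; apply/sigma_ran/restr_play.
have Hy : is_map M (lam om F) (fun n => n ∈ om) (ran M f) by apply: lam_map.
case: (win U (lam om F)).
- by split=> //; apply/seq_om.
- exact/seq_om.
- move=> n v /(map_app _ _ Hy) [Hn ->]; rewrite ap_lam //.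
  exists (succ n), (restr U (succ n)); split; first exact/is_succP.
  split; first by apply/(init_segP _ (om_succ Hn) HU).
  by apply/(map_app _ _ Hm); split=> //; apply/playsIP/restr_play.
- by case; exists x.
move=> [x' [fx [cx' [/(map_app _ _ Hf) [_ ->] [_ H]]]]].
have E := limit_uniq cx cx'; rewrite -E in H.
have [N [/in_om HN HV]] := H V Vo fV; exists N; split=> // n Hn Nn.
by apply: (HV n) => //; apply/(map_app _ _ Hy); split=> //; rewrite ap_lam.
Qed.

(** Otherwise a run converging to [x] would get answers outside the first set of [p]
    infinitely often. *)
Lemma forced x p : x ∈ pts X -> p ∈ P -> ap f x ∈ ap w1 p ->
  exists s, s ∈ bplays /\ thru s x /\
    forall t, t ∈ bplays -> s ⊆ t -> thru t x -> ap sigma t ∈ ap w1 p.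
Proof.
move=> xX pP fx; apply: NNPP => no.
have HQ s : s ∈ bplays -> thru s x ->
    exists t, t ∈ bplays /\ thru t x /\ s ⊆ t /\ ~ ap sigma t ∈ ap w1 p.
  move=> sB sx; apply: NNPP => nt; apply: no; exists s; split=> //; split=> // t tB st tx.
  by apply: NNPP => ns; apply: nt; exists t.
have [b [bB [_ [xb _]]]] := basis_at HB (open_all HX) xX om_emp.
have mb : move_I X b by split; [exact: (basis_open HB)|exists x].
have He : isseq emp emp (move_I X) by apply: map_intro => [p' /in_emp|i /in_emp].
have Hs : isseq (snoc emp emp b) (succ emp) (move_I X) by exact: snoc_isseq.
have Ed : dom (snoc emp emp b) = succ emp by apply: (dom_eq _ Hs); exact: om_succ om_emp.
have Eb : ap (snoc emp emp b) emp = b by exact: (ap_snoc He mb).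
have [|||U [HU [cx [_ [_ HN]]]]] :=
  @run_build (snoc emp emp b) x (fun t => ~ ap sigma t ∈ ap w1 p) _ _ xX _ HQ.
- apply/in_bplays; split; last by move=> i; rewrite Ed => /in_succ [/in_emp|->] //; rewrite Eb.
  apply: (playsI_intro (om_succ om_emp) _ Hs); first exact: succ_neq0.
  by move=> i /in_succ [/in_emp|/succ_neq0].
- by move=> i; rewrite Ed => /in_succ [/in_emp|->] //; rewrite Eb.
- by df.
have [N [HN' H]] := sigma_converges HU cx (apart_open1 HP pP) fx.
have [n [Hn [Nn]]] := HN N HN'; apply; exact: H.
Qed.

Lemma forced_value s x p : x ∈ pts X -> p ∈ P -> s ∈ bplays -> thru s x ->
  (forall t, t ∈ bplays -> s ⊆ t -> thru t x -> ap sigma t ∈ ap w1 p) -> ~ ap f x ∈ ap w2 p.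
Proof.
move=> xX pP sB sx H f2.
have [||U [HU [cx [sU [UB _]]]]] := @run_build s x (fun _ => True) sB sx xX.
- exact: dfn_prop.
- by move=> t tB tx; exists t; do 2!split=> //; split=> // z.
have [N [HN H2]] := sigma_converges HU cx (apart_open2 HP pP) f2.
have [/play_seq [j [Hj [Ej [Hs _]]]] _] := (in_bplays s).1 sB.
have [n [Hn [Nn jn]]] := om_max HN Hj.
have [_ [dU [xU _]]] := cx.
have sub i : i ∈ succ n -> i ∈ om by apply: om_in; exact: om_succ.
have Hr : isseq (restr U (succ n)) (succ n) (move_I X) by exact: (restr_isseq HU sub).
have Ed : dom (restr U (succ n)) = succ n by apply: (dom_eq _ Hr); exact: om_succ.
have rp : restr U (succ n) ∈ playsI X by exact: restr_play.
have [V [_ [lV [dV|dV]]]] := apart_sep HP pP (ran_sub Hf (sigma_ran rp)); last first.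
  by apply: (dV _ lV); exact: H2.
apply: (dV _ lV); apply: H.
- apply/in_bplays; split=> // i; rewrite Ed => Hi; rewrite (ap_restr HU sub Hi).
  by apply: UB; exact: sub.
- move=> q /[dup] /(map_in Hs) [i [ij Eq]] qs; rewrite Eq; apply/in_restr; rewrite -Eq.
  by split; [exact: sU|]; apply/in_succ_sub => //; [exact: (om_in (om_succ Hj) ij)|];
    move=> z zi; apply: jn; apply: ((in_succ_sub (om_in (om_succ Hj) ij) Hj).1 ij).
- move=> i; rewrite Ed => Hi; rewrite (ap_restr HU sub Hi).
  by apply: (xU i); apply/appP/(map_pr HU); exact: sub.
Qed.

Theorem Baire1_of_II_wins : Baire_class_1 X Y f.
Proof.
move=> V Vo.
pose (idx := prod bplays (prod P BX)).
pose (ok := fun q => (forall z, adherent X (psnd (psnd q)) z -> thru (pfst q) z) /\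
  ap w3 (pfst (psnd q)) ⊆ V).
pose (Cl := fun q => sep (pts X) (fun x => adherent X (psnd (psnd q)) x /\
  forall t, t ∈ bplays -> pfst q ⊆ t -> ~ ap sigma t ∈ ap w1 (pfst (psnd q)) -> ~ thru t x)).
have Dok : dfn (fun e => ok (e 0)) by rewrite /ok /thru; df.
have DCl : tdef (fun e => Cl (e 0)) by rewrite /Cl /thru; df.
have inCl s p b x : x ∈ Cl (pr s (pr p b)) <-> x ∈ pts X /\ adherent X b x /\
    forall t, t ∈ bplays -> s ⊆ t -> ~ ap sigma t ∈ ap w1 p -> ~ thru t x.
  by rewrite /Cl pfst_pr !psnd_pr pfst_pr; apply: in_sep; rewrite /thru; df.
have inF C : C ∈ img (sep idx ok) Cl <-> exists s p b, s ∈ bplays /\ p ∈ P /\ b ∈ BX /\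
    (forall z, adherent X b z -> thru s z) /\ ap w3 p ⊆ V /\ C = Cl (pr s (pr p b)).
  rewrite in_img //; split.
    move=> [q [/(in_sep _ Dok) [/in_prodP [s [r [sB [/in_prodP [p [b [pP [bB ->]]]] ->]]]] []]]].
    by rewrite pfst_pr !psnd_pr pfst_pr => H1 H2 ->; exists s, p, b.
  move=> [s [p [b [sB [pP [bB [H1 [H2 ->]]]]]]]]; exists (pr s (pr p b)); split=> //.
  by apply/in_sep => //; rewrite /idx /ok !pr_in_prod pfst_pr !psnd_pr pfst_pr.
exists (img (sep idx ok) Cl); split; [|split].
- apply: countable_img => //; apply: (@countable_sub _ _ _ idx) => [q /(in_sep _ Dok) []//|].
  apply: countable_prod; first exact: bplays_countable.
  by apply: countable_prod; [exact: (apart_countable HP)|exact: (basis_countable HB)].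
- move=> C /inF [s [p [b [sB [pP [bB [_ [_ ->]]]]]]]].
  have DC : dfn (fun e => ~ e 0 ∈ Cl (pr s (pr p b))) by df.
  split=> [x /inCl []//|]; exists (sep (pts X) (fun x => ~ x ∈ Cl (pr s (pr p b)))); split.
    apply: (open_local HX) => [x /(in_sep _ DC) []//|x /(in_sep _ DC) [xX nx]].
    case: (excluded_middle_informative (adherent X b x)) => ad; last first.
      have Da : dfn (fun e => ~ adherent X b (e 0)) by df.
      exists (sep (pts X) (fun z => ~ adherent X b z)); split; first exact: coadherent_open.
      split; first exact/in_sep.
      by move=> z /(in_sep _ Da) [zX nz]; apply/in_sep => //; split=> // /inCl [_ [? _]].
    have [t [tB [st [nt tx]]]] : exists t, t ∈ bplays /\ s ⊆ t /\
        ~ ap sigma t ∈ ap w1 p /\ thru t x.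
      apply: NNPP => no; apply: nx; apply/inCl; split=> //; split=> // t tB st nt tx.
      by apply: no; exists t.
    have [/play_last [j [Hj [Ej [to th]]]] _] := (in_bplays t).1 tB.
    exists (ap t j); split=> //; split; first by apply: tx; rewrite Ej; exact: succ_self.
    move=> z zt; apply/in_sep => //; split; first exact: (open_sub HX to).
    by move=> /inCl [_ [_ H]]; apply: (H t) => //; exact: th.
  move=> x xX; rewrite in_sep //; split=> [H []//|H]; apply: NNPP => nx; exact: H.
- move=> x; split.
    move=> [y [/(map_app _ _ Hf) [xX ->] fV]].
    have [p [pP [f1 p3]]] := apart_at HP Vo fV.
    have [s [sB [sx Hs]]] := forced xX pP f1.
    have [/play_last [j [Hj [Ej [so th]]]] _] := (in_bplays s).1 sB.
    have xs : x ∈ ap s j by apply: sx; rewrite Ej; exact: succ_self.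
    have [b [bB [_ [xb [_ ad]]]]] := basis_at HB so xs om_emp.
    exists (Cl (pr s (pr p b))); split.
      apply/inF; exists s, p, b; do 3!split=> //; split=> // z /ad; exact: th.
    apply/inCl; split=> //; split; last by move=> t tB st nt tx; apply: nt; exact: Hs.
    by apply: adherent_in => //; apply: (open_sub HX); exact: (basis_open HB).
  move=> [C [/inF [s [p [b [sB [pP [bB [ths [p3 ->]]]]]]]] /inCl [xX [ad H]]]].
  exists (ap f x); split; first exact/(map_app _ _ Hf).
  have fY : ap f x ∈ pts Y by exact: (map_val Hf xX).
  case: (apart_cover HP pP fY) => [f2|/p3 //]; case: (forced_value xX pP sB (ths x ad) _ f2).
  by move=> t tB st tx; apply: NNPP => nt; apply: (H t).
Qed.
End BaireOneOfII.

(** * From a winning strategy of Player I to a compact set *)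

Section CompactOfI.
Context {M : structure} {hZF : ZF M} {R : field_data M} {hR : complete_ordered_field R}.
Hypothesis hAC : AC_omega_R R.
Variables (X Y : space M) (f P w1 w2 w3 tau D : M).
Hypotheses (HX : topological X) (HY : topological Y).
Hypotheses (HP : apart_family Y P w1 w2 w3) (Hf : function X Y f).
Hypothesis Htau : winning_I X Y f tau.
Hypotheses (Dcount : countable M D) (Dran : forall y, y ∈ D -> ran M f y).
Hypothesis Ddense : forall V y, V ∈ opens Y -> ran M f y -> y ∈ V -> exists z, z ∈ D /\ z ∈ V.
Implicit Types (U V B C x y z n m i p s t k q g W : M).

(** Infinite sequences of answers of Player II in [D]. *)
Definition branches : M :=
  sep (pow (prod om D)) (fun y => is_map M y (fun n => n ∈ om) (fun z => z ∈ D)).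

Lemma in_branches y : y ∈ branches <-> is_map M y (fun n => n ∈ om) (fun z => z ∈ D).
Proof.
rewrite in_sep; last by df.
split=> [[_ //]|Hy]; split=> //; apply/in_pow => p /(map_in Hy) [i [Hi ->]].
by apply/pr_in_prod; split=> //; exact: (map_val Hy Hi).
Qed.

Lemma branch_restr y n : y ∈ branches -> n ∈ om -> isseq (restr y n) n (fun z => z ∈ D).
Proof. by move=> /in_branches Hy Hn; apply: (restr_isseq Hy) => i; exact: om_in. Qed.

Lemma branch_ap y n i : y ∈ branches -> n ∈ om -> i ∈ n -> ap (restr y n) i = ap y i.
Proof. by move=> /in_branches Hy Hn; apply: (ap_restr Hy) => j; exact: om_in. Qed.

Lemma restr_eq y y' n : y ∈ branches -> y' ∈ branches -> n ∈ om ->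
  (forall i, i ∈ n -> ap y i = ap y' i) -> restr y n = restr y' n.
Proof.
move=> Hy Hy' Hn H; apply: (isseq_eq (branch_restr Hy Hn) (branch_restr Hy' Hn)) => i ni.
by rewrite !branch_ap // H.
Qed.

(** The run of Player I against [y], and its limit. *)
Definition runI y : M := lam om (fun n => ap tau (restr y n)).
Definition phi y : M := iota (converges_opens X (runI y)).

Lemma D_playII s n : n ∈ om -> isseq s n (fun z => z ∈ D) -> partial_play_II M f s.
Proof.
move=> Hn Hs; exists n; split; first exact/in_om.
by apply: (map_mono Hs) => // i ni; exact: Dran.
Qed.

Lemma runI_map y : y ∈ branches -> is_map M (runI y) (fun n => n ∈ om) (move_I X).
Proof.
move=> yb; have [[Hm _] _] := Htau; apply: lam_map => // [|n Hn]; first by df.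
by apply: (map_val Hm); apply: (D_playII Hn); exact: branch_restr.
Qed.

Lemma runI_ap y n : n ∈ om -> ap (runI y) n = ap tau (restr y n).
Proof. by move=> Hn; rewrite ap_lam //; df. Qed.

Lemma tau_mono s t n m : n ∈ om -> m ∈ om -> isseq s n (fun z => z ∈ D) ->
  isseq t m (fun z => z ∈ D) -> s ⊆ t -> ap tau t ⊆ ap tau s.
Proof.
move=> Hn Hm Hs Ht st; have [[Htm mono] _] := Htau.
apply: (mono _ _ _ _ st); apply/(map_app _ _ Htm); split=> //.
  exact: (D_playII Hn).
exact: (D_playII Hm).
Qed.

Lemma restr_mono y n m : y ∈ branches -> n ∈ om -> m ∈ om -> n ⊆ m -> restr y n ⊆ restr y m.
Proof.
move=> yb Hn Hm nm p /(map_in (branch_restr yb Hn)) [i [ni ->]].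
rewrite branch_ap //; apply/in_restr; split; last exact: nm.
by apply: (map_pr ((in_branches y).1 yb)); exact: om_in ni.
Qed.

Lemma tau_dec y n m : y ∈ branches -> n ∈ om -> m ∈ om -> n ⊆ m ->
  ap tau (restr y m) ⊆ ap tau (restr y n).
Proof.
move=> yb Hn Hm nm; apply: (tau_mono Hn Hm); try exact: branch_restr.
exact: restr_mono.
Qed.

Lemma phi_spec y : y ∈ branches -> converges_opens X (runI y) (phi y) /\
  ~ forall V, V ∈ opens Y -> ap f (phi y) ∈ V ->
    exists N, N ∈ om /\ forall n, n ∈ om -> N ⊆ n -> ap y n ∈ V.
Proof.
move=> yb; have Hy := (in_branches y).1 yb; have Hm := runI_map yb.
have [[Htm _] win] := Htau.
have Hd : decreasing M (runI y).
  apply/(decreasing_omP Hm) => i Hi; rewrite !runI_ap //; last exact: om_succ.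
  by apply: tau_dec => //; [exact: om_succ|move=> z zi; apply/in_succ; left].
have Hy' : is_map M y (fun n => n ∈ om) (ran M f) by apply: (map_mono Hy) => // i _; exact: Dran.
have fol : I_follows M tau (runI y) y.
  move=> n A /(map_app _ _ Hm) [Hn ->]; exists (restr y n); split.
    exact/(init_segP _ Hn Hy).
  rewrite runI_ap //; apply/(map_app _ _ Htm); split=> //.
  by apply: (D_playII Hn); exact: branch_restr.
have lose := win (runI y) y (conj ((seq_om _ _).2 Hm) Hd) ((seq_om _ _).2 Hy') fol.
have [x cx] : exists x, converges_opens X (runI y) x.
  by apply: NNPP => no; apply: lose; left.
have E : phi y = x by apply: iota_eq => // x' cx'; exact: (limit_uniq HX cx' cx).
rewrite E; split=> // H; apply: lose; right; exists x, (ap f x).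
have [xX _] := cx; split=> //; split; first exact/(map_app _ _ Hf).
split=> [|V Vo fV]; first exact: (map_val Hf xX).
have [N [HN NV]] := H V Vo fV; exists N; split; first exact/in_om.
by move=> n v Nn /(map_app _ _ Hy) [Hn ->]; exact: NV.
Qed.

Lemma phi_pts y : y ∈ branches -> phi y ∈ pts X.
Proof. by move=> /phi_spec [[]]. Qed.

Lemma phi_in y n : y ∈ branches -> n ∈ om -> phi y ∈ ap tau (restr y n).
Proof.
move=> yb Hn; have [[_ [_ [H _]]] _] := phi_spec yb; rewrite -runI_ap //.
by apply: (H n); apply/appP/(map_pr (runI_map yb)).
Qed.

Lemma phi_base y V : y ∈ branches -> V ∈ opens X -> phi y ∈ V ->
  exists n, n ∈ om /\ ap tau (restr y n) ⊆ V.
Proof.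
move=> yb Vo H; have [[_ [_ [_ K]]] _] := phi_spec yb.
have [n [A [/(map_app _ _ (runI_map yb)) [Hn ->] AV]]] := K V Vo H.
by exists n; rewrite -runI_ap.
Qed.

(** Player II continues the play [t] within [W]. *)
Definition inT t W y : Prop :=
  y ∈ branches /\ t ⊆ y /\ forall i, i ∈ om -> dom t ⊆ i -> ap y i ∈ W.

(** [t'] continues [t] within [W]. *)
Definition ext_in t W t' : Prop :=
  t' ∈ seqs D /\ t ⊆ t' /\ forall i, i ∈ dom t' -> dom t ⊆ i -> ap t' i ∈ W.

Lemma seqs_dom t : t ∈ seqs D -> dom t ∈ om /\ isseq t (dom t) (fun z => z ∈ D).
Proof. by move=> /in_seqs [n [Hn Hs]]; rewrite (dom_eq Hn Hs). Qed.

Lemma inT_ext t W t' y : t ∈ seqs D -> ext_in t W t' -> inT t' W y -> inT t W y.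
Proof.
move=> tS [t'S [tt' Ht']] [yb [t'y Hy]]; split=> //; split=> [z /tt' /t'y //|i Hi ti].
have [Hd' Hs'] := seqs_dom t'S.
case: (excluded_middle_informative (i ∈ dom t')) => [it'|/(om_nle Hi Hd')]; last exact: Hy.
by rewrite (sub_ap Hs' ((in_branches y).1 yb) t'y it'); exact: Ht'.
Qed.

Lemma inT_exists t W z : t ∈ seqs D -> z ∈ D -> z ∈ W -> exists y, inT t W y.
Proof.
move=> tS zD zW; have [Hd Hs] := seqs_dom tS.
pose (F := fun i => ite (i ∈ dom t) (ap t i) z).
have DF : tdef (fun e => F (e 0)) by rewrite /F; df.
have Fin i : i ∈ dom t -> F i = ap t i by move=> H; rewrite /F ite_true.
have Hy : is_map M (lam om F) (fun n => n ∈ om) (fun z => z ∈ D).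
  apply: lam_map => // i Hi; rewrite /F.
  case: (excluded_middle_informative (i ∈ dom t)) => H; last by rewrite ite_false.
  by rewrite ite_true //; exact: (map_val Hs H).
exists (lam om F); split; first exact/in_branches.
split.
  apply: (map_sub Hs Hy) => i it; have Hi := om_in Hd it.
  by rewrite ap_lam // Fin.
move=> i Hi ti; rewrite ap_lam // /F ite_false // => it.
exact: (mem_irr (ti _ it)).
Qed.

Lemma ext_snoc t W z : t ∈ seqs D -> z ∈ D -> z ∈ W ->
  ext_in t W (snoc t (dom t) z) /\ dom (snoc t (dom t) z) = succ (dom t).
Proof.
move=> tS zD zW; have [Hd Hs] := seqs_dom tS.
have Hs' : isseq (snoc t (dom t) z) (succ (dom t)) (fun z => z ∈ D) by exact: snoc_isseq.
have Ed : dom (snoc t (dom t) z) = succ (dom t) by apply: (dom_eq _ Hs'); exact: om_succ.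
split=> //; split; first by apply/in_seqs; exists (succ (dom t)); split=> //; exact: om_succ.
split; first exact: snoc_sub.
move=> i; rewrite Ed => /in_succ [it ti|-> _]; first by case: (mem_irr (ti _ it)).
by rewrite (ap_snoc Hs zD).
Qed.

Lemma ext_trans t W t' t'' : ext_in t W t' -> ext_in t' W t'' -> ext_in t W t''.
Proof.
move=> [t'S [tt' Ht']] [t''S [t't'' Ht'']]; split=> //; split=> [z /tt' /t't'' //|i it ti].
have [Hd' Hs'] := seqs_dom t'S; have [Hd'' Hs''] := seqs_dom t''S.
case: (excluded_middle_informative (i ∈ dom t')) => [it'|H].
  by rewrite (sub_ap Hs' Hs'' t't'' it'); exact: Ht'.
by apply: Ht'' => //; apply: (om_nle (om_in Hd'' it) Hd').
Qed.

Lemma ext_refl t W : t ∈ seqs D -> ext_in t W t.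
Proof. by move=> tS; split=> //; split=> [z //|i it ti]; case: (mem_irr (ti _ it)). Qed.

Lemma D_nonempty : exists z, z ∈ D.
Proof.
have [[Hm _] _] := Htau.
have pe : partial_play_II M f emp.
  exists emp; split; first exact/in_om/om_emp.
  by apply: map_intro => [q /in_emp|i /in_emp].
have [Uo [x xU]] := map_val Hm pe; have xX := open_sub HX Uo xU.
have fr : ran M f (ap f x) by apply/(ranP Hf); exists x.
by have [z [zD _]] := Ddense (open_all HY) fr (ran_sub Hf fr); exists z.
Qed.

(** The images of the limits of all the plays that continue [t] within [W] avoid [w]. *)
Definition avoids t W w : Prop := forall y, inT t W y -> ~ ap f (phi y) ∈ w.

Ltac dfu := rewrite ?/avoids ?/inT ?/ext_in ?/phi ?/runI; df.

(** Some play [t] cannot be continued, within some [W], so as to avoid one of the first two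
    sets of some triple [p]. Otherwise Player II would decide one triple after the other, and
    when the second set is avoided restrict later answers to the third; the answers would
    converge to the image [l] of the limit, since for a triple with [l] in its first set it is
    the second that has been avoided. *)
Lemma undecided : exists t W p, t ∈ seqs D /\ p ∈ P /\ (exists z, z ∈ D /\ z ∈ W) /\
  forall t', ext_in t W t' ->
    (exists y, inT t' W y /\ ap f (phi y) ∈ ap w1 p) /\
    (exists y, inT t' W y /\ ap f (phi y) ∈ ap w2 p).
Proof.
apply: NNPP => no.
have decide t W p : t ∈ seqs D -> p ∈ P -> (exists z, z ∈ D /\ z ∈ W) ->
    exists t', ext_in t W t' /\ (avoids t' W (ap w1 p) \/ avoids t' W (ap w2 p)).
  move=> tS pP zW; apply: NNPP => nd; apply: no; exists t, W, p.
  split=> //; split=> //; split=> // t' Ht'; split; apply: NNPP => ny; apply: nd; exists t'.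
    by split=> //; left=> y yT fy; apply: ny; exists y.
  by split=> //; right=> y yT fy; apply: ny; exists y.
have [h [Hh hI]] := (countableP P).1 (apart_countable HP).
have [g Hg] := (countableP (seqs D)).1 (countable_seqs (hR := hR) Dcount).
pose (nx := fun n t W t' => ext_in t W t' /\ dom t ∈ dom t' /\
  forall p, p ∈ P -> ap h p = n -> avoids t' W (ap w1 p) \/ avoids t' W (ap w2 p)).
pose (nt := fun n t W => pick g (seqs D) (nx n t W)).
(* The answers are confined to the third set of the triple with code [n] when its second
   set is avoided. *)
pose (nW := fun n t' W => sep W (fun z => forall p, p ∈ P -> ap h p = n ->
  avoids t' W (ap w2 p) -> z ∈ ap w3 p)).
have innW n t' W z : z ∈ nW n t' W <-> z ∈ W /\ forall p, p ∈ P -> ap h p = n ->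
    avoids t' W (ap w2 p) -> z ∈ ap w3 p.
  by apply: in_sep; dfu.
pose (ok := fun t W => t ∈ seqs D /\ W ∈ opens Y /\ (exists z, z ∈ D /\ z ∈ W) /\
  forall y, inT t W y -> ap f (phi y) ∈ W).
have fphi y : y ∈ branches -> ap f (phi y) ∈ pts Y by move=> /phi_pts H; exact: (map_val Hf H).
have avoid_ext t t' W w : t ∈ seqs D -> ext_in t W t' -> avoids t W w -> avoids t' W w.
  by move=> tS Ht' H y /(inT_ext tS Ht') /H.
have step n t W : n ∈ om -> ok t W -> nx n t W (nt n t W) /\ ok (nt n t W) (nW n (nt n t W) W).
  move=> Hn [tS [Wo [[z [zD zW]] TW]]].
  have [t'S Hnx] : nt n t W ∈ seqs D /\ nx n t W (nt n t W).
    apply: pickP => //; first by rewrite /nx; dfu.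
    have [t1 [Ht1 dec1]] : exists t1, ext_in t W t1 /\
        forall p, p ∈ P -> ap h p = n -> avoids t1 W (ap w1 p) \/ avoids t1 W (ap w2 p).
      case: (excluded_middle_informative (exists p, p ∈ P /\ ap h p = n)) => [[p [pP Ep]]|np].
        have [|t1 [Ht1 dec]] := decide t W p tS pP; first by exists z.
        by exists t1; split=> // p' p'P Ep'; have -> : p' = p by apply: hI => //; rewrite Ep.
      by exists t; split=> [|p pP Ep]; [exact: ext_refl|case: np; exists p].
    have t1S : t1 ∈ seqs D by case: Ht1.
    have [Hs Ed] := ext_snoc t1S zD zW.
    exists (snoc t1 (dom t1) z); have [H _] := Hs; split=> //.
    have [Hd1 Hs1] := seqs_dom t1S; have [Hd Hst] := seqs_dom tS.
    split; first exact: (ext_trans Ht1 Hs).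
    split; last first.
      by move=> p pP Ep; case: (dec1 p pP Ep) => A; [left|right]; exact: (avoid_ext _ _ _ _ t1S Hs A).
    rewrite Ed; apply/in_succ_sub => // i it.
    by have [_ [tt1 _]] := Ht1; have [] := map_dom Hs1 (tt1 _ (map_pr Hst it)).
  split=> //; have [Hext [_ dec]] := Hnx; set t' := nt n t W in t'S Hnx Hext dec *.
  have T'W y : inT t' W y -> ap f (phi y) ∈ nW n t' W.
    move=> yT; apply/innW; split; first by apply: TW; exact: (inT_ext tS Hext yT).
    move=> p pP Ep av; have [yb _] := yT.
    by case: (apart_cover HP pP (fphi y yb)) => // /(av y yT).
  have nWW : nW n t' W ⊆ W by move=> z' /innW [].
  have nWo : nW n t' W ∈ opens Y.
    apply: (open_local HY) => [z' /nWW|z' z'n]; first exact: (open_sub HY).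
    have [z'W Hz'] := (innW _ _ _ _).1 z'n.
    case: (excluded_middle_informative (exists p, p ∈ P /\ ap h p = n /\ avoids t' W (ap w2 p)))
      => [[p [pP [Ep av]]]|np].
      have [V [Vo [z'V [VW V3]]]] := open_cap HY Wo (apart_open3 HP pP) z'W (Hz' p pP Ep av).
      exists V; split=> //; split=> // v vV; apply/innW; split; first exact: VW.
      by move=> p' p'P Ep' _; have -> : p' = p by [apply: hI => //; rewrite Ep]; exact: V3.
    exists W; split=> //; split=> // v vW; apply/innW; split=> // p pP Ep av.
    by case: np; exists p.
  split=> //; split=> //; split; last first.
    by move=> y [yb [ty Hy]]; apply: T'W; split=> //; split=> // i Hi ti; apply/nWW/Hy.
  have [y yT] := inT_exists t'S zD zW; have [yb _] := yT.
  apply: (Ddense nWo _ (T'W y yT)); apply/(ranP Hf); exists (phi y); split=> //; exact: phi_pts.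
pose (st := fun n => rec (pr emp (pts Y))
  (fun n q => pr (nt n (pfst q) (psnd q)) (nW n (nt n (pfst q) (psnd q)) (psnd q))) n).
pose (t_ := fun n => pfst (st n)); pose (W_ := fun n => psnd (st n)).
have Dst : tdef (fun e => st (e 0)) by rewrite /st /nt /nW /nx; dfu.
have st0 : st emp = pr emp (pts Y) by rewrite /st rec0 // /nt /nW /nx; dfu.
have stS n : n ∈ om -> st (succ n) =
    pr (nt n (t_ n) (W_ n)) (nW n (nt n (t_ n) (W_ n)) (W_ n)).
  by move=> Hn; rewrite /st recS // /nt /nW /nx; dfu.
have all_ok : forall n, n ∈ om -> ok (t_ n) (W_ n).
  apply: om_ind; first by rewrite /ok /t_ /W_; dfu.
    rewrite /t_ /W_ st0 pfst_pr psnd_pr; split.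
      apply/in_seqs; exists emp; split; first exact: om_emp.
      by apply: map_intro => [q /in_emp|i /in_emp].
    split; first exact: (open_all HY).
    split=> [|y [yb _]]; last exact: fphi.
    by have [z zD] := D_nonempty; exists z; split=> //; exact: (ran_sub Hf (Dran zD)).
  move=> n Hn H; rewrite /t_ /W_ stS // pfst_pr psnd_pr.
  exact: (step n _ _ Hn H).2.
have tS n : n ∈ om -> t_ n ∈ seqs D by move=> /all_ok [].
have tnx n : n ∈ om -> nx n (t_ n) (W_ n) (t_ (succ n)).
  by move=> Hn; rewrite {2}/t_ stS // pfst_pr; exact: (step n _ _ Hn (all_ok n Hn)).1.
have WS n : n ∈ om -> W_ (succ n) = nW n (t_ (succ n)) (W_ n).
  by move=> Hn; rewrite {1}/W_ {1}/t_ stS // pfst_pr psnd_pr.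
have Dt : tdef (fun e => t_ (e 0)) by rewrite /t_; df.
have DW : tdef (fun e => W_ (e 0)) by rewrite /W_; df.
have tseq n : n ∈ om -> exists d, d ∈ om /\ isseq (t_ n) d (fun z => z ∈ D).
  by move=> /tS /in_seqs.
have tsub n : n ∈ om -> t_ n ⊆ t_ (succ n) by move=> /tnx [[_ []]].
have tdom : forall n, n ∈ om -> n ⊆ dom (t_ n).
  apply: om_ind; [by df|by move=> z /in_emp|].
  move=> n Hn IH; have [_ [H _]] := tnx n Hn.
  have [Hd _] := seqs_dom (tS n Hn); have [Hd' _] := seqs_dom (tS _ (om_succ Hn)).
  apply/(succ_sub Hn Hd'); case: ((om_sub Hn Hd).1 IH) => [K|E].
    exact: (om_trans Hd' H K).
  by rewrite {1}E.
(* The chain is indexed from 1 on, so that the length at stage [n] exceeds [n]. *)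
pose (u := fun n => t_ (succ n)).
have Du : tdef (fun e => u (e 0)) by rewrite /u; df.
have useq n : n ∈ om -> exists d, d ∈ om /\ isseq (u n) d (fun z => z ∈ D).
  by move=> /om_succ; exact: tseq.
have usub n : n ∈ om -> u n ⊆ u (succ n) by move=> /om_succ; exact: tsub.
have udom n : n ∈ om -> n ∈ dom (u n).
  by move=> Hn; apply: (tdom _ (om_succ Hn)); exact: succ_self.
have Hy := chain_map Du useq usub udom; set y := chain u in Hy.
have yb : y ∈ branches by apply/in_branches.
have Wsub n m : n ∈ om -> m ∈ om -> n ⊆ m -> W_ m ⊆ W_ n.
  move=> Hn Hm nm.
  have E k : k ∈ om -> ap (lam om W_) k = W_ k by exact: ap_lam.
  rewrite -!E //; apply: dec_om => // i Hi; rewrite !E //; last exact: om_succ.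
  by rewrite WS // => z /innW [].
have ty n : n ∈ om -> t_ n ⊆ y.
  by move=> Hn p /(tsub _ Hn) Hp; exact: (chain_sub Du Hn Hp).
have yT n : n ∈ om -> inT (t_ n) (W_ n) y.
  move=> Hn; split=> //; split; first exact: ty.
  have H : forall k, k ∈ om -> n ⊆ k -> forall i, i ∈ dom (t_ k) -> dom (t_ n) ⊆ i ->
      ap (t_ k) i ∈ W_ n.
    apply: om_ind_from => //; first by df.
      by move=> i it ti; case: (mem_irr (ti _ it)).
    move=> k Hk nk' IH i it ti.
    have [Hd Hs] := seqs_dom (tS k Hk); have [Hd' Hs'] := seqs_dom (tS _ (om_succ Hk)).
    case: (excluded_middle_informative (i ∈ dom (t_ k))) => [ik|/(om_nle (om_in Hd' it) Hd) ki].
      by rewrite (sub_ap Hs Hs' (tsub k Hk) ik); exact: IH.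
    by have [[_ [_ Hext]] _] := tnx k Hk; apply: (Wsub n k Hn Hk nk'); exact: Hext.
  move=> i Hi ti; rewrite (chain_ap Du useq usub udom Hi (udom i Hi)).
  have [k [Hk [nk ik]]] := om_max Hn (om_succ Hi).
  have [_ Hs] := seqs_dom (tS _ (om_succ Hi)); have [_ Hs'] := seqs_dom (tS k Hk).
  have Ei : ap (t_ k) i = ap y i.
    apply: esym; apply: (sub_ap Hs' Hy (ty k Hk)); apply: (tdom k Hk); apply: ik; exact: succ_self.
  rewrite -(chain_ap Du useq usub udom Hi (udom i Hi)) -/y -Ei; apply: H => //.
  by apply: (tdom k Hk); apply: ik; exact: succ_self.
have [_ nconv] := phi_spec yb; apply: nconv => V Vo fV.
have [p [pP [f1 p3]]] := apart_at HP Vo fV.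
have Hn := Hh p pP; have Hn' := om_succ Hn.
have [Hext [_ dec]] := tnx _ Hn.
have yT' : inT (t_ (succ (ap h p))) (W_ (ap h p)) y.
  have [_ [ty' Hy']] := yT _ Hn'; split=> //; split=> // i Hi ti.
  apply: (Wsub _ (succ (ap h p))) => //; last exact: Hy'.
  by move=> z zn; apply/in_succ; left.
have [Hd _] := seqs_dom (tS _ Hn').
exists (dom (t_ (succ (ap h p)))); split=> // i Hi ti; apply: p3.
have [_ [_ Hy']] := yT _ Hn'.
have := Hy' i Hi ti; rewrite WS // => /innW [_ H]; apply: H => //.
by case: (dec p pP erefl) => // /(_ y yT').
Qed.

Section Tree.
Variables (t0 W p : M).
Hypotheses (t0S : t0 ∈ seqs D) (pP : p ∈ P) (HW : exists z, z ∈ D /\ z ∈ W).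
Hypothesis und : forall t', ext_in t0 W t' ->
  (exists y, inT t' W y /\ ap f (phi y) ∈ ap w1 p) /\
  (exists y, inT t' W y /\ ap f (phi y) ∈ ap w2 p).

(** The plays that continue [t0] within [W]. *)
Definition nodes : M := sep (seqs D) (ext_in t0 W).

Lemma in_nodes t : t ∈ nodes <-> ext_in t0 W t.
Proof. by rewrite in_sep; [split=> [[]//|H]; have [] := H|dfu]. Qed.

(* A continuation of each node whose limit has its image in [w]. *)
Lemma node_choice w : (forall t, ext_in t0 W t -> exists y, inT t W y /\ ap f (phi y) ∈ w) ->
  exists h, forall t, ext_in t0 W t -> inT t W (ap h t) /\ ap f (phi (ap h t)) ∈ w.
Proof.
move=> H; pose (S := fun t => sep branches (fun y => inT t W y /\ ap f (phi y) ∈ w)).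
have inS t y : y ∈ S t <-> y ∈ branches /\ inT t W y /\ ap f (phi y) ∈ w.
  by apply: in_sep; dfu.
have [|||||||h Hh] := countable_choice hAC (I := nodes) (S := S) (j := id) (C := prod om D).
- apply: (@countable_sub _ _ _ (seqs D)); last exact: (countable_seqs (hR := hR)).
  by move=> t /in_nodes [].
- by apply: countable_prod => //; exact: countable_om.
- by rewrite /S; dfu.
- by df.
- move=> t y _ /inS [/in_branches Hy _] q /(map_in Hy) [i [Hi ->]].
  by apply/pr_in_prod; split=> //; exact: (map_val Hy Hi).
- by [].
- by move=> t /in_nodes /H [y [yT fy]]; exists y; apply/inS; have [yb _] := yT.
by exists h => t /in_nodes /Hh /inS [].
Qed.

(** A path is a sequence of branches, each of which is the previous one or a chosen
    continuation of its initial segment of the current length; [K] is the set of the limits of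
    all paths. It is compact by the argument of the lemma of Koenig, each step having three
    options. The two jumps at a high level lead to points of [K] close to the given point, with
    images in the two separated sets. *)
Lemma tree_compact : exists K, K ⊆ pts X /\ nonempty M K /\ compact X K /\
  ~ exists x, continuity_point X Y f K x.
Proof.
have [h1 Hh1] := node_choice (fun t Ht => (und Ht).1).
have [h2 Hh2] := node_choice (fun t Ht => (und Ht).2).
have [Hd0 Hs0] := seqs_dom t0S.
have [y0 y0L] : exists y, inT t0 W y by have [z [zD zW]] := HW; exact: (inT_exists t0S zD zW).
have leaf_node y m : inT t0 W y -> m ∈ om -> dom t0 ⊆ m -> ext_in t0 W (restr y m).
  move=> [yb [ty Hy]] Hm tm; have Hr := branch_restr yb Hm.
  split; first by apply/in_seqs; exists m.
  split=> [q qt|i].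
    have [i [it Eq]] := map_in Hs0 qt; rewrite Eq; apply/in_restr.
    by rewrite -Eq; split; [exact: ty|exact: tm].
  rewrite (dom_eq Hm Hr) => im ti; rewrite branch_ap //; apply: Hy => //; exact: (om_in Hm im).
(* One step along the tree: keep the branch [y], or jump at level [m] to one of the two
    chosen continuations of its initial segment. *)
pose (jump := fun m y y' => y' = y \/
  dom t0 ⊆ m /\ (y' = ap h1 (restr y m) \/ y' = ap h2 (restr y m))).
have jumpP m y y' : m ∈ om -> inT t0 W y -> jump m y y' -> inT t0 W y' /\ restr y' m = restr y m.
  move=> Hm yL J.
  have cont y'' : dom t0 ⊆ m -> inT (restr y m) W y'' -> inT t0 W y'' /\ restr y'' m = restr y m.
    move=> tm yT; have [yb _] := yL; have [y''b [sub _]] := yT.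
    split; first exact: (inT_ext t0S (leaf_node y m yL Hm tm) yT).
    by apply: esym; exact: (sub_restr (branch_restr yb Hm) ((in_branches _).1 y''b) sub).
  case: J => [->//|[tm [->|->]]]; apply: cont => //.
    exact: (Hh1 _ (leaf_node y m yL Hm tm)).1.
  exact: (Hh2 _ (leaf_node y m yL Hm tm)).1.
pose (path := fun g => is_map M g (fun n => n ∈ om) (inT t0 W) /\ ap g emp = y0 /\
  forall m, m ∈ om -> jump m (ap g m) (ap g (succ m))).
(* The branch that a path converges to. *)
pose (lim := fun g => lam om (fun n => ap (ap g (succ n)) n)).
have Dlim g : tdef (fun e => ap (ap g (succ (e 0))) (e 0)) by df.
have path_stable g n m : path g -> n ∈ om -> m ∈ om -> n ⊆ m ->
    restr (ap g m) n = restr (ap g n) n.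
  move=> [Hg [g0 gS]] Hn; move: m; apply: om_ind_from => //; first by df.
  move=> m Hm nm' IH; rewrite -IH; have gm : inT t0 W (ap g m) by exact: (map_val Hg Hm).
  have gm' : inT t0 W (ap g (succ m)) by exact: (map_val Hg (om_succ Hm)).
  have [_ E] := jumpP m _ _ Hm gm (gS m Hm); have [b _] := gm; have [b' _] := gm'.
  by apply: restr_eq => // i ni; rewrite -(branch_ap b' Hm (nm' _ ni)) -(branch_ap b Hm (nm' _ ni)) E.
have lim_ap g n : n ∈ om -> ap (lim g) n = ap (ap g (succ n)) n.
  by move=> Hn; rewrite /lim ap_lam.
have lim_b g : path g -> lim g ∈ branches.
  move=> [Hg _]; apply/in_branches; apply: lam_map => // n Hn.
  have [/in_branches b _] := map_val Hg (om_succ Hn); exact: (map_val b Hn).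
have lim_restr g m : path g -> m ∈ om -> restr (lim g) m = restr (ap g m) m.
  move=> pg Hm; have [Hg _] := pg; have [b _] := map_val Hg Hm.
  apply: restr_eq => //; first exact: lim_b.
  move=> i im; have Hi := om_in Hm im; rewrite lim_ap //.
  have sm : succ i ⊆ m by apply/(succ_sub Hi Hm).
  have [b' _] := map_val Hg (om_succ Hi).
  rewrite -(branch_ap b' (om_succ Hi) (succ_self i)).
  by rewrite -(path_stable g (succ i) m pg (om_succ Hi) Hm sm) branch_ap //; [exact: om_succ|exact: succ_self].
have lim_in g m : path g -> m ∈ om -> phi (lim g) ∈ ap tau (restr (ap g m) m).
  by move=> pg Hm; rewrite -lim_restr //; apply: phi_in => //; exact: lim_b.
have Djump : dfn (fun e => jump (e 2) (e 1) (e 0)) by rewrite /jump; df.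
have Dpath : dfn (fun e => path (e 0)) by rewrite /path /jump; dfu.
have Dphilim : tdef (fun e => phi (lim (e 0))) by rewrite /lim; dfu.
pose (K := sep (pts X) (fun x => exists g, path g /\ x = phi (lim g))).
have inK x : x ∈ K <-> exists g, path g /\ x = phi (lim g).
  rewrite /K in_sep; last by df.
  split=> [[]//|[g [pg ->]]]; split; last by exists g.
  by apply: phi_pts; exact: lim_b.
have path0 : path (lam om (fun _ => y0)).
  have E n : n ∈ om -> ap (lam om (fun _ => y0)) n = y0 by move=> Hn; rewrite ap_lam //; df.
  split; first by apply: lam_map => //; df.
  by split=> [|m Hm]; rewrite !E //; [exact: om_emp|left|exact: om_succ].
exists K; split; first by move=> x /(in_sep _ _) []; [df|].
split; first by exists (phi (lim (lam om (fun _ => y0)))); apply/inK; exists (lam om (fun _ => y0)).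
split.
  move=> F FO cov; apply: NNPP => nofin.
  (* The limits of the paths that are at [y] at level [m] have no finite subcover. *)
  pose (nc := fun m y => ~ exists G, G ⊆ F /\ finite M G /\
    forall g, path g -> ap g m = y -> exists U, U ∈ G /\ phi (lim g) ∈ U).
  have Dnc : dfn (fun e => nc (e 1) (e 0)) by rewrite /nc /lim; dfu.
  have nc0 : nc emp y0.
    move=> [G [GF [Gfin H]]]; apply: nofin; exists G; split=> //; split=> // x /inK [g [pg ->]].
    by apply: H => //; have [_ []] := pg.
  have ncS m y : m ∈ om -> inT t0 W y -> nc m y ->
      nc (succ m) y \/ dom t0 ⊆ m /\
        (nc (succ m) (ap h1 (restr y m)) \/ nc (succ m) (ap h2 (restr y m))).
    move=> Hm yL ncm; apply: NNPP => no; apply: ncm.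
    have [G [GF [Gfin HG]]] := NNPP _ (fun H => no (or_introl H)).
    case: (excluded_middle_informative (dom t0 ⊆ m)) => [tm|ntm]; last first.
      exists G; split=> //; split=> // g pg Eg; apply: HG => //.
      have [_ [_ J]] := pg; rewrite -Eg; case: (J m Hm) => [//|[tm _]].
      by case: ntm.
    have [G1 [G1F [G1fin HG1]]] := NNPP _ (fun H => no (or_intror (conj tm (or_introl H)))).
    have [G2 [G2F [G2fin HG2]]] := NNPP _ (fun H => no (or_intror (conj tm (or_intror H)))).
    exists (cup G (cup G1 G2)).
    split; first by move=> U /in_cup [/GF|/in_cup [/G1F|/G2F]].
    split; first by apply: finite_cup => //; exact: finite_cup.
    move=> g pg Eg; have [_ [_ J]] := pg; have := J m Hm; rewrite Eg.
    case=> [E|[_ [E|E]]].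
    - by have [U [UG Ux]] := HG g pg E; exists U; split=> //; apply/in_cup; left.
    - have [U [UG Ux]] := HG1 g pg E; exists U; split=> //; apply/in_cup; right.
      by apply/in_cup; left.
    - have [U [UG Ux]] := HG2 g pg E; exists U; split=> //; apply/in_cup; right.
      by apply/in_cup; right.
  pose (nx := fun m y => ite (nc (succ m) y) y
    (ite (nc (succ m) (ap h1 (restr y m))) (ap h1 (restr y m)) (ap h2 (restr y m)))).
  have nxP m y : m ∈ om -> inT t0 W y -> nc m y -> jump m y (nx m y) /\ nc (succ m) (nx m y).
    move=> Hm yL ncm; rewrite /nx.
    case: (excluded_middle_informative (nc (succ m) y)) => H.
      by rewrite ite_true //; split=> //; left.
    rewrite ite_false //; case: (ncS m y Hm yL ncm) => // -[tm H1].
    case: (excluded_middle_informative (nc (succ m) (ap h1 (restr y m)))) => H'.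
      by rewrite ite_true //; split=> //; right; split=> //; left.
    rewrite ite_false //; case: H1 => // H2; split=> //; right; split=> //; by right.
  have Dnx : tdef (fun e => nx (e 1) (e 0)) by rewrite /nx; df.
  pose (g_ := fun m => rec y0 nx m).
  have Dg : tdef (fun e => g_ (e 0)) by rewrite /g_; df.
  have g0 : g_ emp = y0 by rewrite /g_ rec0.
  have gS m : m ∈ om -> g_ (succ m) = nx m (g_ m) by move=> Hm; rewrite /g_ recS.
  have inv : forall m, m ∈ om -> inT t0 W (g_ m) /\ nc m (g_ m).
    apply: om_ind; [by rewrite /inT; df|by rewrite g0|].
    move=> m Hm [gL gn]; rewrite gS //; have [J H] := nxP m _ Hm gL gn; split=> //.
    exact: (jumpP m _ _ Hm gL J).1.
  have apg m : m ∈ om -> ap (lam om g_) m = g_ m by move=> Hm; rewrite ap_lam.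
  have pg : path (lam om g_).
    split; first by apply: lam_map => // m /inv [].
    split=> [|m Hm]; first by rewrite apg //; exact: om_emp.
    rewrite !apg //; last exact: om_succ.
    by have [gL gn] := inv m Hm; rewrite gS //; exact: (nxP m _ Hm gL gn).1.
  have [|U [UF xU]] := cov (phi (lim (lam om g_))); first by apply/inK; exists (lam om g_).
  have [n [Hn sub]] := phi_base (lim_b _ pg) (FO U UF) xU.
  have [_ ncn] := inv n Hn; apply: ncn; exists (upr U U).
  split; first by move=> V /in_upr [->|->].
  split; first exact: finite_sg.
  move=> g' pg' Eg'; exists U; split; first by apply/in_upr; left.
  apply: sub; rewrite lim_restr // apg // -Eg'; exact: lim_in.
move=> [x [/inK [g [pg Ex]] Hc]]; subst x.
have lb := lim_b g pg; have xX := phi_pts lb.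
have lY : ap f (phi (lim g)) ∈ pts Y by exact: (map_val Hf xX).
have [V [Vo [lV sepV]]] := apart_sep HP pP lY.
have [|U [Uo [xU HU]]] := Hc (ap f (phi (lim g))) V _ Vo lV; first exact/(map_app _ _ Hf).
have [n [Hn nU]] := phi_base lb Uo xU.
have [m [Hm [nm tm]]] := om_max Hn Hd0.
have [Hg [g0 gS]] := pg; have gmL : inT t0 W (ap g m) by exact: (map_val Hg Hm).
have Hnode : ext_in t0 W (restr (ap g m) m) by exact: leaf_node.
(* The path that follows [g] up to level [m] and then jumps to [y1] stays in [U]. *)
have reach y1 : y1 = ap h1 (restr (ap g m) m) \/ y1 = ap h2 (restr (ap g m) m) ->
    ap f (phi y1) ∈ V.
  move=> Ey; have J1 : jump m (ap g m) y1 by right.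
  have [y1L Er] := jumpP m _ _ Hm gmL J1; have [y1b _] := y1L.
  pose (G := fun j => ite (j ⊆ m) (ap g j) y1).
  have DG : tdef (fun e => G (e 0)) by rewrite /G; df.
  have apG j : j ∈ om -> ap (lam om G) j = G j by move=> Hj; rewrite ap_lam.
  have G1 j : j ⊆ m -> G j = ap g j by move=> H; rewrite /G ite_true.
  have G2 j : ~ j ⊆ m -> G j = y1 by move=> H; rewrite /G ite_false.
  have pG : path (lam om G).
    split.
      apply: lam_map => // j Hj; case: (excluded_middle_informative (j ⊆ m)) => H.
        by rewrite G1 //; exact: (map_val Hg Hj).
      by rewrite G2.
    split; first by rewrite apG ?G1 //; [move=> z /in_emp|exact: om_emp].
    move=> j Hj; rewrite !apG //; last exact: om_succ.
    case: (excluded_middle_informative (succ j ⊆ m)) => H.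
      rewrite !G1 //; first exact: gS.
      by move=> z zj; apply: H; apply/in_succ; left.
    rewrite (G2 _ H); case: (excluded_middle_informative (j ⊆ m)) => H'; last by rewrite G2 //; left.
    have -> : j = m by case: ((om_sub Hj Hm).1 H') => // /(succ_sub Hj Hm).
    by rewrite G1 // => z.
  have E : lim (lam om G) = y1.
    have HG' := (in_branches _).1 (lim_b _ pG).
    apply: (map_ext HG' ((in_branches _).1 y1b)) => // i Hi.
    rewrite lim_ap // apG; last exact: om_succ.
    case: (excluded_middle_informative (succ i ⊆ m)) => H; last by rewrite G2.
    rewrite G1 //; have im : i ∈ m by apply: H; exact: succ_self.
    have [gmb _] := gmL; have [gib _] := map_val Hg (om_succ Hi).
    rewrite -(branch_ap y1b Hm im) Er branch_ap //.
    rewrite -(branch_ap gib (om_succ Hi) (succ_self i)).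
    by rewrite -(path_stable g (succ i) m pg (om_succ Hi) Hm H) branch_ap //; [exact: om_succ|exact: succ_self].
  apply: (HU (phi y1)).
  - apply: nU; rewrite lim_restr //.
    rewrite -(path_stable g n m pg Hn Hm nm).
    have [gmb _] := gmL.
    by apply: (tau_dec gmb Hn Hm nm); rewrite -Er; exact: phi_in.
  - by apply/inK; exists (lam om G); rewrite E.
  - by apply/(map_app _ _ Hf); split=> //; exact: phi_pts.
case: sepV => dV.
- by apply: (dV _ (reach _ (or_introl erefl))); exact: (Hh1 _ Hnode).2.
- by apply: (dV _ (reach _ (or_intror erefl))); exact: (Hh2 _ Hnode).2.
Qed.
End Tree.

Theorem compact_of_I_wins : exists K, K ⊆ pts X /\ nonempty M K /\ compact X K /\
  ~ exists x, continuity_point X Y f K x.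
Proof.
have [t [W [p [tS [pP [HW und]]]]]] := undecided.
exact: (tree_compact tS pP HW und).
Qed.

End CompactOfI.

(** * The equivalence *)

Theorem corollary3p1 (M : structure) (R : field_data M)
  (hZF : ZF M) (hR : complete_ordered_field R) (hAC : AC_omega_R R) :
  all_games_determined R <-> GBT R.
Proof.
have top Z : sep_metrizable R Z -> topological Z by exact: sep_topological.
have bas Z : sep_metrizable R Z -> exists B S, basis Z B S by exact: sep_basis.
split=> H X Y f SX SY Hf; have HX := top X SX; have HY := top Y SY;
  have [BX [TX HB]] := bas X SX; have [BY [TY HBY]] := bas Y SY;
  have [P [w1 [w2 [w3 HP]]]] := sep_apart_family SY.
- split=> [Hb K KX K0 HK|Hc].
    exact: (Baire1_continuity hAC HX HB HBY Hf Hb HK KX K0).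
  have [[tau Htau]|[sigma Hsigma]] := H X Y f SX SY Hf.
    have [D [Dc [Dr Dd]]] := dense_range hAC HY HBY Hf.
    have [K [KX [K0 [HK no]]]] := compact_of_I_wins hAC HX HY HP Hf Htau Dc Dr Dd.
    by case: no; exact: (Hc K KX K0 HK).
  exact: (Baire1_of_II_wins HX HB HP Hf Hsigma).
- case: (excluded_middle_informative (Baire_class_1 X Y f)) => Hb.
    by right; exact: (II_wins_of_Baire1 hAC HX HB HY HBY Hf Hb).
  left; apply: NNPP => no; apply: Hb; apply/(H X Y f SX SY Hf) => K KX K0 HK.
  apply: NNPP => nc; apply: no.
  exact: (I_wins_of_compact hAC HX HB HP Hf HK KX K0 nc).
Qed.
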